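(* For every integer $n\ge 0$, the monic polynomial $P_n(z)$ defined by the moments $c_k=e^{\gamma wk+\gamma\alpha}\,\dfrac{\sigma(wk+\beta+\alpha)}{\sigma(wk+\alpha)\,\sigma(\beta)}$, $k\in\mathbb Z$, through the determinant formula $$P_n(z)=\frac{1}{\Delta_n}\begin{vmatrix} c_0&c_1&\dots&c_n\\ c_{-1}&c_0&\dots&c_{n-1}\\ \vdots&\vdots&&\vdots\\ c_{1-n}&c_{2-n}&\dots&c_1\\ 1&z&\dots&z^n\end{vmatrix},\qquad \Delta_n=\det(c_{k-i})_{i,k=0,\dots,n-1},$$ is expressed in terms of the elliptic hypergeometric function as $$P_n(z)=B_n\;{}_3E_2\left({-n,\ \hat\alpha+1,\ -(\hat\alpha+1)n-\hat\beta+1\atop \hat\alpha+1-n,\ -(\hat\alpha+1)n-\hat\beta};\,ze^{-\gamma w}\right),$$ where $\hat\alpha=\alpha/w$, $\hat\beta=\beta/w$ and $$B_n=e^{\gamma wn}\,\frac{[-\hat\alpha]_n}{[\hat\alpha+1]_n}\,\frac{[\hat\alpha n+\hat\beta+n]}{[\hat\alpha n+\hat\beta]}.$$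
   Context: $\sigma,\zeta$ denote the Weierstrass sigma and zeta functions of the lattice $\Lambda=2\omega_1\mathbb Z+2\omega_3\mathbb Z$ with $\omega_1>0$ and $\omega_3\in i\mathbb R_{>0}$; $\eta_1=\zeta(\omega_1)$. The parameter $w$ is real with $wN_1\ne\omega_1N_2$ for all integers $(N_1,N_2)\neq(0,0)$; $\alpha,\beta,\gamma$ are complex parameters. Nondegeneracy assumptions: $\alpha\notin w\mathbb Z+\Lambda$, and for all integers $n\ge0$: $\beta+n\alpha\notin\Lambda$ and $\beta+n(\alpha+w)\notin\Lambda$ (this corresponds to all Toeplitz determinants $\Delta_n=\det(c_{k-i})_{i,k=0}^{n-1}$ and $\Delta_n^{(1)}=\det(c_{1+k-i})_{i,k=0}^{n-1}$ being well defined and nonzero). Convention $\Delta_0=1$, $P_0=1$. Elliptic numbers: $[x]=\sigma(wx)/\sigma(w)$; elliptic Pochhammer symbol: $[x]_0=1$, $[x]_n=[x][x+1]\cdots[x+n-1]$. Elliptic hypergeometric function: $${}_{r+1}E_r\left({a_1,\dots,a_{r+1}\atop b_1,\dots,b_r};z\right)=\sum_{s=0}^\infty\frac{[a_1]_s\cdots[a_{r+1}]_s}{[1]_s[b_1]_s\cdots[b_r]_s}\,e^{Ms(s-1)}z^s,\qquad M=\frac{\eta_1}{2\omega_1}w^2\Bigl(1+\sum_{i=1}^r b_i-\sum_{i=1}^{r+1}a_i\Bigr).$$ When $a_1=-n$ the series terminates: it is understood as the sum over $0\le s\le n$. *)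

(* Defs.v *)
From mathcomp Require Import all_boot all_order all_algebra.
From mathcomp Require Import complex.
From mathcomp Require Import boolp classical_sets reals topology normedtype.
From mathcomp Require Import sequences exp trigo.

Set Implicit Arguments.
Unset Strict Implicit.
Unset Printing Implicit Defensive.

Import Order.TTheory GRing.Theory Num.Theory.
Import numFieldNormedType.Exports.

Local Open Scope classical_set_scope.
Local Open Scope ring_scope.
Local Open Scope complex_scope.

Definition cexp (R : realType) (z : R[i]) : R[i] :=
  (expR (complex.Re z) * cos (complex.Im z)) +i*
  (expR (complex.Re z) * sin (complex.Im z)).

(* [R[i]^o] carries the topology of the norm; [R[i]] itself has none. *)
Definition clim (R : realType) (u : nat -> R[i]) : R[i] :=
  lim ((u : nat -> R[i]^o) @ \oo).

Definition lattice_point (R : realType) (om1 om3 : R[i]) (m n : int) : R[i] :=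
  2 * om1 * m%:~R + 2 * om3 * n%:~R.

Definition lattice (R : realType) (om1 om3 : R[i]) : set R[i] :=
  [set z | exists m n : int, z = lattice_point om1 om3 m n].

Definition lattice_square (R : realType) (om1 om3 : R[i]) (N : nat) :
    seq R[i] :=
  [seq lattice_point om1 om3 (i%:Z - N%:Z) (j%:Z - N%:Z)
     | i <- iota 0 N.*2.+1, j <- iota 0 N.*2.+1].

(* The product and the series below converge absolutely, so that exhausting the
   lattice by the squares [-N, N] x [-N, N] of coordinates is harmless. *)
Definition weierstrass_sigma (R : realType) (om1 om3 z : R[i]) : R[i] :=
  z * clim (fun N => \prod_(l <- lattice_square om1 om3 N | l != 0)
                        ((1 - z / l) * cexp (z / l + (z / l) ^+ 2 / 2))).

Definition weierstrass_zeta (R : realType) (om1 om3 z : R[i]) : R[i] :=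
  z^-1 + clim (fun N => \sum_(l <- lattice_square om1 om3 N | l != 0)
                           ((z - l)^-1 + l^-1 + z / l ^+ 2)).

Definition ell_num (R : realType) (om1 om3 : R[i]) (w : R) (x : R[i]) : R[i] :=
  weierstrass_sigma om1 om3 (w%:C * x) / weierstrass_sigma om1 om3 w%:C.

Definition ell_poch (R : realType) (om1 om3 : R[i]) (w : R) (x : R[i])
    (n : nat) : R[i] :=
  \prod_(i < n) ell_num om1 om3 w (x + i%:R).

Definition poch_args (R : realType) (x : R[i]) (n : nat) : seq R[i] :=
  [seq x + i%:R | i <- iota 0 n].

(* [x_1]...[x_p] / ([y_1]...[y_q]), where elliptic numbers of the same argument
   are cancelled first: each distinct argument appears with the exponent
   (multiplicity in num) - (multiplicity in den).  This is the plain quotient as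
   soon as no denominator vanishes (see ell_quotE); the difference matters since
   x^-1 = 0 for x = 0.  In ratios such as [x+1]_s / [x]_s = [x+s] / [x], an
   intermediate [x+j] may vanish and the ratio still makes sense. *)
Definition ell_quot (R : realType) (om1 om3 : R[i]) (w : R)
    (num den : seq R[i]) : R[i] :=
  \prod_(x <- undup (num ++ den))
     ell_num om1 om3 w x ^ ((count_mem x num)%:Z - (count_mem x den)%:Z).

Definition ellE_M (R : realType) (om1 om3 : R[i]) (w : R)
    (a b : seq R[i]) : R[i] :=
  weierstrass_zeta om1 om3 om1 / (2 * om1) * w%:C ^+ 2
  * (1 + \sum_(y <- b) y - \sum_(x <- a) x).

Definition ellE_term (R : realType) (om1 om3 : R[i]) (w : R)
    (a b : seq R[i]) (z : R[i]) (s : nat) : R[i] :=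
  ell_quot om1 om3 w (flatten [seq poch_args x s | x <- a])
                     (flatten [seq poch_args y s | y <- 1 :: b])
  * cexp (ellE_M om1 om3 w a b * (s * s.-1)%:R) * z ^+ s.

(* The terminating series with upper parameters - n, a_2, ..., a_(r+1). *)
Definition ellE_terminating (R : realType) (om1 om3 : R[i]) (w : R) (n : nat)
    (a b : seq R[i]) (z : R[i]) : R[i] :=
  \sum_(s < n.+1) ellE_term om1 om3 w (- n%:R :: a) b z s.

Definition toeplitz_det (R : realType) (c : int -> R[i]) (n : nat) : R[i] :=
  \det (\matrix_(i < n, k < n) c (k%:Z - i%:Z)).

Definition toeplitz_poly (R : realType) (c : int -> R[i]) (n : nat) :
    {poly R[i]} :=
  (toeplitz_det c n)^-1 *:
  \det (\matrix_(i < n.+1, k < n.+1)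
          if (i < n)%N then (c (k%:Z - i%:Z))%:P else 'X^k).

Definition ell_moment (R : realType) (om1 om3 : R[i]) (w : R)
    (al be ga : R[i]) (k : int) : R[i] :=
  cexp (ga * w%:C * k%:~R + ga * al)
  * (weierstrass_sigma om1 om3 (w%:C * k%:~R + be + al)
     / (weierstrass_sigma om1 om3 (w%:C * k%:~R + al)
        * weierstrass_sigma om1 om3 be)).

Lemma prod_count_mem (T : eqType) (K : fieldType) (f : T -> K) (s r : seq T) :
  {subset s <= r} ->
  \prod_(x <- undup r) f x ^+ count_mem x s = \prod_(x <- s) f x.
Proof.
move=> sr; rewrite -[RHS](big_undup_iterop_count *%R s xpredT f)/=.
rewrite [RHS](_ : _ = \prod_(x <- undup s) f x ^+ count_mem x s)//.
rewrite (bigID (mem s))/= [X in _ * X]big1 ?mulr1; last first.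
  by move=> x /count_memPn ->; rewrite expr0.
rewrite -big_filter; apply: perm_big; apply: uniq_perm.
- by rewrite filter_uniq// undup_uniq.
- exact: undup_uniq.
move=> x; rewrite mem_filter !mem_undup.
by case: (boolP (x \in s)) => [/sr|].
Qed.

Lemma ell_quotE (R : realType) (om1 om3 : R[i]) (w : R) (num den : seq R[i]) :
  (forall y, y \in den -> ell_num om1 om3 w y != 0) ->
  ell_quot om1 om3 w num den
  = (\prod_(x <- num) ell_num om1 om3 w x)
    / \prod_(y <- den) ell_num om1 om3 w y.
Proof.
move=> den0; rewrite /ell_quot.
rewrite -(@prod_count_mem _ _ _ num (num ++ den)); last first.
  by move=> x xs; rewrite mem_cat xs.
rewrite -(@prod_count_mem _ _ _ den (num ++ den)); last first.
  by move=> x xs; rewrite mem_cat xs orbT.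
rewrite -prodf_div; apply: eq_bigr => x _.
have [xden|/count_memPn ->] := boolP (x \in den).
  by rewrite expfzDr ?den0// -exprnP exprnN.
by rewrite subr0 -exprnP expr0 divr1.
Qed.

Lemma prod_poch_args (R : realType) (om1 om3 : R[i]) (w : R) (a : seq R[i])
    (s : nat) :
  \prod_(x <- flatten [seq poch_args x s | x <- a]) ell_num om1 om3 w x
  = \prod_(x <- a) ell_poch om1 om3 w x s.
Proof.
rewrite big_flatten big_map; apply: eq_bigr => x _.
by rewrite big_map -[X in iota 0 X]subn0 -/(index_iota 0 s) big_mkord.
Qed.

Lemma ellE_termE (R : realType) (om1 om3 : R[i]) (w : R) (a b : seq R[i])
    (z : R[i]) (s : nat) :
  (forall y, y \in 1 :: b -> ell_poch om1 om3 w y s != 0) ->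
  ellE_term om1 om3 w a b z s
  = (\prod_(x <- a) ell_poch om1 om3 w x s)
    / (ell_poch om1 om3 w 1 s * \prod_(y <- b) ell_poch om1 om3 w y s)
    * cexp (ellE_M om1 om3 w a b * (s * s.-1)%:R) * z ^+ s.
Proof.
move=> b0; rewrite /ellE_term ell_quotE.
  by rewrite !prod_poch_args big_cons.
move=> y /flatten_mapP[x /b0 x0 yx].
move: yx => /mapP[j]; rewrite mem_iota add0n /= => si ->.
move: x0; rewrite /ell_poch prodf_seq_neq0 => /allP /(_ (Ordinal si)).
by apply; rewrite mem_index_enum.
Qed.

(* Main.v *)
(* The zeta function does not enter the polynomials: the parameters are balanced
   so that M = 0.  The determinants are controlled by exhibiting, for each n, the
   coefficient vector q of the claimed polynomial and checking that
   sum_s c_(s-i) q_s vanishes for i < n but not for i = n.  Up to a factor that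
   does not depend on s, each term is a product of sigma(x_s - y_j) over a product
   of sigma(x_s - x_k), where the x_k are w s (0 <= s <= n) together with
   w i - alpha and the sum of the x_k is the sum of the y_j; the sum is then minus
   the term of the extra node, by the sigma form of partial fractions.  The latter
   follows by induction from Weierstrass' three-term relation, which says that the
   functions sigma(x - a) sigma(x - c + a) of x span a space of dimension two.

   The three-term relation is proved without complex analysis.  Exhausting
   the lattice by rectangles [-M, M] x [-N, N] with M >> N and dropping the
   Gaussian factors exp(S_(M,N) u^2), which are invisible to the three-term
   relation, turns sigma into a product of sines as M goes to infinity, hence into
   a finite theta product.  The finite Jacobi triple product (the q-binomial theorem)
   expands it, and theta(a + b) theta(a - b) tends to O(a) E(b) - E(a) O(b) for
   two series E, O, so that the relation becomes a Pluecker identity. *)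

Require Import Defs.
From mathcomp Require Import all_boot all_order all_algebra.
From mathcomp Require Import complex zify ring lra.
From mathcomp Require Import boolp classical_sets reals topology normedtype.
From mathcomp Require Import sequences derive realfun exp trigo.

Set Implicit Arguments.
Unset Strict Implicit.
Unset Printing Implicit Defensive.

Import Order.TTheory GRing.Theory Num.Theory.
Import numFieldNormedType.Exports.

Local Open Scope classical_set_scope.
Local Open Scope ring_scope.
Local Open Scope complex_scope.

(** * Norms and limits of complex numbers *)

(** The obstacle is that the sum of 1/l^2 over the lattice does not converge absolutely. With its
    exponential, a pair {l, -l} contributes 1 + O(|l|^-4), so the full product does not depend on
    the exhausting rectangles; without it, M has to grow first, which turns each row into a sine.
    Both products are compared at the same (M, N), where they differ exactly by exp(S u^2). This
    drops out of the three-term relation because the squares of the four arguments have the same sum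
    in each of its three products. As the relation involves finitely many points, M can be chosen
    for each N so that all of them are close to their row limits; beyond this, boundedness in N is
    enough.

    The nonvanishing of the determinants is a by-product: the orthogonality sum at i = n is
    Delta_(n+1) / Delta_n, and up to nonzero constants it is the term of the extra node. The
    condition on beta + n alpha keeps its numerator nonzero, the one on alpha separates the extra
    node from the others, the one on w separates the nodes w s, and the one on beta + n (alpha + w)
    keeps a denominator of the coefficients nonzero. *)

Definition cn (R : realType) (z : R[i]) : R := complex.Re `|z|.

(** The norm of [R[i]] takes its values in [R[i]]; [cn] is the same number in the ordered field [R],
    where the estimates are carried out. *)
Lemma cnE (R : realType) (z : R[i]) : (cn z)%:C = `|z|.
Proof. by apply: RRe_real; rewrite normr_real. Qed.

Lemma cn_ge0 (R : realType) (z : R[i]) : 0 <= cn z.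
Proof. by rewrite -ler0c cnE normr_ge0. Qed.

Lemma cnM (R : realType) : {morph @cn R : z w / z * w}.
Proof. by move=> z w; apply: complexI; rewrite rmorphM/= !cnE normrM. Qed.

Lemma cn_eq0 (R : realType) (z : R[i]) : (cn z == 0) = (z == 0).
Proof. by rewrite -[RHS]normr_eq0 -cnE fmorph_eq0. Qed.

Lemma cn_gt0 (R : realType) (z : R[i]) : (0 < cn z) = (z != 0).
Proof. by rewrite lt_def cn_ge0 andbT cn_eq0. Qed.

Lemma cn_real (R : realType) (x : R) : cn x%:C = `|x|.
Proof.
by apply: complexI; rewrite cnE normc_def/= expr0n/= addr0 sqrtr_sqr.
Qed.

Lemma cn0 (R : realType) : cn (0 : R[i]) = 0.
Proof. by apply/eqP; rewrite cn_eq0. Qed.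

Lemma cn1 (R : realType) : cn (1 : R[i]) = 1.
Proof. by rewrite /cn normr1. Qed.

Lemma cn_nat (R : realType) n : cn (n%:R : R[i]) = n%:R.
Proof. by apply: complexI; rewrite cnE normr_nat rmorph_nat. Qed.

Lemma cnN (R : realType) (z : R[i]) : cn (- z) = cn z.
Proof. by rewrite /cn normrN. Qed.

Lemma cn_distC (R : realType) (z w : R[i]) : cn (z - w) = cn (w - z).
Proof. by rewrite /cn distrC. Qed.

Lemma cnV (R : realType) (z : R[i]) : cn z^-1 = (cn z)^-1.
Proof. by apply: complexI; rewrite fmorphV/= !cnE normfV. Qed.

Lemma cnX (R : realType) (z : R[i]) n : cn (z ^+ n) = cn z ^+ n.
Proof. by apply: complexI; rewrite rmorphXn/= !cnE normrX. Qed.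

Lemma ler_cnD (R : realType) (z w : R[i]) : cn (z + w) <= cn z + cn w.
Proof. by rewrite -lecR rmorphD/= !cnE ler_normD. Qed.

Lemma ler_cnB (R : realType) (z w : R[i]) : cn (z - w) <= cn z + cn w.
Proof. by rewrite (le_trans (ler_cnD _ _))// cnN. Qed.

Lemma ler_cn_dist (R : realType) (v z w : R[i]) :
  cn (z - w) <= cn (z - v) + cn (v - w).
Proof. by rewrite (le_trans _ (ler_cnD _ _))// addrA subrK. Qed.

Lemma ler_distcn (R : realType) (z w : R[i]) : cn z - cn w <= cn (z - w).
Proof. by rewrite lerBlDr (le_trans _ (ler_cnD _ _))// subrK. Qed.

Lemma cn_prod (R : realType) I (r : seq I) (P : pred I) (F : I -> R[i]) :
  cn (\prod_(i <- r | P i) F i) = \prod_(i <- r | P i) cn (F i).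
Proof. by apply: (big_morph _ (@cnM R)); rewrite cn1. Qed.

Lemma ler_cn_sum (R : realType) I (r : seq I) (P : pred I) (F : I -> R[i]) :
  cn (\sum_(i <- r | P i) F i) <= \sum_(i <- r | P i) cn (F i).
Proof.
by rewrite -lecR cnE rmorph_sum/= (le_trans (ler_norm_sum _ _ _))//;
  rewrite le_eqVlt; apply/orP; left; apply/eqP/eq_bigr => i _; rewrite cnE.
Qed.

Lemma ler_normRe (R : realType) (z : R[i]) : `|complex.Re z| <= cn z.
Proof. by rewrite -lecR cnE normc_ge_Re. Qed.

Lemma ler_normIm (R : realType) (z : R[i]) : `|complex.Im z| <= cn z.
Proof.
have -> : cn z = cn (z * 'i) by rewrite cnM -[X in _ * X](_ : 1 = _) ?mulr1// /cn
  normc_def/= expr0n/= add0r expr1n sqrtr1.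
by rewrite (le_trans _ (ler_normRe _))// ReiNIm normrN.
Qed.

Lemma cn_leReIm (R : realType) (z : R[i]) :
  cn z <= `|complex.Re z| + `|complex.Im z|.
Proof.
rewrite {1}(complexE z) (le_trans (ler_cnD _ _))// cnM !cn_real.
rewrite lerD2l (_ : cn _ = 1) ?mul1r//.
by rewrite /cn normc_def/= expr0n/= add0r expr1n sqrtr1.
Qed.

Definition ccvg (R : realType) (u : nat -> R[i]) (l : R[i]) : Prop :=
  (u : nat -> R[i]^o) @ \oo --> (l : R[i]^o).

Lemma ccvgP (R : realType) (u : nat -> R[i]) l :
  ccvg u l <-> (fun n => cn (u n - l)) @ \oo --> (0 : R).
Proof.
split=> [/cvgrPdistC_lt ul|/cvgrPdistC_lt ul]; apply/cvgrPdistC_lt => e.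
  move=> e0; have e0C : 0 < e%:C by rewrite ltcR.
  apply: filterS (ul _ e0C) => n.
  by rewrite -cnE ltcR subr0 ger0_norm ?cn_ge0.
(* A positive element of [R[i]] has zero imaginary part, so this epsilon is a real one. *)
rewrite ltcE => /andP[/eqP ei er].
have -> : e = (complex.Re e)%:C by case: e ei er => a b /= ->.
apply: filterS (ul _ er) => n.
by rewrite subr0 ger0_norm ?cn_ge0// -ltcR cnE.
Qed.

Lemma ccvg_epsP (R : realType) (u : nat -> R[i]) l :
  ccvg u l <-> forall e, 0 < e ->
    exists N, forall n, (N <= n)%N -> cn (u n - l) < e.
Proof.
split=> [/ccvgP/cvgrPdistC_lt ul e e0|ul].
  have [N _ NP] := ul e e0; exists N => n Nn.
  by have := NP n Nn; rewrite /= subr0 ger0_norm ?cn_ge0.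
apply/ccvgP/cvgrPdistC_lt => e /ul[N NP]; exists N => // n Nn /=.
by rewrite subr0 ger0_norm ?cn_ge0// NP.
Qed.

Lemma null_le (R : realType) (u e : nat -> R) :
  (forall n, 0 <= u n <= e n) -> e @ \oo --> 0 -> u @ \oo --> 0.
Proof.
move=> ue e0; apply: (@squeeze_cvgr _ _ _ _ (fun=> 0) e) => //.
  by apply: nearW => n; exact: ue.
exact: cvg_cst.
Qed.

Lemma ccvg_le (R : realType) (u : nat -> R[i]) (e : nat -> R) l :
  (forall n, cn (u n - l) <= e n) -> e @ \oo --> (0 : R) -> ccvg u l.
Proof.
by move=> ue e0; apply/ccvgP; apply: (null_le _ e0) => n; rewrite cn_ge0 ue.
Qed.

Lemma ccvg_uniq (R : realType) (u : nat -> R[i]) l l' :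
  ccvg u l -> ccvg u l' -> l = l'.
Proof. by move=> ul ul'; exact: (cvg_unique (@norm_hausdorff _ _) ul ul'). Qed.

Lemma ccvg_clim (R : realType) (u : nat -> R[i]) l : ccvg u l -> clim u = l.
Proof. by move=> ul; exact: (cvg_lim (@norm_hausdorff _ _) ul). Qed.

Lemma ccvg_cst (R : realType) (l : R[i]) : ccvg (fun=> l) l.
Proof. exact: cvg_cst. Qed.

Lemma ccvgD (R : realType) (u v : nat -> R[i]) l m :
  ccvg u l -> ccvg v m -> ccvg (fun n => u n + v n) (l + m).
Proof. by move=> ul vm; exact: cvgD ul vm. Qed.

Lemma ccvgB (R : realType) (u v : nat -> R[i]) l m :
  ccvg u l -> ccvg v m -> ccvg (fun n => u n - v n) (l - m).
Proof. by move=> ul vm; exact: cvgB ul vm. Qed.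

Lemma ccvgM (R : realType) (u v : nat -> R[i]) l m :
  ccvg u l -> ccvg v m -> ccvg (fun n => u n * v n) (l * m).
Proof. by move=> ul vm; exact: cvgM ul vm. Qed.

Lemma ccvgX (R : realType) (u : nat -> R[i]) l k :
  ccvg u l -> ccvg (fun n => u n ^+ k) (l ^+ k).
Proof.
move=> ul; elim: k => [|k IH]; first exact: ccvg_cst.
rewrite exprS; under eq_fun do rewrite exprS.
exact: ccvgM.
Qed.

Lemma ccvgV (R : realType) (u : nat -> R[i]) l :
  l != 0 -> ccvg u l -> ccvg (fun n => (u n)^-1) l^-1.
Proof. by move=> l0 ul; exact: (@cvgV _ _ _ _ u l l0 ul). Qed.

Lemma ccvg_prod (R : realType) I (r : seq I) (u : I -> nat -> R[i])
    (l : I -> R[i]) :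
  (forall i, ccvg (u i) (l i)) ->
  ccvg (fun n => \prod_(i <- r) u i n) (\prod_(i <- r) l i).
Proof.
move=> ul; elim: r => [|i r IH].
  rewrite big_nil (_ : (fun _ => _) = fun=> 1); first exact: ccvg_cst.
  by apply/funext => n; rewrite big_nil.
rewrite big_cons (_ : (fun _ => _) = fun n => u i n * \prod_(j <- r) u j n).
  exact: ccvgM.
by apply/funext => n; rewrite big_cons.
Qed.

Lemma ccvg_null (R : realType) (u v : nat -> R[i]) l :
  ccvg u l -> ccvg (fun n => v n - u n) 0 -> ccvg v l.
Proof.
move=> ul vu; have := ccvgD ul vu; rewrite addr0.
by under eq_fun do rewrite addrC subrK.
Qed.

Lemma ccvg_comp (R : realType) (u : nat -> R[i]) l (f : nat -> nat) :
  (forall n, (n <= f n)%N) -> ccvg u l -> ccvg (fun n => u (f n)) l.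
Proof.
move=> fn /ccvg_epsP ul; apply/ccvg_epsP => e /ul[N NP].
by exists N => n Nn; apply: NP; exact: leq_trans (fn n).
Qed.

Lemma ccvg_cn_le (R : realType) (u : nat -> R[i]) (l v : R[i]) (B : R) N :
  ccvg u l -> (forall n, (N <= n)%N -> cn (u n - v) <= B) -> cn (l - v) <= B.
Proof.
move=> /ccvg_epsP ul uB; apply/ler_addgt0Pr => e /ul[M MP].
have := MP _ (leq_maxr N M); have := uB _ (leq_maxl N M).
have := ler_cn_dist (u (maxn N M)) l v; rewrite [cn (l - u _)]cn_distC; lra.
Qed.

Lemma ccvg_bounded (R : realType) (u : nat -> R[i]) l :
  ccvg u l -> exists B : R, forall n, cn (u n) <= B.
Proof.
move=> /ccvg_epsP /(_ 1 ltr01)[N NP].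
exists (cn l + 1 + \sum_(i < N) cn (u i)) => n.
have S0 (P : pred 'I_N) : 0 <= \sum_(i < N | P i) cn (u i).
  by apply: sumr_ge0 => i _; exact: cn_ge0.
have [Nn|nN] := leqP N n.
  have := NP _ Nn; have := ler_distcn (u n) l; have := S0 xpredT; lra.
rewrite (bigD1 (Ordinal nN))//= addrCA lerDl addr_ge0//.
by rewrite addr_ge0// cn_ge0.
Qed.

(** Real and imaginary parts are 1-Lipschitz for [cn], which reduces completeness of [R[i]] to that
    of [R]. *)
Lemma ccvg_cauchy (R : realType) (u : nat -> R[i]) (e : nat -> R) :
  (forall n m, (n <= m)%N -> cn (u m - u n) <= e n) ->
  e @ \oo --> (0 : R) -> exists l, ccvg u l.
Proof.
move=> ue e0.
have cv (f : R[i] -> R) : (forall z w, `|f z - f w| <= cn (z - w)) ->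
    cvgn (fun n => f (u n)).
  move=> fP; apply: cauchy_cvg; apply: cauchy_exP => d d0.
  have [N _ NP] := (@cvgrPdistC_lt _ _ _ _ _ _ _).1 e0 d d0.
  exists (f (u N)); exists N => // m Nm; rewrite /ball/= distrC.
  apply: le_lt_trans (fP _ _) _; apply: le_lt_trans (ue _ _ Nm) _.
  by have := NP N (leqnn N); rewrite /= subr0 => /(le_lt_trans (ler_norm _)).
have /cvg_ex[/= a ua] : cvgn (fun n => complex.Re (u n)).
  by apply: cv => z w; rewrite -raddfB ler_normRe.
have /cvg_ex[/= b ub] : cvgn (fun n => complex.Im (u n)).
  by apply: cv => z w; rewrite -raddfB ler_normIm.
exists (a +i* b); apply: (@ccvg_le _ _
  (fun n => `|complex.Re (u n) - a| + `|complex.Im (u n) - b|)).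
  move=> n; apply: le_trans (cn_leReIm _) _.
  by case: (u n) => x y /=.
rewrite -[0]addr0; apply: cvgD.
  by rewrite -(normr0 R) -(subrr a); apply: cvg_norm; apply: cvgB => //; exact: cvg_cst.
by rewrite -(normr0 R) -(subrr b); apply: cvg_norm; apply: cvgB => //; exact: cvg_cst.
Qed.

(** * The complex exponential and infinite products *)

Lemma cexpD (R : realType) (z w : R[i]) : cexp (z + w) = cexp z * cexp w.
Proof.
case: z w => a b [c d]; rewrite /cexp/= expRD cosD sinD.
by apply/eqP; rewrite eq_complex/=; apply/andP; split; apply/eqP; ring.
Qed.

Lemma cexp0 (R : realType) : cexp (0 : R[i]) = 1.
Proof. by rewrite /cexp/= expR0 cos0 sin0 mulr1 mulr0. Qed.

Lemma cexpMn (R : realType) (z : R[i]) n : cexp (z *+ n) = cexp z ^+ n.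
Proof.
by elim: n => [|n IH]; rewrite ?mulr0n ?cexp0// mulrS cexpD exprS IH.
Qed.

Lemma cexp_neq0 (R : realType) (z : R[i]) : cexp z != 0.
Proof.
apply/eqP => z0; have := cexpD z (- z); rewrite subrr cexp0 z0 mul0r.
by move/eqP; rewrite oner_eq0.
Qed.

Lemma cexpN (R : realType) (z : R[i]) : cexp (- z) = (cexp z)^-1.
Proof.
by apply: (mulfI (cexp_neq0 z)); rewrite -cexpD subrr cexp0 divff ?cexp_neq0.
Qed.

Lemma cexp_sum (R : realType) I (r : seq I) (F : I -> R[i]) :
  cexp (\sum_(i <- r) F i) = \prod_(i <- r) cexp (F i).
Proof. by apply: (big_morph _ (@cexpD R)); rewrite cexp0. Qed.

Lemma cn_cexp (R : realType) (z : R[i]) : cn (cexp z) = expR (complex.Re z).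
Proof.
rewrite /cn normc_def/= !exprMn -mulrDr cos2Dsin2 mulr1 sqrtr_sqr.
by rewrite ger0_norm// expR_ge0.
Qed.

Lemma cn_cexp_le (R : realType) (z : R[i]) : cn (cexp z) <= expR (cn z).
Proof.
by rewrite cn_cexp ler_expR (le_trans (ler_norm _))// ler_normRe.
Qed.

Lemma cexp_real (R : realType) (x : R) : cexp x%:C = (expR x)%:C.
Proof. by rewrite /cexp/= cos0 sin0 mulr1 mulr0. Qed.

Lemma ler_norm_sin (R : realType) (x : R) : `|sin x| <= `|x|.
Proof.
wlog x0 : x / 0 <= x => [h|].
  by have [/h//|x0] := lerP 0 x; rewrite -normrN -[leRHS]normrN -sinN h// oppr_ge0 ltW.
move: x0; rewrite le_eqVlt => /predU1P[<-|x0]; first by rewrite sin0.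
have [c _] := @MVT _ sin cos 0 x x0 (fun y _ => is_derive_sin y)
  (continuous_subspaceT (@continuous_sin R)).
by rewrite sin0 !subr0 => ->; rewrite normrM ler_piMl// cos_max.
Qed.

(** Half-angle formula: 1 - cos x = 2 sin^2 (x / 2), with |sin y| <= |y|. *)
Lemma cos_bounds (R : realType) (x : R) : 0 <= 1 - cos x <= x ^+ 2 / 2.
Proof.
set y := x / 2; have xE : x = y + y by rewrite /y; field.
have hs : sin y ^+ 2 <= y ^+ 2.
  by rewrite -[leLHS]real_normK ?num_real// -[leRHS]real_normK ?num_real//
    ler_pXn2r ?nnegrE// ler_norm_sin.
by rewrite xE cosD; have := cos2Dsin2 y; have := sqr_ge0 (sin y);
  move=> ? ?; apply/andP; split; nra.
Qed.

Lemma ler_norm_sinB (R : realType) (x : R) : `|sin x - x| <= x ^+ 2.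
Proof.
wlog x0 : x / 0 <= x => [h|].
  have [/h//|x0] := lerP 0 x; rewrite -normrN opprD -sinN -sqrrN h//.
  by rewrite oppr_ge0 ltW.
move: x0; rewrite le_eqVlt => /predU1P[<-|x0].
  by rewrite sin0 subr0 normr0 expr0n.
have [c cx] := @MVT _ sin cos 0 x x0 (fun y _ => is_derive_sin y)
  (continuous_subspaceT (@continuous_sin R)).
rewrite sin0 !subr0 => ->; rewrite -{2}[x]mul1r -mulrBl normrM distrC.
rewrite expr2 [`|x|]gtr0_norm// ler_pM2r//.
have /andP[c0 c2] := cos_bounds c; rewrite ger0_norm//.
move: cx; rewrite in_itv/= => /andP[cp cx].
(* The goal is 1 - cos c <= x with c < x: for c <= 2 use c^2 / 2 <= c, for c > 2 use 1 - cos c <=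
   2. *)
have := cos_geN1 c; have [|] := lerP c 2; nra.
Qed.

(** Both follow from 1 + y <= exp y at y = x and y = - x; the latter, multiplied by exp x, reads exp
    x - 1 <= x exp x. *)
Lemma expR_bounds (R : realType) (x : R) :
  (`|expR x - 1| <= `|x| * expR `|x|) *
  (`|expR x - 1 - x| <= x ^+ 2 * expR `|x|).
Proof.
have h1 := expR_ge1Dx x; have h2 := expR_ge1Dx (- x).
have e0 := expR_gt0 x; have := expRxMexpNx_1 x; have en0 := expR_gt0 (- x).
move=> ee; have h3 : expR x - 1 <= x * expR x by nra.
have [x0|x0] := lerP 0 x.
  rewrite [`|x|]ger0_norm//; split; rewrite ger0_norm; try lra.
  apply: le_trans (_ : x * (expR x - 1) <= _); first lra.
  by rewrite expr2 -mulrA; apply: ler_wpM2l.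
have e1 : expR x <= 1 by rewrite -expR0 ler_expR ltW.
have e2 : 1 <= expR (- x) by lra.
rewrite [`|x|]ltr0_norm//; split.
  by rewrite ler0_norm; nra.
rewrite ger0_norm; last lra.
apply: le_trans (_ : x * x <= _); first nra.
by rewrite expr2 ler_peMr// mulr_le0// ltW.
Qed.

(** The constant is 2 + 2: the real part is (e^x - 1 - x) - e^x (1 - cos y) and the imaginary part
    is (e^x - 1) sin y + (sin y - y). *)
Lemma cexp_bound (R : realType) (z : R[i]) :
  cn (cexp z - 1 - z) <= 4 * cn z ^+ 2 * expR (cn z).
Proof.
apply: le_trans (cn_leReIm _) _.
have := ler_normRe z; have := ler_normIm z.
case: z => x y; set c := cn _; rewrite /cexp/= => yc xc.
have c0 : 0 <= c := cn_ge0 _.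
have [ex1 ex2] := expR_bounds x.
have xE : expR `|x| <= expR c by rewrite ler_expR.
have E1 : 1 <= expR c by rewrite -expR0 ler_expR.
have x2 : x ^+ 2 <= c ^+ 2 by rewrite -real_normK ?num_real// ler_pXn2r ?nnegrE.
have y2 : y ^+ 2 <= c ^+ 2 by rewrite -real_normK ?num_real// ler_pXn2r ?nnegrE.
have A1 : `|expR x * cos y - 1 - x| <= 2 * c ^+ 2 * expR c.
  rewrite (_ : _ - x = (expR x - 1 - x) - expR x * (1 - cos y)); last by ring.
  apply: le_trans (ler_normB _ _) _; rewrite normrM [`|expR x|]ger0_norm ?expR_ge0//.
  have /andP[c1 c2] := cos_bounds y; rewrite [`|1 - _|]ger0_norm//.
  have : expR x <= expR c by rewrite ler_expR (le_trans (ler_norm _)).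
  have := expR_gt0 x; have := expR_gt0 `|x|; have := sqr_ge0 x; nra.
have A2 : `|expR x * sin y - y| <= 2 * c ^+ 2 * expR c.
  rewrite (_ : _ - y = (expR x - 1) * sin y + (sin y - y)); last by ring.
  apply: le_trans (ler_normD _ _) _; rewrite normrM.
  have := ler_norm_sinB y; have := ler_norm_sin y.
  have : `|expR x - 1| <= c * expR c.
    by apply: le_trans ex1 _; rewrite ler_pM ?expR_ge0.
  have := normr_ge0 (expR x - 1); have := normr_ge0 (sin y).
  move=> s0 e0 el sl sb.
  have : `|expR x - 1| * `|sin y| <= c * expR c * c by rewrite ler_pM// (le_trans sl).
  have : c ^+ 2 <= c ^+ 2 * expR c by rewrite ler_peMr ?sqr_ge0.
  rewrite expr2; lra.
rewrite subr0; lra.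
Qed.

Lemma prod1D_bound (R : realType) I (r : seq I) (F : I -> R[i]) :
  cn (\prod_(i <- r) F i - 1) <= expR (\sum_(i <- r) cn (F i - 1)) - 1.
Proof.
elim: r => [|i r IH]; first by rewrite !big_nil subrr cn0 expR0 subrr.
rewrite !big_cons expRD; set P := \prod_(_ <- _) _ in IH *.
rewrite (_ : F i * P - 1 = (F i - 1) * (P - 1) + ((F i - 1) + (P - 1))); last by ring.
apply: le_trans (ler_cnD _ _) _; rewrite cnM.
have := ler_cnD (F i - 1) (P - 1).
have := expR_ge1Dx (cn (F i - 1)); have := cn_ge0 (F i - 1); have := cn_ge0 (P - 1).
set a := cn (F i - 1); set b := cn (P - 1) in IH *; set E := expR (\sum_(_ <- _) _) in IH *.
nra.
Qed.

(** Telescoping: the factors are exchanged one at a time, and each of the others costs at most exp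
    (b i). *)
Lemma prodB_bound (R : realType) I (r : seq I) (A B : I -> R[i]) (b : I -> R) :
  (forall i, 0 <= b i) ->
  (forall i, cn (A i) <= expR (b i)) -> (forall i, cn (B i) <= expR (b i)) ->
  cn (\prod_(i <- r) A i - \prod_(i <- r) B i) <=
  (\sum_(i <- r) cn (A i - B i)) * expR (\sum_(i <- r) b i).
Proof.
move=> b0 Ab Bb; elim: r => [|i r IH].
  by rewrite !big_nil subrr cn0 mul0r.
have Br : cn (\prod_(j <- r) B j) <= expR (\sum_(j <- r) b j).
  rewrite cn_prod (big_morph _ (@expRD R) (expR0 R)).
  by apply: ler_prod => j _; rewrite cn_ge0 Bb.
rewrite !big_cons expRD.
set P := \prod_(_ <- _) A _ in IH *; set Q := \prod_(_ <- _) B _ in IH Br *.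
rewrite (_ : _ - _ = A i * (P - Q) + (A i - B i) * Q); last by ring.
apply: le_trans (ler_cnD _ _) _; rewrite !cnM.
have E1 : 1 <= expR (b i) by rewrite -expR0 ler_expR.
have := expR_gt0 (\sum_(j <- r) b j); set E := expR (\sum_(_ <- _) _) in IH Br * => E0.
rewrite mulrDl addrC; apply: lerD.
  rewrite ler_pM ?cn_ge0// (le_trans Br)// ler_peMl// ltW//.
by rewrite mulrCA; apply: ler_pM; rewrite ?cn_ge0.
Qed.

(** * The sine product *)

Lemma null_harmonic (R : realType) (C : R) :
  (fun n => C / n.+1%:R) @ \oo --> (0 : R).
Proof. by rewrite -(mulr0 C); apply: cvgMl_tmp; exact: cvg_harmonic. Qed.

(** exp z is the k-th power of exp (z / k), which differs from 1 + z / k by O(1 / k^2); k factors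
    leave an error O(1 / k). *)
Lemma ccvg_cexp (R : realType) (z : R[i]) :
  ccvg (fun n => (1 + z / n.+1%:R) ^+ n.+1) (cexp z).
Proof.
apply: (ccvg_le _ (@null_harmonic R (4 * cn z ^+ 2 * expR (cn z) * expR (cn z)))).
move=> n; set k := n.+1.
have k0 : (k%:R : R[i]) != 0 by rewrite pnatr_eq0.
have kR0 : (k%:R : R) != 0 by rewrite pnatr_eq0.
have kR1 : (1 : R) <= k%:R by rewrite ler1n.
have -> : cexp z = \prod_(i < k) cexp (z / k%:R).
  by rewrite prodr_const card_ord -cexpMn -[(z / _) *+ k]mulr_natr divfK.
have -> : (1 + z / k%:R) ^+ k = \prod_(i < k) (1 + z / k%:R).
  by rewrite prodr_const card_ord.
set b := cn z / k%:R.
have zb : cn (z / k%:R) = b by rewrite cnM cnV cn_nat.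
have b0 : 0 <= b by rewrite -zb cn_ge0.
have bz : b <= cn z by rewrite ler_pdivrMr ?ltr0n// ler_peMr ?cn_ge0.
apply: le_trans (@prodB_bound _ _ _ _ _ (fun=> b) _ _ _) _ => //.
- move=> _; apply: le_trans (ler_cnD _ _) _.
  by rewrite cn1 zb expR_ge1Dx.
- by move=> _; rewrite (le_trans (cn_cexp_le _))// zb.
rewrite !sumr_const card_ord -[b *+ _]mulr_natr divfK//.
rewrite mulrAC; apply: ler_wpM2r; first exact: expR_ge0.
rewrite cn_distC opprD addrA -[cn _ *+ k]mulr_natr -ler_pdivlMr ?ltr0n//.
apply: le_trans (cexp_bound _) _; rewrite zb.
rewrite (_ : _ / k%:R / k%:R = 4 * b ^+ 2 * expR (cn z)); last first.
  by rewrite /b; field.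
have b4 : 0 <= 4 * b ^+ 2 by rewrite mulr_ge0// sqr_ge0.
by rewrite ler_wpM2l// ler_expR.
Qed.

Lemma prim_root_prodB (F : fieldType) k (z a b : F) :
  (0 < k)%N -> k.-primitive_root z ->
  \prod_(0 <= j < k) (a - z ^+ j * b) = a ^+ k - b ^+ k.
Proof.
move=> k0 pz; have [->|b0] := eqVneq b 0.
  rewrite (eq_bigr (fun=> a)) => [|i _]; last by rewrite mulr0 subr0.
  by rewrite prodr_const_nat subn0 expr0n eqn0Ngt k0 subr0.
rewrite (eq_bigr (fun j => (a / b - z ^+ j) * b)) => [|i _]; last first.
  by rewrite mulrBl divfK.
rewrite big_split/= prodr_const_nat subn0.
have /(congr1 (fun p => p.[a / b])) := factor_Xn_sub_1 pz.
rewrite horner_prod (eq_bigr (fun j => a / b - z ^+ j)); last first.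
  by move=> j _; rewrite !hornerE.
rewrite !hornerE => ->.
by rewrite mulrBl mul1r expr_div_n divfK ?expf_neq0.
Qed.

Lemma prim_root_prod1B (F : fieldType) k (z : F) :
  (0 < k)%N -> k.-primitive_root z ->
  \prod_(1 <= j < k) (1 - z ^+ j) = k%:R.
Proof.
move=> k0 pz; have := factor_Xn_sub_1 pz.
have X1 : ('X - 1 : {poly F}) != 0 by rewrite -polyC1 polyXsubC_eq0.
rewrite big_ltn// expr0 polyC1 subrX1 => /(mulfI X1).
move=> /(congr1 (fun p => p.[1])); rewrite horner_prod horner_sum.
rewrite (eq_bigr (fun i => 1 - z ^+ i)) => [->|i _]; last by rewrite !hornerE.
rewrite (eq_bigr (fun=> 1)) => [|i _]; last by rewrite hornerXn expr1n.
by rewrite sumr_const card_ord.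
Qed.

Lemma prod_pairing (K : comNzRingType) (F : nat -> K) M :
  \prod_(1 <= j < M.*2.+1) F j =
  \prod_(m < M) (F m.+1 * F (M.*2.+1 - m.+1)%N).
Proof.
rewrite big_add1/= -addnn big_mkord big_split_ord/= big_split/=; congr (_ * _).
rewrite (reindex_inj rev_ord_inj)/=; apply: eq_bigr => i _.
by congr (F _); have := ltn_ord i; lia.
Qed.

(** Euler's finite product. The root 1 contributes 2 s, the product of the 1 - z^j is the order
    [M.*2.+1], and j is paired with its opposite, where [c] changes sign. For z = exp (2 pi i / k)
    one has c j = i cot (pi j / k). *)
Lemma prim_root_split (F : fieldType) M (z s : F) (c : nat -> F) :
  M.*2.+1.-primitive_root z ->
  (forall j, c j = (1 + z ^+ j) / (1 - z ^+ j)) ->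
  (1 + s) ^+ M.*2.+1 - (1 - s) ^+ M.*2.+1 =
  2 * s * M.*2.+1%:R * \prod_(m < M) (1 - s ^+ 2 * c m.+1 ^+ 2).
Proof.
set k := M.*2.+1 => pz cE.
have z1 j : (0 < j < k)%N -> 1 - z ^+ j != 0.
  move=> /andP[j0 jk]; rewrite subr_eq0 eq_sym -(expr0 z) (eq_prim_root_expr pz).
  by rewrite mod0n modn_small// -lt0n.
rewrite -(prim_root_prodB _ _ _ pz)// big_ltn// expr0.
rewrite (_ : 1 + s - 1 * (1 - s) = 2 * s); last by ring.
rewrite -[RHS]mulrA; congr (_ * _); rewrite -(prim_root_prod1B _ pz)//.
rewrite [RHS](_ : _ = (\prod_(1 <= j < k) (1 - z ^+ j)) *
    \prod_(1 <= j < k) (1 + s * c j)).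
  rewrite -big_split/=; apply: eq_big_nat => j jk; rewrite cE.
  by field; exact: z1.
congr (_ * _); rewrite prod_pairing; apply: eq_bigr => -[m mM] _ /=.
have -> : c (k - m.+1)%N = - c m.+1.
  have e : z ^+ (k - m.+1) * z ^+ m.+1 = 1.
    by rewrite -exprD subnK ?prim_expr_order// /k; lia.
  have z0 : z ^+ m.+1 != 0.
    by apply/eqP => h; move/eqP: e; rewrite h mulr0 eq_sym oner_eq0.
  have d0 : 1 - z ^+ m.+1 != 0 by apply: z1; rewrite /k; lia.
  rewrite !cE (_ : z ^+ (k - m.+1) = (z ^+ m.+1)^-1); last first.
    by apply: (mulIf z0); rewrite e mulVf.
  field; rewrite z0 d0/= -opprB oppr_eq0; exact: d0.
by ring.
Qed.

Lemma cexp_angleMn (R : realType) (t : R) j :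
  cexp ('i * t%:C) ^+ j = cexp ('i * (t * j%:R)%:C).
Proof.
by rewrite -cexpMn -mulrnAr mulr_natr rmorphMn.
Qed.

Lemma cexp_imag (R : realType) (t : R) :
  cexp ('i * t%:C) = (cos t)%:C + 'i * (sin t)%:C.
Proof.
have -> : ('i * t%:C : R[i]) = 0 +i* t.
  by apply/eqP; rewrite eq_complex/=; apply/andP; split; apply/eqP; ring.
by rewrite /cexp/= expR0 !mul1r [LHS]complexE.
Qed.

Lemma cexp_2pi_prim (R : realType) k : (0 < k)%N ->
  k.-primitive_root (cexp ('i * (2 * pi / k%:R)%:C : R[i])).
Proof.
move=> k0; set z := cexp _; have kR0 : 0 < k%:R :> R by rewrite ltr0n.
have zk : z ^+ k = 1.
  rewrite cexp_angleMn divfK ?gt_eqF// cexp_imag mulr_natl cos2pi sin2pi.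
  by rewrite mulr0 addr0.
have [m pm mk] := prim_order_exists k0 zk.
have m0 := prim_order_gt0 pm.
have [<-//|mnk] := eqVneq m k.
have {}mk : (m < k)%N by rewrite ltn_neqAle mnk dvdn_leq.
have := prim_expr_order pm; rewrite cexp_angleMn cexp_imag => /(congr1 (@complex.Re R)).
(* A smaller order m would give cos (2 t) = 1 with 0 < t < pi, hence sin t = 0. *)
pose t : R := pi / k%:R * m%:R; rewrite (_ : 2 * pi / k%:R * _ = t + t); last first.
  by rewrite /t; field; rewrite gt_eqF.
rewrite /= mul0r mul1r subr0 addr0 cosD => c1.
have : 0 < sin t.
  apply: sin_gt0_pi; rewrite /t mulr_gt0 ?divr_gt0 ?pi_gt0 ?ltr0n//=.
  by rewrite mulrAC ltr_pdivrMr// ltr_pM2l ?pi_gt0// ltr_nat.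
have := cos2Dsin2 t; nra.
Qed.

(** From cot t <= 1 / t <= 1 / sin t and 1 / sin^2 t = 1 + cot^2 t. *)
Lemma cot_bounds (R : realType) (t : R) : 0 < t < pi / 2 ->
  0 <= t ^-2 - (cos t / sin t) ^+ 2 <= 1.
Proof.
move=> /andP[t0 tpi].
have pi0 := pi_gt0 R.
have s0 : 0 < sin t by apply: sin_gt0_pihalf; rewrite t0.
have c0 : 0 < cos t by apply: cos_gt0_pihalf; rewrite tpi andbT; lra.
have st : sin t <= t.
  by have := ler_norm_sin t; rewrite !gtr0_norm.
have tc : t * cos t <= sin t.
  have [c ct] := @MVT _ sin cos 0 t t0 (fun y _ => is_derive_sin y)
    (continuous_subspaceT (@continuous_sin R)).
  rewrite sin0 !subr0 => ->; rewrite mulrC ler_pM2r// ltW//.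
  move: ct; rewrite in_itv/= => /andP[c1 c2].
  by rewrite ltr_cos// in_itv/=; apply/andP; split; lra.
have i0 : 0 <= t^-1 - cos t / sin t.
  by rewrite subr_ge0 ler_pdivrMr// mulrC ler_pdivlMr// mulrC.
have i1 : t^-1 <= (sin t)^-1 by rewrite lef_pV2.
have q0 : 0 < cos t / sin t by rewrite divr_gt0.
have e : (sin t)^-1 ^+ 2 = 1 + (cos t / sin t) ^+ 2.
  rewrite -[LHS]mul1r -[X in X * _ = _](cos2Dsin2 t); field.
  by rewrite gt_eqF.
have ti0 : 0 < t^-1 by rewrite invr_gt0.
rewrite -exprVn; apply/andP; split; nra.
Qed.

Lemma half_angle (K : comNzRingType) (i c s : K) (e := c + i * s) :
  i * i = -1 -> c ^+ 2 + s ^+ 2 = 1 ->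
  (1 + e ^+ 2 = 2 * c * e) * (1 - e ^+ 2 = - (2 * i) * s * e).
Proof.
move=> ii cs; split; apply/eqP; rewrite -subr_eq0.
  rewrite (_ : _ - _ = 1 - (c ^+ 2 + s ^+ 2) + s ^+ 2 * (1 + i * i)).
    by rewrite cs ii !subrr mulr0 addr0.
  by rewrite /e; ring.
rewrite (_ : _ - _ = 1 - (c ^+ 2 + s ^+ 2) + s ^+ 2 * (1 + i * i)).
  by rewrite cs ii !subrr mulr0 addr0.
by rewrite /e; ring.
Qed.

Lemma sine_factor_cancel (K : fieldType) (i p v k P : K) :
  (2 : K) != 0 -> i != 0 -> p != 0 -> k != 0 ->
  2 * (i * p * v / k) * k * P / (2 * i * p) = v * P.
Proof. by move=> t0 i0 p0 k0; field; rewrite t0 i0 p0 k0. Qed.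

(** This is sin (pi v) / pi, normalised to have derivative 1 at 0 like [sinprod]. *)
Definition csinpi (R : realType) (v : R[i]) : R[i] :=
  (cexp ('i * pi%:C * v) - cexp (- ('i * pi%:C * v))) / (2 * 'i * pi%:C).

Definition sinprod (R : realType) (v : R[i]) (M : nat) : R[i] :=
  v * \prod_(m < M) (1 - v ^+ 2 / m.+1%:R ^+ 2).

(* telescoping weight, comparable with 1 / max(1, m)^2 *)
Definition gtel (R : realType) (m : nat) : R := (m.+1 * m.+2)%:R^-1.

Lemma gtel_ge0 (R : realType) m : 0 <= gtel R m.
Proof. by rewrite invr_ge0. Qed.

Lemma sum_gtel (R : realType) a b : (a <= b)%N ->
  \sum_(a <= m < b) gtel R m = a.+1%:R^-1 - b.+1%:R^-1.
Proof.
move=> ab; rewrite -(subnK ab) addnC; elim: (b - a)%N => [|d IH].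
  by rewrite addn0 big_geq// subrr.
rewrite addnS big_nat_recr ?leq_addr//= IH /gtel natrM.
have h1 : ((a + d).+1%:R : R) != 0 by rewrite pnatr_eq0.
have h2 : ((a + d).+2%:R : R) != 0 by rewrite pnatr_eq0.
have h3 : (a.+1%:R : R) != 0 by rewrite pnatr_eq0.
have e : ((a + d).+2%:R : R) = (a + d).+1%:R + 1 by rewrite -natr1.
have aux (p : R) : p != 0 -> p + 1 != 0 -> (p * (p + 1))^-1 = p^-1 - (p + 1)^-1.
  by move=> p0 p1; field; rewrite p0 p1.
by move: h2; rewrite e => h2; rewrite aux// addrA subrK.
Qed.

Lemma sum_gtel_le1 (R : realType) M : \sum_(0 <= m < M) gtel R m <= 1.
Proof. by rewrite sum_gtel// invr1 lerBlDr lerDl invr_ge0. Qed.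

Lemma invsq_le_gtel (R : realType) m : (m.+1%:R ^+ 2)^-1 <= 2 * gtel R m.
Proof.
have h1 : (0 : R) < m.+1%:R by rewrite ltr0n.
have e : (m.+2%:R : R) = m.+1%:R + 1 by rewrite -natr1.
rewrite /gtel natrM expr2 !invfM [leRHS]mulrCA; apply: ler_wpM2l.
  by rewrite invr_ge0 ltW.
rewrite ler_pdivlMr; last by rewrite e; lra.
rewrite mulrC ler_pdivrMr// e.
have : (1 : R) <= m.+1%:R by rewrite ler1n.
lra.
Qed.

(** With k = 2 M + 1, the finite product of [prim_root_split] at s = i pi v / k has factors 1 - v^2
    q_m, where q_m = ((pi / k) cot (pi m / k))^2 lies within (pi / k)^2 of 1 / m^2 by [cot_bounds].
    This error is uniform in m, so the M factors cost O(1 / M) in total. *)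
Lemma ccvg_sinprod (R : realType) (v : R[i]) :
  ccvg (sinprod v) (csinpi v).
Proof.
set z := 'i * pi%:C * v.
pose D M : R[i] := ((1 + z / M.*2.+1%:R) ^+ M.*2.+1 -
   (1 + (- z) / M.*2.+1%:R) ^+ M.*2.+1) / (2 * 'i * pi%:C).
have pi0 : (pi%:C : R[i]) != 0 by rewrite fmorph_eq0 gt_eqF ?pi_gt0.
have i0 : ('i : R[i]) != 0 by rewrite eq_complex/= oner_eq0 andbF.
have two0 : (2 : R[i]) != 0 by rewrite pnatr_eq0.
have DE : ccvg D (csinpi v).
  apply: ccvgM; last exact: ccvg_cst.
  have h (y : R[i]) : ccvg (fun M => (1 + y / M.*2.+1%:R) ^+ M.*2.+1) (cexp y).
    apply: (ccvg_comp (f := double) _ (@ccvg_cexp _ y)) => n.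
    by rewrite -addnn leq_addr.
  exact: ccvgB.
apply: ccvg_null DE _.
pose C := cn v * cn v ^+ 2 * pi ^+ 2 * expR (2 * cn v ^+ 2).
apply: (ccvg_le _ (@null_harmonic R C)) => M; rewrite subr0.
set k := M.*2.+1; have kR0 : 0 < k%:R :> R by rewrite ltr0n.
have kC0 : (k%:R : R[i]) != 0 by rewrite pnatr_eq0.
pose th m : R := pi / k%:R * m%:R.
pose q m : R := (pi / k%:R * (cos (th m) / sin (th m))) ^+ 2.
have thP (m : 'I_M) : 0 < th m.+1 < pi / 2.
  rewrite /th mulr_gt0 ?divr_gt0 ?pi_gt0 ?ltr0n//=.
  rewrite mulrAC ltr_pdivrMr// -mulrA ltr_pM2l ?pi_gt0//.
  rewrite mulrC ltr_pdivlMr// -natrM ltr_nat /k; have := ltn_ord m; lia.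
have -> : D M = v * \prod_(m < M) (1 - v ^+ 2 * (q m.+1)%:C).
  rewrite /D mulNr (prim_root_split _ (cexp_2pi_prim R (ltn0Sn _)) (fun=> erefl)).
  rewrite (_ : 2 * (z / k%:R) * k%:R * _ / _ =
    v * \prod_(m < M) (1 - (z / k%:R) ^+ 2 *
     ((1 + cexp ('i * (2 * pi / k%:R)%:C) ^+ m.+1) /
      (1 - cexp ('i * (2 * pi / k%:R)%:C) ^+ m.+1)) ^+ 2)); last first.
    exact: sine_factor_cancel.
  congr (_ * _); apply: eq_bigr => m _; congr (1 - _).
  rewrite cexp_angleMn (_ : 2 * pi / k%:R * _ = th m.+1 *+ 2); last first.
    by rewrite /th mulr2n; field; rewrite gt_eqF.
  set t := th m.+1; have := thP m; rewrite -/t => /andP[t0 tpi].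
  have st : sin t != 0 by rewrite gt_eqF// sin_gt0_pihalf// t0.
  have -> : cexp ('i * (t *+ 2)%:C) = ((cos t)%:C + 'i * (sin t)%:C) ^+ 2.
    by rewrite -cexp_imag cexp_angleMn mulr_natr.
  set e := (cos t)%:C + 'i * (sin t)%:C.
  have i2 : 'i * 'i = -1 :> R[i] by rewrite -expr2 sqr_i.
  have cs : (cos t)%:C ^+ 2 + (sin t)%:C ^+ 2 = 1 :> R[i].
    by rewrite -!rmorphXn/= -rmorphD/= cos2Dsin2.
  have e0 : e != 0 by rewrite /e -cexp_imag cexp_neq0.
  have stC : ((sin t)%:C : R[i]) != 0 by rewrite fmorph_eq0.
  have [E1 E2] := half_angle i2 cs; rewrite -/e in E1 E2.
  rewrite E1 E2 /q !(rmorphM, rmorphXn, fmorphV)/= rmorph_nat -/t.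
  rewrite /z; field.
  by rewrite e0 kC0 stC i0.
rewrite /sinprod -mulrBr cnM.
pose b (m : 'I_M) := cn v ^+ 2 * (m.+1%:R ^+ 2)^-1.
have inv2 (m : nat) : cn (v ^+ 2 / m.+1%:R ^+ 2) = cn v ^+ 2 * (m.+1%:R ^+ 2)^-1.
  by rewrite cnM cnV !cnX cn_nat.
have q0 m : 0 <= q m by exact: sqr_ge0.
have qP (m : 'I_M) : 0 <= (m.+1%:R ^+ 2)^-1 - q m.+1 <= (pi / k%:R) ^+ 2.
  have /andP[b1 b2] := cot_bounds (thP m).
  have -> : (m.+1%:R ^+ 2)^-1 = (pi / k%:R) ^+ 2 * (th m.+1) ^-2 :> R.
    have aux (P y : R) : P != 0 -> y != 0 -> (y ^+ 2)^-1 = P ^+ 2 / (P * y) ^+ 2.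
      by move=> P0 y0; field; rewrite P0 y0.
    by apply: aux; rewrite ?pnatr_eq0// mulf_neq0 ?invr_neq0 ?gt_eqF ?pi_gt0.
  rewrite /q [X in _ - X]exprMn -mulrBr; apply/andP; split; first by rewrite mulr_ge0 ?sqr_ge0.
  by rewrite ler_piMr ?sqr_ge0.
have B := @prodB_bound _ _ (index_enum 'I_M)
  (fun m => 1 - v ^+ 2 / m.+1%:R ^+ 2) (fun m => 1 - v ^+ 2 * (q m.+1)%:C) b.
apply: le_trans (ler_wpM2l (cn_ge0 _) (B _ _ _)) _.
- by move=> m; rewrite /b mulr_ge0 ?sqr_ge0// invr_ge0 sqr_ge0.
- move=> m; apply: le_trans (ler_cnB _ _) _; rewrite cn1 inv2; exact: expR_ge1Dx.
- move=> m; apply: le_trans (ler_cnB _ _) _; rewrite cn1 cnM cnX cn_real ger0_norm//.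
  apply: le_trans (expR_ge1Dx _); rewrite lerD2l /b; apply: ler_wpM2l.
    exact: sqr_ge0.
  by have /andP[h _] := qP m; rewrite -subr_ge0.
rewrite (_ : C / _ = cn v * (cn v ^+ 2 * pi ^+ 2 / M.+1%:R *
  expR (2 * cn v ^+ 2))); last by rewrite /C; ring.
apply: ler_wpM2l; first exact: cn_ge0.
have S1 : \sum_(m < M) cn (1 - v ^+ 2 / m.+1%:R ^+ 2 - (1 - v ^+ 2 * (q m.+1)%:C))
    <= cn v ^+ 2 * pi ^+ 2 / M.+1%:R.
  apply: le_trans (_ : \sum_(m < M) cn v ^+ 2 * (pi / k%:R) ^+ 2 <= _).
    apply: ler_sum => m _; have /andP[b1 b2] := qP m.
    rewrite (_ : _ - (1 - _) = - (v ^+ 2 * ((m.+1%:R ^+ 2)^-1 - q m.+1)%:C)).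
      by rewrite cnN cnM cn_real cnX ger0_norm// ler_wpM2l// sqr_ge0.
    move: (q m.+1) => Q; rewrite rmorphB fmorphV rmorphXn rmorph_nat; ring.
  rewrite sumr_const card_ord -[(_ * _) *+ M]mulr_natr.
  rewrite (_ : _ * M%:R = cn v ^+ 2 * pi ^+ 2 * (M%:R / k%:R ^+ 2)); last first.
    by rewrite exprMn exprVn; ring.
  apply: ler_wpM2l; first by rewrite mulr_ge0 ?sqr_ge0.
  rewrite -[leRHS]mul1r ler_pdivlMr ?ltr0n// mulrAC ler_pdivrMr ?exprn_gt0//.
  by rewrite mul1r -natrM -natrX ler_nat /k; nia.
have S2 : \sum_(m < M) b m <= 2 * cn v ^+ 2.
  rewrite -mulr_sumr mulrC; apply: ler_wpM2r; first exact: sqr_ge0.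
  apply: le_trans (_ : \sum_(m < M) 2 * gtel R m <= _).
    by apply: ler_sum => m _; exact: invsq_le_gtel.
  rewrite -mulr_sumr ler_piMr//.
  by have := sum_gtel_le1 R M; rewrite big_mkord.
apply: ler_pM; rewrite ?expR_ge0 ?ler_expR//.
by apply: sumr_ge0 => m _; exact: cn_ge0.
Qed.

(** * The finite Jacobi triple product *)

(** Gaussian binomial coefficients by Pascal's rule, free of division. When j' exceeds n', the
    truncated exponent does no harm: the coefficient it multiplies is 0. *)
Fixpoint qbin (K : comNzRingType) (p : K) (n j : nat) {struct n} : K :=
  match n, j with
  | _, 0 => 1
  | 0, _.+1 => 0
  | n'.+1, j'.+1 => qbin p n' j'.+1 + p ^+ (n' - j') * qbin p n' j'
  end.

Lemma qbin0 (K : comNzRingType) (p : K) n : qbin p n 0 = 1.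
Proof. by case: n. Qed.

Lemma qbin_gt (K : comNzRingType) (p : K) n j : (n < j)%N -> qbin p n j = 0.
Proof.
elim: n j => [|n IH] [|j]//= nj.
by rewrite !IH ?mulr0 ?addr0// ltnW.
Qed.

Lemma qbin_rmorph (K L : comNzRingType) (f : {rmorphism K -> L}) (p : K) n j :
  f (qbin p n j) = qbin (f p) n j.
Proof.
elim: n j => [|n IH] [|j]/=; rewrite ?rmorph1 ?rmorph0//.
by rewrite rmorphD rmorphM rmorphXn !IH.
Qed.

Lemma qbinomial (K : comNzRingType) (p t : K) n :
  \prod_(k < n) (1 + t * p ^+ k) =
  \sum_(j < n.+1) p ^+ 'C(j, 2) * qbin p n j * t ^+ j.
Proof.
elim: n => [|n IH].
  by rewrite big_ord0 big_ord_recl big_ord0 /= addr0 !mulr1.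
pose a j := p ^+ 'C(j, 2) * qbin p n j * t ^+ j.
have e : \sum_(j < n.+1) a j = \sum_(j < n.+2) a j.
  by rewrite [RHS]big_ord_recr/= [X in _ + X]/a qbin_gt// mulr0 mul0r addr0.
rewrite big_ord_recr/= IH -/(a _) mulrDr mulr1 {1}e big_ord_recl [RHS]big_ord_recl.
rewrite {1}/a /= qbin0 -addrA; congr (_ + _).
rewrite mulr_suml -big_split/=; apply: eq_bigr => -[j jn] _ /=.
rewrite /bump/= add1n binS bin1 exprD exprSr.
have -> : p ^+ n = p ^+ j * p ^+ (n - j) by rewrite -exprD subnKC.
by rewrite /a add0n binS bin1 exprD !exprSr; ring.
Qed.

Definition qfact (K : comNzRingType) (p : K) (n : nat) : K :=
  \prod_(i < n) (1 - p ^+ i.+1).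

Lemma qfactS (K : comNzRingType) (p : K) n :
  qfact p n.+1 = qfact p n * (1 - p ^+ n.+1).
Proof. by rewrite /qfact big_ord_recr. Qed.

Lemma qbin_qfact (K : comNzRingType) (p : K) j k :
  qbin p (j + k) j * (qfact p j * qfact p k) = qfact p (j + k).
Proof.
have [n nE] : exists n, (j + k)%N = n by exists (j + k)%N.
elim: n j k nE => [|n IH] [|j] [|k]// nE.
- by rewrite qbin0 /qfact !big_ord0 !mulr1.
- by rewrite add0n qbin0 /qfact big_ord0 !mul1r.
- rewrite addn0 /= qbin_gt// subnn expr0 mul1r add0r.
  have := IH j 0%N; rewrite !addn0 in nE * => /(_ (succn_inj nE)) IHj.
  rewrite qfactS -{2}IHj; ring.
rewrite addSn/= mulrDl.
have jk : (j + k.+1 - j = k.+1)%N by rewrite addKn.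
rewrite jk; have nE' : (j + k.+1 = n)%N by move: nE; lia.
have h1 := IH j k.+1 nE'; have h2 := IH j.+1 k.
rewrite addSnnS in h2; move/(_ nE') in h2.
rewrite [RHS]qfactS.
(* The first summand completes [qfact p k] to index [k.+1], the second [qfact p j] to index
   [j.+1]. *)
rewrite (_ : 1 - p ^+ (j + k.+1).+1 =
   (1 - p ^+ k.+1) + p ^+ k.+1 * (1 - p ^+ j.+1)); last first.
  by rewrite (_ : (j + k.+1).+1 = (k.+1 + j.+1)%N) ?exprD; [ring|lia].
rewrite mulrDr -{1}h2 -h1 !qfactS.
ring.
Qed.

Lemma prod_center (K : comNzRingType) (F : nat -> K) N :
  \prod_(k < N.*2.+1) F k =
  F N * \prod_(i < N) (F (N + i.+1)%N * F (N - i.+1)%N).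
Proof.
rewrite -addnn -addnS big_split_ord/= big_ord_recl/= addn0 mulrCA.
congr (_ * _); rewrite big_split/= mulrC; congr (_ * _).
by rewrite (reindex_inj rev_ord_inj).
Qed.

(** Terms of Jacobi's theta_1 with nome q at x = exp (i z), without the constant containing q^(1/4),
    so that all exponents are integers. *)
Definition theta_term (K : fieldType) (q x : K) (m : int) : K :=
  (-1) ^ m * q ^ (m * (m - 1)) * x ^ (2 * m - 1).

Definition theta_prod (K : fieldType) (q x : K) (N : nat) : K :=
  (x^-1 - x) * \prod_(i < N)
    ((1 - (q ^+ 2) ^+ i.+1 * x ^+ 2) * (1 - (q ^+ 2) ^+ i.+1 / x ^+ 2)).

Lemma theta_termS (K : fieldType) (q x : K) (m : int) : q != 0 -> x != 0 ->
  theta_term q x (m + 1) = theta_term q x m * (- x ^+ 2 * q ^ (2 * m)).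
Proof.
move=> q0 x0; rewrite /theta_term.
have -> : (m + 1) * (m + 1 - 1) = m * (m - 1) + 2 * m by ring.
have -> : 2 * (m + 1) - 1 = (2 * m - 1) + 2 by ring.
rewrite [(-1) ^ _]expfzDr ?oppr_eq0 ?oner_neq0// [q ^ (_ + _)]expfzDr//.
rewrite [x ^ (_ + 2)]expfzDr// expr1z -(exprnP x 2); ring.
Qed.

(* Finite form of the Jacobi triple product. *)
Lemma theta_prod_sum (K : fieldType) (q x : K) N : q != 0 -> x != 0 ->
  theta_prod q x N =
  \sum_(j < N.*2.+2) qbin (q ^+ 2) N.*2.+1 j * theta_term q x (j%:Z - N%:Z).
Proof.
move=> q0 x0; set p := q ^+ 2; have p0 : p != 0 by rewrite expf_neq0.
have pX0 k : p ^+ k != 0 by rewrite expf_neq0.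
(* [D N] turns the two-sided product into the one-sided product of the q-binomial theorem at t = -
   x^2 / p^N. *)
pose D M := \prod_(i < M) (- x ^+ 2 / p ^+ i.+1).
have D0 M : D M != 0.
  by apply/prodf_neq0 => i _; rewrite mulf_neq0 ?invr_eq0 ?oppr_eq0 ?expf_neq0.
have D1 M : theta_term q x (- M%:Z) * D M = x^-1.
  elim: M => [|M IH].
    by rewrite /D big_ord0 /theta_term mulr1 oppr0 mul0r !expr0z !mul1r.
  have h := theta_termS (- M.+1%:Z) q0 x0.
  rewrite (_ : - M.+1%:Z + 1 = - M%:Z) in h; last by lia.
  have e : q ^ (2 * - M.+1%:Z) = (p ^+ M.+1)^-1.
    by rewrite mulrN -invr_expz /p -exprM.
  rewrite -IH h e /D big_ord_recr/= -/(D M); ring.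
have T j : p ^+ 'C(j, 2) * (- x ^+ 2 / p ^+ N) ^+ j * x^-1 =
    D N * theta_term q x (j%:Z - N%:Z).
  elim: j => [|j IH].
    rewrite (_ : 0%:Z - N%:Z = - N%:Z); last by lia.
    by rewrite [RHS]mulrC D1 bin0n !expr0 !mul1r.
  rewrite binS bin1 exprD exprSr.
  rewrite (_ : (j.+1%:Z - N%:Z) = (j%:Z - N%:Z) + 1); last by lia.
  rewrite theta_termS// [RHS]mulrA -IH.
  rewrite mulrBr expfzDr// (_ : q ^ (2 * j%:Z) = p ^+ j); last first.
    by rewrite /p -exprM.
  rewrite (_ : q ^ (- (2 * N%:Z)) = (p ^+ N)^-1); last first.
    by rewrite -invr_expz /p -exprM.
  by field; rewrite pX0 x0.
apply: (mulfI (D0 N)); rewrite mulr_sumr.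
under eq_bigr do rewrite mulrCA -T.
have -> : D N * theta_prod q x N =
    (\prod_(k < N.*2.+1) (1 + (- x ^+ 2 / p ^+ N) * p ^+ k)) * x^-1.
  rewrite (prod_center (fun k => 1 + - x ^+ 2 / p ^+ N * p ^+ k)).
  rewrite divfK// /theta_prod -/p.
  set P := \prod_(i < N) _; set Q := \prod_(i < N) _.
  have -> : Q = D N * P.
    rewrite /Q /P /D -big_split/=; apply: eq_bigr => -[i iN] _ /=.
    rewrite exprD mulrA divfK//.
    have -> : p ^+ N = p ^+ (N - i.+1) * p ^+ i.+1 by rewrite -exprD subnK.
    by field; rewrite !pX0 x0.
  by field.
rewrite qbinomial mulr_suml; apply: eq_bigr => j _.
by ring.
Qed.

(** * Bilateral theta series *)

(** The window is centred at 1/2, like the exponents m (m - 1); it is the range of summation of the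
    finite triple product. *)
Definition win (N : nat) : seq int := [seq j%:Z - N%:Z | j <- iota 0 N.*2.+2].

Lemma win_uniq N : uniq (win N).
Proof. by rewrite map_inj_uniq ?iota_uniq// => i j /eqP; lia. Qed.

Lemma mem_win N (m : int) : (m \in win N) = (- N%:Z <= m <= N%:Z + 1).
Proof.
apply/mapP/idP => [[j]|mN].
  by rewrite mem_iota add0n /= => jN ->; lia.
exists (absz (m + N%:Z)); first by rewrite mem_iota; lia.
by lia.
Qed.

Lemma sum_win (V : zmodType) (f : int -> V) N :
  \sum_(m <- win N) f m = \sum_(j < N.*2.+2) f (j%:Z - N%:Z).
Proof.
by rewrite big_map -[X in iota 0 X]subn0 -/(index_iota 0 _) big_mkord.
Qed.

Lemma sum_winS (V : zmodType) (f : int -> V) N :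
  \sum_(m <- win N.+1) f m =
  f (- N.+1%:Z) + \sum_(m <- win N) f m + f (N.+2%:Z).
Proof.
rewrite !sum_win doubleS big_ord_recl big_ord_recr/= -addrA; congr (_ + (_ + _)).
- by congr f; lia.
- by apply: eq_bigr => i _; congr f; rewrite /bump/=; lia.
- by congr f; rewrite /bump/=; lia.
Qed.

Lemma sum_win_nd (R : realType) (f : int -> R) : (forall m, 0 <= f m) ->
  {homo (fun N => \sum_(m <- win N) f m) : a b / (a <= b)%N >-> a <= b}.
Proof.
move=> f0; apply: homo_leq => [//| |N]; first by move=> ? ? ?; exact: le_trans.
by rewrite sum_winS; have := f0 (- N.+1%:Z); have := f0 N.+2%:Z; lra.
Qed.

Lemma sum_win_pow (R : realType) N :
  \sum_(m <- win N) (2^-1 : R) ^+ `|m| <= 4.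
Proof.
(* Strengthened for the induction: each step adds (3/4) 2^-N, exactly what the subtracted term
   loses. *)
suff : \sum_(m <- win N) (2^-1 : R) ^+ `|m| <= 4 - 3 / 2 * 2^-1 ^+ N.
  have : (0 : R) <= 2^-1 ^+ N by rewrite exprn_ge0// invr_ge0.
  lra.
elim: N => [|N IH].
  by rewrite sum_win !big_ord_recl big_ord0 /= !expr0; lra.
by rewrite sum_winS abszN /= !exprS in IH *; lra.
Qed.

Definition gauss (R : realType) (c r : R) (m : int) : R := c ^ (m * m) * r ^ m.

(** c^(i^2) r^i 2^i = (2 r c^i)^i is at most 1 as soon as 2 r c^i <= 1; the finitely many earlier i
    are covered by (1 + 2 r)^N. *)
Lemma gauss_nat_le (R : realType) (c r : R) : 0 < c < 1 -> 0 < r ->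
  exists C, forall i : nat, gauss c r i <= C * 2^-1 ^+ i.
Proof.
move=> /andP[c0 c1] r0.
have c1' : `|c| < 1 by rewrite gtr0_norm.
have e0 : 0 < (2 * r)^-1 by rewrite invr_gt0 mulr_gt0.
have [N _ NP] := (@cvgrPdistC_lt _ _ _ _ _ _ _).1 (cvg_expr c1') _ e0.
have cN i : (N <= i)%N -> c ^+ i * (2 * r) <= 1.
  move=> Ni; have := NP i Ni; rewrite /= subr0 gtr0_norm ?exprn_gt0// => h.
  by rewrite -ler_pdivlMr ?mulr_gt0// div1r ltW.
exists ((1 + 2 * r) ^+ N) => i.
rewrite exprVn ler_pdivlMr ?exprn_gt0//.
have -> : gauss c r i * 2 ^+ i = (c ^+ i * (2 * r)) ^+ i.
  rewrite /gauss -PoszM -!exprnP exprMn -exprM exprMn; ring.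
have x0 : 0 <= c ^+ i * (2 * r) by rewrite mulr_ge0 ?exprn_ge0 ?mulr_ge0 ?ltW.
have r1 : 1 <= 1 + 2 * r by rewrite lerDl mulr_ge0// ltW.
have [/cN ci|iN] := leqP N i.
  apply: le_trans (_ : 1 <= _); first by rewrite exprn_ile1.
  exact: exprn_ege1.
apply: le_trans (_ : (1 + 2 * r) ^+ i <= _).
  rewrite lerXn2r ?nnegrE//; first lra.
  have : c ^+ i <= 1 by rewrite exprn_ile1// ltW.
  move=> ci; have : c ^+ i * (2 * r) <= 1 * (2 * r).
    by rewrite ler_wpM2r// mulr_ge0// ltW.
  lra.
by rewrite ler_weXn2l// ltnW.
Qed.

Lemma gauss_ge0 (R : realType) (c r : R) m : 0 < c -> 0 < r -> 0 <= gauss c r m.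
Proof. by move=> c0 r0; rewrite mulr_ge0// exprz_ge0// ltW. Qed.

Lemma gauss_win (R : realType) (c r : R) : 0 < c < 1 -> 0 < r ->
  exists C, forall N, \sum_(m <- win N) gauss c r m <= C.
Proof.
move=> c01 r0; have c0 : 0 < c by case/andP: c01.
have [C CP] := gauss_nat_le c01 r0.
have ri0 : 0 < r^-1 by rewrite invr_gt0.
have [D DP] := gauss_nat_le c01 ri0.
have C0 : 0 <= C.
  by have := CP 0%N; rewrite expr0 mulr1; apply: le_trans; exact: gauss_ge0.
have D0 : 0 <= D.
  by have := DP 0%N; rewrite expr0 mulr1; apply: le_trans; exact: gauss_ge0.
exists ((C + D) * 4) => N.
apply: le_trans (_ : (C + D) * \sum_(m <- win N) 2^-1 ^+ `|m| <= _); last first.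
  by rewrite ler_wpM2l ?addr_ge0// sum_win_pow.
rewrite mulr_sumr; apply: ler_sum => m _; rewrite mulrDl.
have p0 : (0 : R) <= 2^-1 ^+ `|m| by rewrite exprn_ge0// invr_ge0.
have [m0|m0] := lerP 0 m.
  have -> : gauss c r m = gauss c r `|m|%N by congr gauss; lia.
  by rewrite (le_trans (CP _))// lerDl mulr_ge0.
have -> : gauss c r m = gauss c r^-1 `|m|%N.
  rewrite /gauss exprz_inv; congr (_ ^ _ * _ ^ _); lia.
by rewrite (le_trans (DP _))// lerDr mulr_ge0.
Qed.

(** Both products of window sums tend to the same limit. Applied to absolute values, this makes
    every summation region between [box N] and [box N.*2.+1] equivalent to [box N]. *)
Lemma sum_win_gap (R : realType) (f g : int -> R) (A B : R) :
  (forall m, 0 <= f m) -> (forall m, 0 <= g m) ->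
  (forall N, \sum_(m <- win N) f m <= A) ->
  (forall N, \sum_(m <- win N) g m <= B) ->
  (fun N => (\sum_(m <- win N.*2.+1) f m) * (\sum_(m <- win N.*2.+1) g m) -
            (\sum_(m <- win N) f m) * (\sum_(m <- win N) g m)) @ \oo --> (0 : R).
Proof.
move=> f0 g0 fA gB.
have cv (h : int -> R) (H : R) : (forall m, 0 <= h m) ->
    (forall N, \sum_(m <- win N) h m <= H) ->
    cvgn (fun N => \sum_(m <- win N) h m).
  move=> h0 hH; apply: nondecreasing_is_cvgn; first exact: sum_win_nd.
  by exists H => _ [N _ <-]; exact: hH.
have /cvg_ex[/= a fa] := cv _ _ f0 fA; have /cvg_ex[/= b gb] := cv _ _ g0 gB.
have dbl (u : nat -> R) (l : R) : u @ \oo --> l -> (fun N => u N.*2.+1) @ \oo --> l.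
  move=> /cvgrPdistC_lt ul; apply/cvgrPdistC_lt => e /ul[N _ NP].
  by exists N => // n /= Nn; apply: NP => /=; lia.
have := cvgB (cvgM (dbl _ _ fa) (dbl _ _ gb)) (cvgM fa gb).
by rewrite subrr; apply.
Qed.

Lemma sum_uniq_sub (V : zmodType) (T : eqType) (A D : seq T) (f : T -> V) :
  uniq A -> uniq D -> {subset A <= D} ->
  \sum_(x <- D) f x = \sum_(x <- A) f x + \sum_(x <- D | x \notin A) f x.
Proof.
move=> uA uD AD; rewrite (bigID (mem A))/=; congr (_ + _).
rewrite -big_filter; apply: perm_big; apply: uniq_perm => //.
  exact: filter_uniq.
by move=> x; rewrite mem_filter; case: (boolP (x \in A)) => // /AD.
Qed.

Lemma sum_sandwich (R : realType) (T : eqType) (A D B : seq T) (t : T -> R[i]) :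
  uniq A -> uniq D -> uniq B -> {subset A <= D} -> {subset D <= B} ->
  cn (\sum_(x <- D) t x - \sum_(x <- A) t x) <=
  \sum_(x <- B) cn (t x) - \sum_(x <- A) cn (t x).
Proof.
move=> uA uD uB AD DB.
rewrite (sum_uniq_sub t uA uD)// addrC addKr.
rewrite (sum_uniq_sub (fun x => cn (t x)) uA uB) => [|x /AD/DB//].
rewrite addrC addKr; apply: le_trans (ler_cn_sum _ _ _) _.
rewrite -big_filter -[leRHS]big_filter.
rewrite (@sum_uniq_sub _ _ [seq x <- D | x \notin A] [seq x <- B | x \notin A]).
- by rewrite lerDl; apply: sumr_ge0 => x _; exact: cn_ge0.
- exact: filter_uniq.
- exact: filter_uniq.
- by move=> x; rewrite !mem_filter => /andP[-> /DB].
Qed.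

Definition box N : seq (int * int) := [seq (m, n) | m <- win N, n <- win N].

Lemma box_uniq N : uniq (box N).
Proof. by apply: allpairs_uniq; rewrite ?win_uniq// => -[? ?] [? ?]. Qed.

Lemma mem_box N (x : int * int) :
  (x \in box N) = (x.1 \in win N) && (x.2 \in win N).
Proof.
case: x => a b /=; apply/allpairsP/andP => [[[m n]/= [mN nN [-> ->]]]//|[aN bN]].
by exists (a, b).
Qed.

(* the change of summation indices (m, n) = (j + k, j - k) or (j + k, j - k + 1) *)
Definition diamond N : seq (int * int) :=
  [seq (x.1 + x.2, x.1 - x.2) | x <- box N] ++
  [seq (x.1 + x.2, x.1 - x.2 + 1) | x <- box N].

Lemma diamond_uniq N : uniq (diamond N).
Proof.
rewrite cat_uniq 2?map_inj_uniq ?box_uniq ?andbT.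
(* The two halves are told apart by the parity of the sum of the coordinates. *)
- apply/hasPn => _ /mapP[[a b] _ ->]; apply/mapP => -[[c d] _ /= [h1 h2]].
  by lia.
- by move=> [a b] [c d] /= [h1 h2]; congr (_, _); lia.
- by move=> [a b] [c d] /= [h1 h2]; congr (_, _); lia.
Qed.

Lemma box_sub_diamond N : {subset box N <= diamond N}.
Proof.
move=> [m n]; rewrite mem_box/= !mem_win mem_cat => /andP[mN nN].
apply/orP; pose j := ((m + n) %/ 2)%Z.
have [e|o] := boolP ((2 %| m + n)%Z).
  left; apply/mapP; exists (j, m - j); last by rewrite /=; congr (_, _); rewrite /j; lia.
  by rewrite mem_box/= !mem_win /j; lia.
right; apply/mapP; exists (j, m - j); last by rewrite /=; congr (_, _); rewrite /j; lia.
by rewrite mem_box/= !mem_win /j; lia.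
Qed.

Lemma diamond_sub_box N : {subset diamond N <= box N.*2.+1}.
Proof.
move=> x; rewrite mem_cat => /orP[] /mapP[[a b]]; rewrite mem_box/= !mem_win => h ->;
  rewrite mem_box/= !mem_win; lia.
Qed.

Lemma eq_ccvg (R : realType) (u v : nat -> R[i]) l :
  u =1 v -> ccvg u l -> ccvg v l.
Proof. by move=> /funext ->. Qed.

Lemma gaussM (R : realType) (c a r : R) m :
  gauss c (a * r) m = a ^ m * gauss c r m.
Proof. by rewrite /gauss expfzMl mulrCA. Qed.

(** * The three-term relation of theta products *)

(** Up to a constant, [E_term] and [O_term] are the terms of theta_3 and theta_2 at the doubled
    argument, with nome q^2. *)
Definition E_term (K : fieldType) (q x : K) (j : int) : K :=
  q ^ (2 * (j * j)) * x ^ (4 * j).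

Definition O_term (K : fieldType) (q x : K) (j : int) : K :=
  q ^ (2 * (j * j) - 2 * j) * x ^ (4 * j - 2).

(** The exponent m (m - 1) + n (n - 1) separates in j and k: it is 2 j^2 - 2 j + 2 k^2 for (j + k, j
    - k) and 2 j^2 + 2 k^2 - 2 k for (j + k, j - k + 1). The sign is (-1)^(m + n). *)
Lemma theta_termM (K : fieldType) (q A B : K) (j k : int) :
  q != 0 -> A != 0 -> B != 0 ->
  (theta_term q (A * B) (j + k) * theta_term q (A / B) (j - k) =
   O_term q A j * E_term q B k) *
  (theta_term q (A * B) (j + k) * theta_term q (A / B) (j - k + 1) =
   - (E_term q A j * O_term q B k)).
Proof.
move=> q0 A0 B0.
have m1 : (-1 : K) != 0 by rewrite oppr_eq0 oner_eq0.
have dbl (m : int) : (-1 : K) ^ (m + m) = 1.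
  by rewrite expfzDr// -expfzMl mulrNN mulr1 exp1rz.
pose M (a b c : int) := q ^ a * A ^ b * B ^ c.
have MM a b c a' b' c' : M a b c * M a' b' c' = M (a + a') (b + b') (c + c').
  by rewrite /M !expfzDr//; ring.
have t1 m : theta_term q (A * B) m =
    (-1) ^ m * M (m * (m - 1)) (2 * m - 1) (2 * m - 1).
  by rewrite /theta_term /M expfzMl; ring.
have t2 m : theta_term q (A / B) m =
    (-1) ^ m * M (m * (m - 1)) (2 * m - 1) (- (2 * m - 1)).
  by rewrite /theta_term /M expfzMl exprz_inv; ring.
have oe : O_term q A j * E_term q B k =
    M (2 * (j * j) - 2 * j + 2 * (k * k)) (4 * j - 2) (4 * k).
  by rewrite /O_term /E_term /M [q ^ (_ + 2 * (k * k))]expfzDr//; ring.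
have eo : E_term q A j * O_term q B k =
    M (2 * (j * j) + (2 * (k * k) - 2 * k)) (4 * j) (4 * k - 2).
  by rewrite /O_term /E_term /M [q ^ (2 * (j * j) + _)]expfzDr//; ring.
rewrite !t1 !t2 oe eo; split.
  rewrite mulrACA MM -expfzDr// (_ : j + k + (j - k) = j + j); last by ring.
  rewrite dbl mul1r; congr M; ring.
rewrite mulrACA MM -expfzDr// (_ : j + k + (j - k + 1) = j + j + 1); last by ring.
rewrite expfzDr// dbl mul1r expr1z mulN1r; congr (- M _ _ _); ring.
Qed.

Lemma sum_box (V : zmodType) (f : int -> int -> V) N :
  \sum_(x <- box N) f x.1 x.2 = \sum_(m <- win N) \sum_(n <- win N) f m n.
Proof. by rewrite big_allpairs. Qed.

Lemma sum_boxM (K : comNzRingType) (f g : int -> K) N :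
  \sum_(x <- box N) f x.1 * g x.2 =
  (\sum_(m <- win N) f m) * (\sum_(n <- win N) g n).
Proof.
rewrite (sum_box (fun m n => f m * g n)) mulr_suml.
by apply: eq_bigr => m _; rewrite mulr_sumr.
Qed.

Lemma sum_diamond (K : fieldType) (q A B : K) N :
  q != 0 -> A != 0 -> B != 0 ->
  \sum_(x <- diamond N) theta_term q (A * B) x.1 * theta_term q (A / B) x.2 =
  (\sum_(j <- win N) O_term q A j) * (\sum_(k <- win N) E_term q B k) -
  (\sum_(j <- win N) E_term q A j) * (\sum_(k <- win N) O_term q B k).
Proof.
move=> q0 A0 B0; rewrite big_cat -[X in _ = X - _]sum_boxM.
rewrite -[X in _ = _ - X]sum_boxM -sumrN; congr (_ + _).
  by rewrite big_map; apply: eq_bigr => x _ /=; rewrite (theta_termM _ _ q0 A0 B0).1.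
by rewrite big_map; apply: eq_bigr => x _ /=; rewrite (theta_termM _ _ q0 A0 B0).2.
Qed.

Lemma cnXz (R : realType) (z : R[i]) (m : int) : cn (z ^ m) = cn z ^ m.
Proof. by case: m => n; rewrite /exprz ?cnV cnX. Qed.

(** The minors o_i e_j - e_i o_j satisfy the Pluecker relation, so only the products of theta values
    survive, with the common factor e^4. *)
Lemma three_term_scale (K : comNzRingType)
    (e t1 t2 t3 t4 t5 t6 t7 t8 t9 t10 t11 t12 o1 o2 o3 o4 e1 e2 e3 e4 : K) :
  e * t1 * (e * t2) * (e * t3 * (e * t4)) -
    (o1 * e2 - e1 * o2) * (o3 * e4 - e3 * o4) -
  (e * t5 * (e * t6) * (e * t7 * (e * t8)) -
    (o1 * e3 - e1 * o3) * (o2 * e4 - e2 * o4)) +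
  (e * t9 * (e * t10) * (e * t11 * (e * t12)) -
    (o1 * e4 - e1 * o4) * (o2 * e3 - e2 * o3)) =
  e ^+ 4 * (t1 * t2 * (t3 * t4) - t5 * t6 * (t7 * t8) + t9 * t10 * (t11 * t12)).
Proof. by ring. Qed.

Section ThetaLimit.
Variables (R : realType) (q : R).
Hypothesis q01 : 0 < q < 1.
Let q0 : 0 < q. Proof. by case/andP: q01. Qed.
Let q1 : q < 1. Proof. by case/andP: q01. Qed.
Let Q : R[i] := q%:C.
Let Q0 : Q != 0. Proof. by rewrite fmorph_eq0 gt_eqF. Qed.
Let cnQ : cn Q = q. Proof. by rewrite cn_real gtr0_norm. Qed.

Lemma cn_theta_term (x : R[i]) (m : int) : x != 0 ->
  cn (theta_term Q x m) = (cn x)^-1 * gauss q (cn x ^+ 2 / q) m.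
Proof.
rewrite -cn_gt0 => x0; have x0' : cn x != 0 by rewrite gt_eqF.
have q0' : q != 0 by rewrite gt_eqF.
rewrite /theta_term !cnM !cnXz cnN cn1 exp1rz mul1r cnQ /gauss.
rewrite expfzMl exprz_inv mulrBr mulr1 !expfzDr// exprN1.
by rewrite -(exprz_exp (cn x) 2 m) -exprnP; ring.
Qed.

Lemma cn_E_term (x : R[i]) (m : int) : x != 0 ->
  cn (E_term Q x m) = gauss (q ^+ 2) (cn x ^+ 4) m.
Proof.
move=> x0; rewrite /E_term !cnM !cnXz cnQ /gauss.
by rewrite -!exprz_exp -!exprnP.
Qed.

Lemma cn_O_term (x : R[i]) (m : int) : x != 0 ->
  cn (O_term Q x m) = (cn x ^+ 2)^-1 * gauss (q ^+ 2) (cn x ^+ 4 / q ^+ 2) m.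
Proof.
rewrite -cn_gt0 => x0; have x0' : cn x != 0 by rewrite gt_eqF.
have q0' : q != 0 by rewrite gt_eqF.
rewrite /O_term !cnM !cnXz cnQ /gauss [(cn x ^+ 4 / _) ^ m]expfzMl exprz_inv.
rewrite [q ^ (_ - 2 * m)]expfzDr// [cn x ^ (_ - 2)]expfzDr//.
rewrite -[q ^ (- (2 * m))]invr_expz -[(q ^+ 2) ^ (- m)]invr_expz.
rewrite -(exprz_exp q 2 m) -(exprz_exp (cn x) 4 m) -(exprz_exp q 2 (m * m)).
by rewrite -[cn x ^ (- _)]invr_expz -!exprnP; ring.
Qed.

Lemma win_bounded (f : int -> R[i]) (c r K : R) : 0 <= K -> 0 < c < 1 -> 0 < r ->
  (forall m, cn (f m) = K * gauss c r m) ->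
  exists C, forall N, \sum_(m <- win N) cn (f m) <= C.
Proof.
move=> K0 c01 r0 fE; have [C CP] := gauss_win c01 r0.
exists (K * C) => N; rewrite (eq_bigr _ (fun m _ => fE m)) -mulr_sumr.
by rewrite ler_wpM2l.
Qed.

Let q201 : 0 < q ^+ 2 < 1.
Proof. by rewrite exprn_gt0//= exprn_ilt1// ltW. Qed.

Lemma theta_win_bounded (x : R[i]) : x != 0 ->
  exists C, forall N, \sum_(m <- win N) cn (theta_term Q x m) <= C.
Proof.
move=> x0; have x0' : 0 < cn x by rewrite cn_gt0.
apply: (@win_bounded _ q (cn x ^+ 2 / q) (cn x)^-1) => //.
- by rewrite invr_ge0 ltW.
- by rewrite divr_gt0// exprn_gt0.
- by move=> m; exact: cn_theta_term.
Qed.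

Lemma E_win_bounded (x : R[i]) : x != 0 ->
  exists C, forall N, \sum_(m <- win N) cn (E_term Q x m) <= C.
Proof.
move=> x0; have x0' : 0 < cn x by rewrite cn_gt0.
apply: (@win_bounded _ (q ^+ 2) (cn x ^+ 4) 1) => //.
- by rewrite exprn_gt0.
- by move=> m; rewrite mul1r; exact: cn_E_term.
Qed.

Lemma O_win_bounded (x : R[i]) : x != 0 ->
  exists C, forall N, \sum_(m <- win N) cn (O_term Q x m) <= C.
Proof.
move=> x0; have x0' : 0 < cn x by rewrite cn_gt0.
apply: (@win_bounded _ (q ^+ 2) (cn x ^+ 4 / q ^+ 2) (cn x ^+ 2)^-1) => //.
- by rewrite invr_ge0 exprn_ge0// ltW.
- by rewrite divr_gt0// exprn_gt0.
- by move=> m; exact: cn_O_term.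
Qed.

Let p : R := q ^+ 2.
Let p0 : 0 < p. Proof. by rewrite exprn_gt0. Qed.
Let p1 : p < 1. Proof. by case/andP: q201. Qed.

Lemma qfact_gt0 n : 0 < qfact p n.
Proof.
by apply: prodr_gt0 => i _; rewrite subr_gt0 exprn_ilt1// ltW.
Qed.

Lemma qfact_ratio j n : (j <= n)%N ->
  1 - p ^+ j.+1 / (1 - p) <= qfact p n / qfact p j <= 1.
Proof.
move=> jn; have d0 : 0 < 1 - p by rewrite subr_gt0.
(* The induction carries the geometric sum p^(j+1) + ... + p^n in closed form. *)
suff : 1 - (p ^+ j.+1 - p ^+ n.+1) / (1 - p) <= qfact p n / qfact p j <= 1.
  move=> /andP[h ->]; rewrite andbT (le_trans _ h)// lerD2l lerN2 ler_pM2r ?invr_gt0//.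
  by rewrite gerBl exprn_ge0// ltW.
rewrite -(subnKC jn); elim: (n - j)%N => [|d IH].
  by rewrite addn0 subrr mul0r subr0 divff ?gt_eqF ?qfact_gt0// lexx.
rewrite addnS qfactS mulrAC; case/andP: IH; set r := qfact p _ / _ => h1 h2.
have P0 : 0 < p ^+ (j + d).+1 by rewrite exprn_gt0.
have P1 : p ^+ (j + d).+1 <= 1 by rewrite exprn_ile1// ltW.
have r0 : 0 < r by rewrite divr_gt0// qfact_gt0.
have e : (p ^+ j.+1 - p ^+ (j + d).+2) / (1 - p) =
    (p ^+ j.+1 - p ^+ (j + d).+1) / (1 - p) + p ^+ (j + d).+1.
  by rewrite [p ^+ (j + d).+2]exprSr; field; rewrite gt_eqF.
rewrite e; apply/andP; split; nra.
Qed.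

(** From some N on, [qfact_ratio] bounds the remaining factors below by 1/2; before N, monotonicity
    suffices. *)
Lemma qfact_lb : exists2 c, 0 < c & forall n, c <= qfact p n.
Proof.
have d0 : 0 < 1 - p by rewrite subr_gt0.
have p1' : `|p| < 1 by rewrite gtr0_norm.
have e0 : 0 < (1 - p) / 2 by rewrite divr_gt0.
have [N _ NP] := (@cvgrPdistC_lt _ _ _ _ _ _ _).1 (cvg_expr p1') _ e0.
have dec m n : (m <= n)%N -> qfact p n <= qfact p m.
  move=> mn; have /andP[_] := qfact_ratio mn.
  by rewrite ler_pdivrMr ?qfact_gt0// mul1r.
have hN n : (N <= n)%N -> qfact p N / 2 <= qfact p n.
  move=> Nn; have /andP[+ _] := qfact_ratio Nn.
  have := NP N.+1 (leqnSn N); rewrite /= subr0 gtr0_norm ?exprn_gt0// => h.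
  have : p ^+ N.+1 / (1 - p) <= 2^-1 by rewrite ler_pdivrMr// mulrC ltW.
  move=> h1 h2; have : 2^-1 <= qfact p n / qfact p N by lra.
  by rewrite ler_pdivlMr ?qfact_gt0// mulrC.
exists (qfact p N / 2); first by rewrite divr_gt0// qfact_gt0.
move=> n; have [/hN//|nN] := leqP N n.
by apply: le_trans (hN N (leqnn N)) (dec _ _ (ltnW nN)).
Qed.

(** The normalised coefficient is the product of qfact n / qfact j and qfact n / qfact k, both close
    to 1 when j and k are large. *)
Lemma qbin_near1 j k n : n = (j + k)%N ->
  `|qfact p n * qbin p n j - 1| <= (p ^+ j.+1 + p ^+ k.+1) / (1 - p).
Proof.
move=> nE; have jn : (j <= n)%N by rewrite nE leq_addr.
have kn : (k <= n)%N by rewrite nE leq_addl.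
have /andP[a1 a2] := qfact_ratio jn; have /andP[b1 b2] := qfact_ratio kn.
have -> : qfact p n * qbin p n j = (qfact p n / qfact p j) * (qfact p n / qfact p k).
  by have := qbin_qfact p j k; rewrite -nE => h; rewrite -{2}h; field; rewrite !gt_eqF ?qfact_gt0.
set r := _ / qfact p j in a1 a2 *; set s := _ / qfact p k in b1 b2 *.
have r0 : 0 < r by rewrite divr_gt0// qfact_gt0.
have s0 : 0 < s by rewrite divr_gt0// qfact_gt0.
by rewrite ler0_norm ?mulrDl; nra.
Qed.

Let th x N := \sum_(m <- win N) theta_term Q x m.
Let G x N := (qfact p N.*2.+1)%:C * theta_prod Q x N.

Lemma theta_prod_near (x : R[i]) : x != 0 -> ccvg (fun N => G x N - th x N) 0.
Proof.
move=> x0; have x0' : 0 < cn x by rewrite cn_gt0.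
have d0 : 0 < 1 - p by rewrite subr_gt0.
(* For j = m + N and k = N + 1 - m, the error in [qbin_near1] is p^N (p^(m+1) + p^(2-m)) / (1 - p):
   its growth in m is absorbed by the Gaussian decay of the terms, and p^N remains. *)
pose f (m : int) : R := (p ^ (m + 1) + p ^ (2 - m)) * cn (theta_term Q x m).
have [C CP] : exists C, forall N, \sum_(m <- win N) f m <= C.
  have c1 : 0 < p * (cn x ^+ 2 / q) by rewrite mulr_gt0// divr_gt0 ?exprn_gt0.
  have c2 : 0 < p^-1 * (cn x ^+ 2 / q).
    by rewrite mulr_gt0 ?invr_gt0// divr_gt0 ?exprn_gt0.
  have [C1 C1P] := gauss_win q01 c1; have [C2 C2P] := gauss_win q01 c2.
  exists ((cn x)^-1 * p * C1 + (cn x)^-1 * p ^+ 2 * C2) => N.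
  have -> : \sum_(m <- win N) f m =
     (cn x)^-1 * p * (\sum_(m <- win N) gauss q (p * (cn x ^+ 2 / q)) m) +
     (cn x)^-1 * p ^+ 2 * (\sum_(m <- win N) gauss q (p^-1 * (cn x ^+ 2 / q)) m).
    rewrite !mulr_sumr -big_split; apply: eq_bigr => m _ /=.
    rewrite /f cn_theta_term// !gaussM exprz_inv.
    rewrite [p ^ (m + 1)]expfzDr ?gt_eqF// [p ^ (2 - m)]expfzDr ?gt_eqF// expr1z.
    by rewrite -(exprnP p 2); ring.
  by rewrite lerD// ler_wpM2l// ?mulr_ge0 ?invr_ge0 ?exprn_ge0 ?ltW.
have pc : (fun N => C / (1 - p) * p ^+ N) @ \oo --> (0 : R).
  rewrite -(mulr0 (C / (1 - p))); apply: cvgMl_tmp; apply: cvg_expr.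
  by rewrite gtr0_norm.
apply: (ccvg_le _ pc) => N; rewrite subr0.
rewrite /G /th theta_prod_sum// sum_win mulr_sumr -sumrB.
apply: le_trans (ler_cn_sum _ _ _) _.
apply: le_trans (_ : \sum_(j < N.*2.+2) f (j%:Z - N%:Z) / (1 - p) * p ^+ N <= _).
  apply: ler_sum => -[j jN] _ /=.
  rewrite mulrA -[X in _ - X]mul1r -mulrBl cnM.
  have -> : (qfact p N.*2.+1)%:C * qbin (Q ^+ 2) N.*2.+1 j - 1 =
     (qfact p N.*2.+1 * qbin p N.*2.+1 j - 1)%:C.
    rewrite rmorphB rmorph1 rmorphM; congr (_ * _ - _).
    by rewrite (qbin_rmorph (real_complex R)) rmorphXn.
  rewrite cn_real /f [leRHS](_ : _ = (p ^ (j%:Z - N%:Z + 1) + p ^ (2 - (j%:Z - N%:Z)))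
      * p ^+ N / (1 - p) * cn (theta_term Q x (j%:Z - N%:Z))); last by ring.
  apply: ler_wpM2r; first exact: cn_ge0.
  have jk : (j + (N.*2.+1 - j))%N = N.*2.+1 by rewrite subnKC.
  apply: le_trans (qbin_near1 (esym jk)) _.
  rewrite ler_pM2r ?invr_gt0// mulrDl !exprnP -!expfzDr ?gt_eqF//.
  rewrite le_eqVlt; apply/orP; left; apply/eqP; congr (_ ^ _ + _ ^ _); lia.
rewrite -!mulr_suml -sum_win; apply: ler_wpM2r; first by rewrite exprn_ge0// ltW.
by rewrite ler_pM2r ?invr_gt0.
Qed.

Let W A B N := (\sum_(j <- win N) O_term Q A j) * (\sum_(k <- win N) E_term Q B k) -
  (\sum_(j <- win N) E_term Q A j) * (\sum_(k <- win N) O_term Q B k).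

Definition cbdd (u : nat -> R[i]) := exists C, forall N, cn (u N) <= C.

Lemma cbddM u v : cbdd u -> cbdd v -> cbdd (fun N => u N * v N).
Proof.
move=> [C uC] [D vD]; exists (C * D) => N; rewrite cnM.
by apply: ler_pM; rewrite ?cn_ge0.
Qed.

Lemma cbddD u v : cbdd u -> cbdd v -> cbdd (fun N => u N + v N).
Proof.
move=> [C uC] [D vD]; exists (C + D) => N.
by apply: le_trans (ler_cnD _ _) _; apply: lerD.
Qed.

Lemma cbddN u : cbdd u -> cbdd (fun N => - u N).
Proof. by move=> [C uC]; exists C => N; rewrite cnN. Qed.

Lemma null_cbddM u v : ccvg u 0 -> cbdd v -> ccvg (fun N => u N * v N) 0.
Proof.
move=> /ccvgP u0 [C vC].
have Cu : (fun N => C * cn (u N - 0)) @ \oo --> (0 : R).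
  by rewrite -(mulr0 C); exact: cvgMl_tmp.
apply: (ccvg_le _ Cu) => N; rewrite !subr0 cnM mulrC.
by rewrite ler_wpM2r ?cn_ge0.
Qed.

Lemma null_subM u v u' v' : cbdd u -> cbdd v' ->
  ccvg (fun N => u N - u' N) 0 -> ccvg (fun N => v N - v' N) 0 ->
  ccvg (fun N => u N * v N - u' N * v' N) 0.
Proof.
move=> ub vb' uu vv.
have := ccvgD (null_cbddM vv ub) (null_cbddM uu vb'); rewrite addr0.
by apply: eq_ccvg => N; ring.
Qed.

Lemma cbdd_null u v : cbdd v -> ccvg (fun N => u N - v N) 0 -> cbdd u.
Proof.
move=> [C vC] /ccvg_bounded[D uD]; exists (D + C) => N.
by rewrite -[u N](subrK (v N)) (le_trans (ler_cnD _ _))// lerD.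
Qed.

Lemma cbdd_win (f : int -> R[i]) :
  (exists C, forall N, \sum_(m <- win N) cn (f m) <= C) ->
  cbdd (fun N => \sum_(m <- win N) f m).
Proof.
by move=> [C CP]; exists C => N; apply: le_trans (ler_cn_sum _ _ _) _.
Qed.

Lemma W_bdd A B : A != 0 -> B != 0 -> cbdd (W A B).
Proof.
move=> A0 B0; apply: cbddD; last apply: cbddN; apply: cbddM; apply: cbdd_win;
  by [exact: O_win_bounded|exact: E_win_bounded].
Qed.

(** The product of window sums runs over [box N], its E/O form over [diamond N]; the difference is
    at most the absolute sum over [box N.*2.+1] outside [box N]. *)
Lemma thM_near A B : A != 0 -> B != 0 ->
  ccvg (fun N => th (A * B) N * th (A / B) N - W A B N) 0.
Proof.
move=> A0 B0; have AB0 : A * B != 0 by rewrite mulf_neq0.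
have AB0' : A / B != 0 by rewrite mulf_neq0 ?invr_eq0.
have [C1 C1P] := theta_win_bounded AB0; have [C2 C2P] := theta_win_bounded AB0'.
apply: (ccvg_le _ (sum_win_gap _ _ C1P C2P)) => [N|m|m]; try exact: cn_ge0.
rewrite subr0 cn_distC /W -sum_diamond// /th -sum_boxM -!sum_boxM.
apply: le_trans (sum_sandwich _ (box_uniq _) (diamond_uniq _) (box_uniq N.*2.+1)
  (@box_sub_diamond N) (@diamond_sub_box N)) _.
by rewrite le_eqVlt; apply/orP; left; apply/eqP; congr (_ - _);
  apply: eq_bigr => x _; rewrite cnM.
Qed.

Lemma GM_near A B : A != 0 -> B != 0 ->
  ccvg (fun N => G (A * B) N * G (A / B) N - W A B N) 0.
Proof.
move=> A0 B0; have AB0 : A * B != 0 by rewrite mulf_neq0.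
have AB0' : A / B != 0 by rewrite mulf_neq0 ?invr_eq0.
have b1 := cbdd_win (theta_win_bounded AB0).
have b2 := cbdd_win (theta_win_bounded AB0').
have n1 := theta_prod_near AB0; have n2 := theta_prod_near AB0'.
have := ccvgD (null_subM (cbdd_null b1 n1) b2 n1 n2) (thM_near A0 B0).
rewrite addr0; apply: eq_ccvg => N; rewrite -/(th _ N); ring.
Qed.

Lemma qfactV_bdd : cbdd (fun N => ((qfact p N)%:C : R[i])^-1).
Proof.
have [c c0 cP] := qfact_lb; exists c^-1 => N.
by rewrite cnV cn_real gtr0_norm ?qfact_gt0// lef_pV2 ?posrE ?qfact_gt0.
Qed.

Lemma theta_prod_bdd x : x != 0 -> cbdd (theta_prod Q x).
Proof.
move=> x0; have [C CP] := qfactV_bdd.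
have qV : cbdd (fun N => ((qfact p N.*2.+1)%:C : R[i])^-1) by exists C => N.
have [D DP] := cbddM (cbdd_null (cbdd_win (theta_win_bounded x0)) (theta_prod_near x0)) qV.
exists D => N; apply: le_trans (DP N).
by rewrite /G mulrAC divff ?mul1r// fmorph_eq0 gt_eqF// qfact_gt0.
Qed.

Lemma theta_three_term x y u v : x != 0 -> y != 0 -> u != 0 -> v != 0 ->
  let F N a b c d :=
    theta_prod Q (a * b) N * theta_prod Q (a / b) N *
    (theta_prod Q (c * d) N * theta_prod Q (c / d) N) in
  ccvg (fun N => F N x y u v - F N x u y v + F N x v y u) 0.
Proof.
move=> x0 y0 u0 v0 F.
pose P a b N := G (a * b) N * G (a / b) N.
have near a b c d : a != 0 -> b != 0 -> c != 0 -> d != 0 ->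
    ccvg (fun N => P a b N * P c d N - W a b N * W c d N) 0.
  move=> a0 b0 c0 d0; apply: null_subM.
  - exact: cbdd_null (W_bdd a0 b0) (GM_near a0 b0).
  - exact: W_bdd.
  - exact: GM_near.
  - exact: GM_near.
have := ccvgD (ccvgB (near _ _ _ _ x0 y0 u0 v0) (near _ _ _ _ x0 u0 y0 v0))
  (near _ _ _ _ x0 v0 y0 u0); rewrite subr0 addr0.
(* [G] carries this factor, which is bounded away from 0, so dividing by its fourth power preserves
   the limit 0. *)
pose e N := (qfact p N.*2.+1)%:C : R[i].
have eb : cbdd (fun N => (e N)^-1 ^+ 4).
  have [C CP] := qfactV_bdd; exists (C ^+ 4) => N.
  have C0 : 0 <= C := le_trans (cn_ge0 _) (CP 0%N).
  by rewrite cnX lerXn2r ?nnegrE ?cn_ge0//; exact: CP.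
move/null_cbddM => /(_ _ eb); apply: eq_ccvg => N.
have e0 : e N != 0 by rewrite fmorph_eq0 gt_eqF// qfact_gt0.
rewrite /P /F /G /W three_term_scale mulrC exprVn mulKf//.
exact: expf_neq0.
Qed.

End ThetaLimit.

(** * The sigma function of a rectangular lattice *)

Lemma cn_sqr (R : realType) (z : R[i]) :
  cn z ^+ 2 = complex.Re z ^+ 2 + complex.Im z ^+ 2.
Proof. by rewrite /cn normc_def/= sqr_sqrtr// addr_ge0// sqr_ge0. Qed.

Lemma mul1D_bound (R : realType) (A B : R[i]) (a b : R) :
  cn (A - 1) <= expR a - 1 -> cn (B - 1) <= expR b - 1 ->
  cn (A * B - 1) <= expR (a + b) - 1.
Proof.
move=> Aa Bb.
rewrite (_ : A * B - 1 = (A - 1) * (B - 1) + ((A - 1) + (B - 1))); last by ring.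
apply: le_trans (ler_cnD _ _) _; rewrite cnM expRD.
have := ler_cnD (A - 1) (B - 1); have := cn_ge0 (A - 1); have := cn_ge0 (B - 1).
nra.
Qed.

(** * Absolutely convergent double products *)

Definition rect (K : comNzRingType) (f : nat -> nat -> K) (a b c d : nat) : K :=
  \prod_(a <= m < b) \prod_(c <= n < d) f m n.

Lemma rect_bound (R : realType) (f : nat -> nat -> R[i]) (K : R) a b c d :
  (forall m n, cn (f m n - 1) <= K * (gtel R m * gtel R n)) ->
  cn (rect f a b c d - 1) <=
  expR (K * ((\sum_(a <= m < b) gtel R m) * (\sum_(c <= n < d) gtel R n))) - 1.
Proof.
move=> fK; rewrite /rect.
have -> : \prod_(a <= m < b) \prod_(c <= n < d) f m n =
    \prod_(x <- [seq (m, n) | m <- index_iota a b, n <- index_iota c d]) f x.1 x.2.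
  by rewrite big_allpairs.
apply: le_trans (prod1D_bound _ _) _; rewrite lerD2r ler_expR.
rewrite big_allpairs /= mulr_suml mulr_sumr; apply: ler_sum => m _.
by rewrite !mulr_sumr; apply: ler_sum => n _; exact: fK.
Qed.

Lemma rect_split (K : comNzRingType) (f : nat -> nat -> K) N M M' :
  (N <= M)%N -> (N <= M')%N ->
  rect f 0 M 0 M' = rect f 0 N 0 N * (rect f 0 N N M' * rect f N M 0 M').
Proof.
move=> NM NM'; rewrite /rect (big_cat_nat (leq0n N) NM)//= [RHS]mulrA; congr (_ * _).
by rewrite -big_split/=; apply: eq_bigr => m _; rewrite -(big_cat_nat (leq0n N) NM').
Qed.

Section RectLimit.
Variables (R : realType) (f : nat -> nat -> R[i]) (K : R).
Hypothesis K0 : 0 <= K.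
Hypothesis fK : forall m n, cn (f m n - 1) <= K * (gtel R m * gtel R n).

(** What is added to the square of side N splits into two strips, in each of which one weight sum is
    at most 1 / (N + 1). The bound is relative to the square product, so that it yields both
    convergence and nonvanishing of the limit. *)
Lemma rect_rel N M M' : (N <= M)%N -> (N <= M')%N ->
  cn (rect f 0 M 0 M' - rect f 0 N 0 N) <=
  cn (rect f 0 N 0 N) * (2 * K * expR (2 * K) / N.+1%:R).
Proof.
move=> NM NM'; rewrite (rect_split f NM NM') -{2}[rect f 0 N 0 N]mulr1 -mulrBr cnM.
apply: ler_wpM2l; first exact: cn_ge0.
have g1 := sum_gtel_le1 R; have N0 : (0 : R) <= N.+1%:R^-1 by rewrite invr_ge0.
have tail a : (N <= a)%N -> \sum_(N <= m < a) gtel R m <= N.+1%:R^-1.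
  by move=> Na; rewrite sum_gtel// gerBl invr_ge0.
have s0 a b : 0 <= \sum_(a <= m < b) gtel R m.
  by apply: sumr_ge0 => m _; exact: gtel_ge0.
apply: le_trans (mul1D_bound (rect_bound 0 N N M' fK) (rect_bound N M 0 M' fK)) _.
set y := K * _ + _; pose x : R := 2 * K / N.+1%:R.
have yx : y <= x.
  rewrite /y -mulrDr /x -mulrA mulrCA; apply: ler_wpM2l => //.
  have h1 := ler_pM (s0 0%N N) (s0 N M') (g1 N) (tail _ NM').
  have h2 := ler_pM (s0 N M) (s0 0%N M') (tail _ NM) (g1 M').
  by apply: le_trans (lerD h1 h2) _; rewrite mul1r mulr1 mulrDl mul1r.
have x0 : 0 <= x by rewrite /x !mulr_ge0.
have xK : x <= 2 * K by rewrite /x ler_piMr ?mulr_ge0// invf_le1 ?ltr0n// ler1n.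
apply: le_trans (_ : expR x - 1 <= _); first by rewrite lerD2r ler_expR.
have [h _] := expR_bounds x; rewrite !(ger0_norm x0) in h.
apply: le_trans (ler_norm _) _; apply: le_trans h _.
rewrite (_ : 2 * K * expR (2 * K) / _ = x * expR (2 * K)); last by rewrite /x; ring.
by rewrite ler_wpM2l// ler_expR.
Qed.

Lemma rect_le M M' : cn (rect f 0 M 0 M') <= expR K.
Proof.
have := rect_bound 0 M 0 M' fK; have := ler_distcn (rect f 0 M 0 M') 1.
rewrite cn1 => h1 h2; have : cn (rect f 0 M 0 M') <=
   expR (K * ((\sum_(0 <= m < M) gtel R m) * (\sum_(0 <= n < M') gtel R n))) by lra.
move/le_trans; apply; rewrite ler_expR ler_piMr// mulr_ile1 ?sum_gtel_le1//;
  by apply: sumr_ge0 => m _; exact: gtel_ge0.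
Qed.

Lemma rect_cvg : exists L,
  (forall M : nat -> nat, (forall N, (N <= M N)%N) ->
     ccvg (fun N => rect f 0 (M N) 0 N) L) /\
  ((forall m n, f m n != 0) -> L != 0).
Proof.
pose C := expR K * (2 * K * expR (2 * K)).
have near N M M' : (N <= M)%N -> (N <= M')%N ->
    cn (rect f 0 M 0 M' - rect f 0 N 0 N) <= C / N.+1%:R.
  move=> NM NM'; apply: le_trans (rect_rel NM NM') _.
  rewrite -[C / _]mulrA; apply: ler_wpM2r; last exact: rect_le.
  by rewrite !mulr_ge0 ?expR_ge0 ?invr_ge0.
have [L Lf] : exists L, ccvg (fun N => rect f 0 N 0 N) L.
  by apply: ccvg_cauchy (null_harmonic C) => n m nm; exact: near.
exists L; split.
  move=> M MN; apply: (ccvg_null Lf); apply: (ccvg_le _ (null_harmonic C)) => N.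
  by rewrite subr0; apply: near.
move=> f0.
(* A relative error of at most 1/2 keeps the limit away from 0. *)
have [N NP] : exists N, 2 * K * expR (2 * K) / N.+1%:R <= 2^-1.
  have /cvgrPdistC_lt /(_ 2^-1) := null_harmonic (2 * K * expR (2 * K)).
  have h : (0 : R) < 2^-1 by rewrite invr_gt0.
  move=> /(_ h)[N _ /(_ N (leqnn N))]; rewrite /= subr0 => /ltW hN.
  by exists N; exact: le_trans (ler_norm _) hN.
set P := rect f 0 N 0 N.
have P0 : P != 0.
  rewrite /P /rect prodf_seq_neq0; apply/allP => m _ /=.
  by rewrite prodf_seq_neq0; apply/allP => n _; exact: f0.
have : cn (L - P) <= cn P / 2.
  apply: (@ccvg_cn_le _ _ _ _ _ N Lf) => n Nn.
  by apply: le_trans (rect_rel Nn Nn) _; rewrite ler_wpM2l ?cn_ge0.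
apply: contraTneq => ->; rewrite sub0r cnN -ltNge.
by rewrite ltr_pdivrMr// ltr_pMr ?cn_gt0// ltr1n.
Qed.

End RectLimit.

(** * Weierstrass factors of the lattice Z + tau Z *)

Definition tau (R : realType) (t : R) : R[i] := 'i * t%:C.

(* one point of each pair {l, - l} of lattice points with coordinates
   (+- m, +- n), minus the origin *)
Definition halfpts (R : realType) (t : R) (m n : nat) : seq R[i] :=
  match m, n with
  | 0, 0 => [::]
  | m'.+1, 0 => [:: m'.+1%:R]
  | 0, n'.+1 => [:: n'.+1%:R * tau t]
  | m'.+1, n'.+1 => [:: n'.+1%:R * tau t + m'.+1%:R; n'.+1%:R * tau t - m'.+1%:R]
  end.

(** The Weierstrass factors of l and - l together; the linear terms of their exponents cancel. *)
Definition wfac (R : realType) (u l : R[i]) : R[i] :=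
  (1 - u ^+ 2 / l ^+ 2) * cexp (u ^+ 2 / l ^+ 2).

Definition gridfac (R : realType) (t : R) (u : R[i]) (m n : nat) : R[i] :=
  \prod_(l <- halfpts t m n) wfac u l.

(** Equality holds at m = 0, whence the 6. *)
Lemma invsq_le_gtelS (R : realType) m : (m.+1%:R ^+ 2)^-1 <= 6 * gtel R m.+1.
Proof.
have h1 : (1 : R) <= m.+1%:R by rewrite ler1n.
have e2 : (m.+2%:R : R) = m.+1%:R + 1 by rewrite -natr1.
have e3 : (m.+3%:R : R) = m.+1%:R + 2 by rewrite -addn2 natrD.
rewrite /gtel natrM e2 e3; move: (m.+1%:R : R) h1 => y h1.
rewrite -[leLHS]mul1r ler_pdivrMr ?exprn_gt0//; last lra.
rewrite mulrAC ler_pdivlMr; last nra.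
nra.
Qed.

Lemma halfpts_sqr (R : realType) (t : R) m n l : l \in halfpts t m n ->
  cn l ^+ 2 = m%:R ^+ 2 + (n%:R * t) ^+ 2.
Proof.
have tE k : (k%:R * tau t : R[i]) = 0 +i* (k%:R * t).
  rewrite /tau -(rmorph_nat (real_complex R)).
  by apply/eqP; rewrite eq_complex/=; apply/andP; split; apply/eqP; ring.
have nE k : (k%:R : R[i]) = k%:R +i* 0.
  by rewrite -(rmorph_nat (real_complex R)).
case: m n => [|m] [|n]; rewrite /= ?inE//.
- move/eqP=> ->; rewrite cn_sqr tE/=; ring.
- move/eqP=> ->; rewrite cn_sqr nE/=; ring.
by case/orP => /eqP ->; rewrite cn_sqr tE nE/=; ring.
Qed.

Lemma halfpts_bound (R : realType) (t : R) : 0 < t -> exists2 K : R, 0 <= K &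
  forall m n l, l \in halfpts t m n ->
  ((cn l ^+ 2)^-1) ^+ 2 <= K * (gtel R m * gtel R n).
Proof.
move=> t0; have ti0 : 0 < t^-1 by rewrite invr_gt0.
(* The constants are 12 = 6 / gtel 0 on the real axis, 12 t^-4 likewise on the imaginary axis, and 9
   t^-2 = 36 t^-2 / 4 off the axes, where a^2 + (b t)^2 >= 2 a b t. *)
exists (12 + 12 * t^-1 ^+ 4 + 9 * t^-1 ^+ 2).
  by rewrite !addr_ge0 ?mulr_ge0 ?exprn_ge0// ltW.
move=> m n l lP; rewrite (halfpts_sqr lP).
have g0 : gtel R 0 = 2^-1 by [].
have i0 k : (0 : R) <= (k.+1%:R ^+ 2)^-1 by rewrite invr_ge0 exprn_ge0.
have i1 k : (k.+1%:R ^+ 2)^-1 <= (1 : R).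
  by rewrite invf_le1 ?exprn_gt0// exprn_ege1// ler1n.
have t2 : 0 <= t^-1 ^+ 2 by rewrite sqr_ge0.
have t4 : 0 <= t^-1 ^+ 4 by rewrite exprn_ge0// ltW.
have aux (a b : R) : 0 < a -> 0 < b ->
    ((a ^+ 2 + (b * t) ^+ 2)^-1) ^+ 2 <= (a ^+ 2)^-1 * (b ^+ 2)^-1 * t^-1 ^+ 2 / 4.
  move=> a0 b0; have bt0 : 0 < b * t by rewrite mulr_gt0.
  rewrite [leRHS](_ : _ = ((2 * (a * (b * t)))^-1) ^+ 2); last first.
    by field; rewrite !gt_eqF.
  have p0 : 0 < 2 * (a * (b * t)) by rewrite !mulr_gt0.
  have d0 : 0 < a ^+ 2 + (b * t) ^+ 2 by rewrite addr_gt0 ?exprn_gt0.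
  rewrite lerXn2r ?nnegrE ?invr_ge0 ?(ltW p0) ?(ltW d0)// lef_pV2 ?posrE//.
  by have := sqr_ge0 (a - b * t); nra.
case: m n lP => [|m] [|n] // _; rewrite ?g0.
- rewrite expr0n add0r exprMn invfM -[(t ^+ 2)^-1]exprVn exprMn -exprM.
  have := invsq_le_gtelS R n; have := i0 n; have := i1 n; have := gtel_ge0 R n.+1.
  set g := gtel R n.+1; set y := (_ ^+ 2)^-1; set s := t^-1 ^+ 4; set s2 := t^-1 ^+ 2.
  move=> a1 a2 a3 a4; have : y ^+ 2 <= 6 * g by nra.
  move=> a5; have : y ^+ 2 * s <= 6 * g * s by rewrite ler_wpM2r.
  have : 0 <= g * s2 by rewrite mulr_ge0.
  by have : 0 <= g * s; [rewrite mulr_ge0|lra].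
- rewrite mul0r expr0n addr0.
  have := invsq_le_gtelS R m; have := i0 m; have := i1 m; have := gtel_ge0 R m.+1.
  set g := gtel R m.+1; set y := (_ ^+ 2)^-1; set s := t^-1 ^+ 4; set s2 := t^-1 ^+ 2.
  move=> a1 a2 a3 a4; have : y ^+ 2 <= 6 * g by nra.
  have : 0 <= g * s2 by rewrite mulr_ge0.
  by have : 0 <= g * s; [rewrite mulr_ge0|lra].
have := invsq_le_gtelS R m; have := invsq_le_gtelS R n.
have := gtel_ge0 R m.+1; have := gtel_ge0 R n.+1; have := i0 m; have := i0 n.
set g := gtel R m.+1; set h := gtel R n.+1.
set y := (m.+1%:R ^+ 2)^-1; set z := (n.+1%:R ^+ 2)^-1 => z0 y0 h0 g0' hz gy.
have m0 : (0 : R) < m.+1%:R by rewrite ltr0n.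
have n0 : (0 : R) < n.+1%:R by rewrite ltr0n.
apply: le_trans (_ : y * z * t^-1 ^+ 2 / 4 <= _).
  exact: aux.
have : y * z <= 6 * g * (6 * h) by apply: ler_pM.
move=> yz; have : y * z * t^-1 ^+ 2 <= 6 * g * (6 * h) * t^-1 ^+ 2 by rewrite ler_wpM2r.
have : 0 <= g * h by rewrite mulr_ge0.
move=> gh; have : 0 <= (g * h) * t^-1 ^+ 4 by rewrite mulr_ge0.
by lra.
Qed.

(** (1 - s) exp s - 1 = (1 - s) (exp s - 1 - s) - s^2 is of second order in s. *)
Lemma wfac_bound (R : realType) (b : R) (u l : R[i]) :
  cn (u ^+ 2 / l ^+ 2) <= b ->
  cn (wfac u l - 1) <= (4 * (1 + b) * expR b + 1) * cn (u ^+ 2 / l ^+ 2) ^+ 2.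
Proof.
rewrite /wfac; set s := _ / _ => sb; have s0 := cn_ge0 s.
have b0 : 0 <= b := le_trans s0 sb.
rewrite (_ : _ - 1 = (1 - s) * (cexp s - 1 - s) - s ^+ 2); last by ring.
apply: le_trans (ler_cnB _ _) _; rewrite cnM cnX mulrDl mul1r lerD2r.
have h1 : cn (1 - s) <= 1 + b.
  by apply: le_trans (ler_cnB _ _) _; rewrite cn1 lerD2l.
have h2 := cexp_bound s.
have h3 : expR (cn s) <= expR b by rewrite ler_expR.
apply: le_trans (_ : (1 + b) * (4 * cn s ^+ 2 * expR (cn s)) <= _).
  by apply: ler_pM; rewrite ?cn_ge0.
rewrite [leRHS](_ : _ = (1 + b) * (4 * cn s ^+ 2 * expR b)); last by ring.
rewrite !ler_wpM2l ?mulr_ge0 ?sqr_ge0//; lra.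
Qed.

Lemma size_halfpts (R : realType) (t : R) m n : (size (halfpts t m n) <= 2)%N.
Proof. by case: m n => [|m] [|n]. Qed.

Lemma gridfac_bound (R : realType) (t : R) (u : R[i]) : 0 < t ->
  exists2 K : R, 0 <= K &
    forall m n, cn (gridfac t u m n - 1) <= K * (gtel R m * gtel R n).
Proof.
move=> t0; have [K K0 KP] := halfpts_bound t0.
have g1 m : gtel R m <= 1 by rewrite invf_le1 ?ltr0n// ler1n.
pose b := cn u ^+ 2 * (1 + K).
have b0 : 0 <= b by rewrite mulr_ge0 ?sqr_ge0// addr_ge0.
pose D := (4 * (1 + b) * expR b + 1) * (cn u ^+ 4 * K).
have D0 : 0 <= D.
  by rewrite !mulr_ge0 ?addr_ge0 ?mulr_ge0 ?expR_ge0 ?exprn_ge0 ?cn_ge0// addr_ge0.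
exists (2 * D * expR (2 * D)); first by rewrite mulr_ge0 ?expR_ge0// mulr_ge0.
move=> m n; set g := gtel R m * gtel R n.
have g0 : 0 <= g by rewrite mulr_ge0 ?gtel_ge0.
have g1' : g <= 1 by rewrite mulr_ile1 ?gtel_ge0.
have lP l : l \in halfpts t m n -> cn (wfac u l - 1) <= D * g.
  move=> /KP; set y := (cn l ^+ 2)^-1 => yK.
  have y0 : 0 <= y by rewrite invr_ge0 sqr_ge0.
  have y1 : y <= 1 + K.
    have : K * g <= K by rewrite ler_piMr.
    have := yK; rewrite -/g; nra.
  have sE : cn (u ^+ 2 / l ^+ 2) = cn u ^+ 2 * y by rewrite cnM cnV !cnX.
  have sb : cn (u ^+ 2 / l ^+ 2) <= b by rewrite sE ler_wpM2l ?sqr_ge0.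
  apply: le_trans (wfac_bound sb) _; rewrite /D -[leRHS]mulrA; apply: ler_wpM2l.
    by rewrite addr_ge0// !mulr_ge0 ?expR_ge0// addr_ge0.
  by rewrite sE exprMn -exprM -mulrA; apply: ler_wpM2l; rewrite ?exprn_ge0 ?cn_ge0.
apply: le_trans (prod1D_bound _ _) _.
set x := \sum_(_ <- _) _.
have xg : x <= 2 * D * g.
  apply: le_trans (_ : \sum_(l <- halfpts t m n) D * g <= _).
    by rewrite /x !big_seq; apply: ler_sum => l; exact: lP.
  rewrite big_const_seq count_predT iter_addr_0 -mulrA [leRHS]mulr_natl.
  rewrite -[_ *+ size _]mulr_natr -[_ *+ 2]mulr_natr.
  apply: ler_wpM2l; first by rewrite mulr_ge0.
  by rewrite ler_nat size_halfpts.
have x0 : 0 <= x by apply: sumr_ge0 => l _; exact: cn_ge0.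
have xD : x <= 2 * D by apply: le_trans xg _; rewrite ler_piMr// mulr_ge0.
have [h _] := expR_bounds x; rewrite !(ger0_norm x0) in h.
apply: le_trans (ler_norm _) _; apply: le_trans h _.
rewrite mulrAC; apply: ler_pM; rewrite ?expR_ge0 ?ler_expR//.
Qed.

(** * Truncated sigma products, with and without exponentials, row by row *)

Definition polyfac (R : realType) (t : R) (u : R[i]) (m n : nat) : R[i] :=
  \prod_(l <- halfpts t m n) (1 - u ^+ 2 / l ^+ 2).

Definition rect_sigma (R : realType) (t : R) (u : R[i]) (M N : nat) : R[i] :=
  u * rect (gridfac t u) 0 M.+1 0 N.+1.

Definition rect_poly (R : realType) (t : R) (u : R[i]) (M N : nat) : R[i] :=
  u * rect (polyfac t u) 0 M.+1 0 N.+1.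

Definition rect_invsq (R : realType) (t : R) (M N : nat) : R[i] :=
  \sum_(0 <= m < M.+1) \sum_(0 <= n < N.+1) \sum_(l <- halfpts t m n) (l ^+ 2)^-1.

Lemma rect_sigmaE (R : realType) (t : R) (u : R[i]) M N :
  rect_sigma t u M N = cexp (rect_invsq t M N * u ^+ 2) * rect_poly t u M N.
Proof.
rewrite /rect_sigma /rect_poly mulrCA; congr (_ * _); rewrite mulrC /rect_invsq.
rewrite !mulr_suml cexp_sum -big_split; apply: eq_bigr => m _ /=.
rewrite !mulr_suml cexp_sum -big_split; apply: eq_bigr => n _ /=.
rewrite !mulr_suml cexp_sum -big_split; apply: eq_bigr => l _ /=.
by rewrite mulrC /wfac mulrC [(l ^+ 2)^-1 * _]mulrC mulrC.
Qed.

Lemma tauE (R : realType) (t : R) k : (k%:R * tau t : R[i]) = 0 +i* (k%:R * t).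
Proof.
rewrite /tau -(rmorph_nat (real_complex R)).
by apply/eqP; rewrite eq_complex/=; apply/andP; split; apply/eqP; ring.
Qed.

Lemma tauD_neq0 (R : realType) (t : R) (z : R[i]) n : 0 < t ->
  complex.Im z = 0 -> n.+1%:R * tau t + z != 0.
Proof.
move=> t0 z0; apply/eqP => /(congr1 (@complex.Im R)); rewrite tauE.
case: z z0 => a b /= ->; rewrite addr0; apply/eqP.
by rewrite mulf_neq0 ?pnatr_eq0// gt_eqF.
Qed.

Lemma Im_nat (R : realType) k : complex.Im (k%:R : R[i]) = 0.
Proof. by rewrite -(rmorph_nat (real_complex R)). Qed.

(** The points of row n and their opposites are the zeros of sin pi (n tau - u) sin pi (n tau + u);
    dividing by the value at u = 0 normalises the row. *)
Lemma rect_poly_rows (R : realType) (t : R) (u : R[i]) M N : 0 < t ->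
  rect_poly t u M N = sinprod u M * \prod_(n < N)
    (sinprod (n.+1%:R * tau t - u) M * sinprod (n.+1%:R * tau t + u) M /
     sinprod (n.+1%:R * tau t) M ^+ 2).
Proof.
move=> t0; rewrite /rect_poly /rect exchange_big/= big_ltn// mulrA; congr (_ * _).
  rewrite /sinprod big_ltn// /polyfac big_nil mul1r big_add1 big_mkord.
  by congr (_ * _); apply: eq_bigr => m _; rewrite big_seq1.
rewrite big_add1 big_mkord; apply: eq_bigr => -[n nN] _ /=.
set a := n.+1%:R * tau t.
have a0 : a != 0 by rewrite -[a]addr0 tauD_neq0.
have ap k : a + k%:R != 0 by rewrite tauD_neq0// Im_nat.
have am k : a - k%:R != 0.
  by rewrite tauD_neq0// -[k%:R](rmorph_nat (real_complex R)) /= oppr0.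
have k0 k : (k.+1%:R : R[i]) != 0 by rewrite pnatr_eq0.
rewrite big_ltn// big_add1 big_mkord {1}/polyfac /= big_seq1.
rewrite (eq_bigr (fun m : 'I_M => ((1 - (a - u) ^+ 2 / m.+1%:R ^+ 2) *
  (1 - (a + u) ^+ 2 / m.+1%:R ^+ 2)) / (1 - a ^+ 2 / m.+1%:R ^+ 2) ^+ 2)); last first.
  move=> m _; rewrite /polyfac /= big_cons big_seq1 -/a.
  have := ap m.+1; have := am m.+1; have := k0 m; move: (m.+1%:R : R[i]) => k kn kma kpa.
  have kam : k - a != 0 by rewrite -opprB oppr_eq0.
  have -> : 1 - a ^+ 2 / k ^+ 2 = (k - a) * (a + k) / k ^+ 2 by field.
  by field; rewrite kn kam kpa kma.
rewrite prodf_div big_split/= prodrXl /sinprod.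
set A := \prod_(i < M) _; set B := \prod_(i < M) _; set C := \prod_(i < M) _.
have C0 : C != 0.
  apply/prodf_neq0 => m _; have := ap m.+1; have := am m.+1; have := k0 m.
  move: (m.+1%:R : R[i]) => k kn kma kpa.
  have -> : 1 - a ^+ 2 / k ^+ 2 = - ((a - k) * (a + k)) / k ^+ 2 by field.
  by rewrite !mulf_neq0 ?invr_eq0 ?oppr_eq0 ?mulf_neq0 ?expf_neq0.
by rewrite -/a; field; rewrite a0 C0.
Qed.

(** * From rows of sines to theta products, and the three-term relation of sigma *)

Section SigmaLimit.
Variables (R : realType) (t : R).
Hypothesis t0 : 0 < t.
(** The nome exp (i pi tau) for tau = i t. *)
Let q : R := expR (- (pi * t)).
Let q01 : 0 < q < 1.
Proof. by rewrite expR_gt0/= -expR0 ltr_expR oppr_lt0 mulr_gt0 ?pi_gt0. Qed.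
Let p : R := q ^+ 2.

Definition cexpi (u : R[i]) : R[i] := cexp ('i * pi%:C * u).

Lemma cexpi_neq0 u : cexpi u != 0. Proof. exact: cexp_neq0. Qed.

Lemma cexpiD u v : cexpi (u + v) = cexpi u * cexpi v.
Proof. by rewrite /cexpi mulrDr cexpD. Qed.

Lemma cexpiB u v : cexpi (u - v) = cexpi u / cexpi v.
Proof. by rewrite /cexpi mulrBr cexpD cexpN. Qed.

Lemma cexpi_tau n : cexpi (n%:R * tau t) = (q ^+ n)%:C.
Proof.
rewrite /cexpi /tau; have -> : 'i * pi%:C * (n%:R * ('i * t%:C)) = (- (pi * t))%:C *+ n.
  have i2 : 'i * 'i = -1 :> R[i] by rewrite -expr2 sqr_i.
  rewrite -[RHS]mulr_natl rmorphN rmorphM -[- (_ * _)]mulN1r -i2; ring.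
by rewrite cexpMn cexp_real rmorphXn.
Qed.

Lemma csinpiE u : csinpi u = (cexpi u - (cexpi u)^-1) / (2 * 'i * pi%:C).
Proof. by rewrite /csinpi cexpN. Qed.

Let qn1 n : q ^+ n.+1 != 1.
Proof. by case/andP: q01 => a b; rewrite lt_eqF// exprn_ilt1// ltW. Qed.

Let den0 : 2 * 'i * pi%:C != 0 :> R[i].
Proof.
rewrite !mulf_neq0 ?pnatr_eq0//; first by rewrite eq_complex/= oner_eq0 andbF.
by rewrite fmorph_eq0 gt_eqF ?pi_gt0.
Qed.

Let Qc : R[i] := q%:C.
Let Qc0 : Qc != 0.
Proof. by case/andP: q01 => a _; rewrite fmorph_eq0 gt_eqF. Qed.

Let Qcn1 n : 1 - (Qc ^+ 2) ^+ n.+1 != 0.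
Proof.
rewrite subr_eq0 eq_sym -exprM mulnC muln2 -addnn addSn -rmorphXn/=.
by rewrite -(rmorph1 (real_complex R)) (inj_eq (@complexI R)) qn1.
Qed.

Lemma csinpi_tau_neq0 n : csinpi (n.+1%:R * tau t) != 0.
Proof.
rewrite csinpiE cexpi_tau mulf_neq0 ?invr_eq0// rmorphXn/= -/Qc.
have := Qcn1 n; apply: contra => /eqP h; apply/eqP.
have X0 : Qc ^+ n.+1 != 0 by rewrite expf_neq0.
rewrite -exprM mulnC exprM; set X := Qc ^+ n.+1 in h X0 *.
by rewrite (_ : 1 - X ^+ 2 = - X * (X - X^-1)); [rewrite h mulr0|field].
Qed.

(** The sign comes from x^-1 - x in [theta_prod] against x - x^-1 in the sine, the square from the
    squared sine in the denominator of each row. *)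
Let kap N : R[i] := - (2 * 'i * pi%:C)^-1 * ((qfact p N)%:C)^-1 ^+ 2.

Let poly_lim (u : R[i]) N : R[i] := kap N * theta_prod Qc (cexpi u) N.

Lemma rect_poly_cvg (u : R[i]) N :
  ccvg (fun M => rect_poly t u M N) (poly_lim u N).
Proof.
have -> : poly_lim u N = csinpi u * \prod_(n < N)
    (csinpi (n.+1%:R * tau t - u) * csinpi (n.+1%:R * tau t + u) /
     csinpi (n.+1%:R * tau t) ^+ 2).
  rewrite csinpiE /poly_lim /kap /theta_prod.
  have -> : ((qfact p N)%:C)^-1 ^+ 2 = \prod_(i < N) (1 - (Qc ^+ 2) ^+ i.+1)^-1 ^+ 2.
    rewrite /qfact rmorph_prod/= -prodfV -prodrXl; apply: eq_bigr => i _.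
    by rewrite rmorphB rmorph1 !rmorphXn.
  set x := cexpi u; have x0 : x != 0 by exact: cexpi_neq0.
  set A := \prod_(i < N) _; set B := \prod_(i < N) _; set D := \prod_(i < N) _.
  have -> : D = A * B.
    rewrite /A /B /D -big_split/=; apply: eq_bigr => -[i iN] _ /=.
    rewrite !csinpiE cexpiB cexpiD -/x cexpi_tau rmorphXn/= -/Qc.
    have := Qcn1 i; have X0 : Qc ^+ i.+1 != 0 by rewrite expf_neq0.
    rewrite -exprM mulnC exprM; move: (Qc ^+ i.+1) X0 (2 * 'i * pi%:C) den0.
    move=> X X0 d d0 X1; have X2 : X ^+ 2 - 1 != 0 by rewrite -opprB oppr_eq0.
    by field; rewrite x0 X0 d0 X1 /= ?X2.
  by move: (2 * 'i * pi%:C) den0 => d d0; field; rewrite d0 x0.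
rewrite (_ : (fun M => _) = (fun M => sinprod u M * \prod_(n < N)
    (sinprod (n.+1%:R * tau t - u) M * sinprod (n.+1%:R * tau t + u) M /
     sinprod (n.+1%:R * tau t) M ^+ 2))); last first.
  by apply/funext => M; rewrite rect_poly_rows.
apply: ccvgM; first exact: ccvg_sinprod.
apply: ccvg_prod => n; apply: ccvgM.
  by apply: ccvgM; exact: ccvg_sinprod.
apply: ccvgV; first by rewrite expf_neq0// csinpi_tau_neq0.
by apply: ccvgX; exact: ccvg_sinprod.
Qed.

Lemma kap_bdd : cbdd kap.
Proof.
have [C CP] := qfactV_bdd q01; exists (cn (2 * 'i * pi%:C : R[i])^-1 * C ^+ 2) => N.
have C0 : 0 <= C := le_trans (cn_ge0 _) (CP 0%N).
rewrite /kap mulNr cnN cnM cnX; apply: ler_wpM2l; first exact: cn_ge0.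
by rewrite lerXn2r ?nnegrE ?cn_ge0//; exact: CP.
Qed.

Lemma poly_lim_bdd u : cbdd (poly_lim u).
Proof. exact: cbddM kap_bdd (theta_prod_bdd q01 (cexpi_neq0 u)). Qed.

Definition three_term (s : R[i] -> R[i]) (x y u v : R[i]) : R[i] :=
  s (x + y) * s (x - y) * (s (u + v) * s (u - v)) -
  s (x + u) * s (x - u) * (s (y + v) * s (y - v)) +
  s (x + v) * s (x - v) * (s (y + u) * s (y - u)).

Lemma poly_lim_three_term x y u v :
  ccvg (fun N => three_term (poly_lim^~ N) x y u v) 0.
Proof.
have k4 : cbdd (fun N => kap N * kap N * (kap N * kap N)).
  by apply: cbddM; apply: cbddM; exact: kap_bdd.
have := theta_three_term q01 (cexpi_neq0 x) (cexpi_neq0 y) (cexpi_neq0 u) (cexpi_neq0 v).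
move=> /null_cbddM /(_ k4); apply: eq_ccvg => N.
rewrite /three_term /poly_lim !cexpiB !cexpiD -/Qc; ring.
Qed.

Definition lat_sigma (u : R[i]) : R[i] :=
  u * clim (fun N => rect (gridfac t u) 0 N.+1 0 N.+1).

Lemma rect_sigma_cvg (u : R[i]) (M : nat -> nat) : (forall N, (N <= M N)%N) ->
  ccvg (fun N => rect_sigma t u (M N) N) (lat_sigma u).
Proof.
move=> MN; have [K K0 KP] := gridfac_bound u t0.
have [L [LP _]] := rect_cvg K0 KP.
have S1 n : (n <= n.+1)%N by [].
have LE : clim (fun N => rect (gridfac t u) 0 N.+1 0 N.+1) = L.
  exact: ccvg_clim (ccvg_comp S1 (LP id (fun=> leqnn _))).
rewrite /lat_sigma LE; apply: ccvgM; first exact: ccvg_cst.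
(* The rectangles have sides [(M N).+1] and [N.+1]: the general statement is applied to the function
   shifted by one, with an arbitrary admissible value at 0, and [ccvg_comp] shifts back. *)
have h N : (N <= (if N is N'.+1 then (M N').+1 else 0))%N by case: N.
exact: ccvg_comp S1 (LP _ h).
Qed.

Lemma lat_sigma_neq0 (u : R[i]) :
  (forall m n : int, u != m%:~R + n%:~R * tau t) -> lat_sigma u != 0.
Proof.
move=> uP; have u0 : u != 0 by have := uP 0 0; rewrite mul0r addr0.
have [K K0 KP] := gridfac_bound u t0.
have [L [LP L0]] := rect_cvg K0 KP.
have S1 n : (n <= n.+1)%N by [].
rewrite /lat_sigma (ccvg_clim (ccvg_comp S1 (LP id (fun=> leqnn _)))) mulf_neq0// L0//.
move=> m n; rewrite /gridfac prodf_seq_neq0; apply/allP => l lP /=.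
rewrite mulf_neq0 ?cexp_neq0//.
have hl : exists a b : int, l = a%:~R + b%:~R * tau t.
  case: m n lP => [|m] [|n]; rewrite /= ?inE//.
  - by move=> /eqP ->; exists 0, n.+1%:Z; rewrite add0r.
  - by move=> /eqP ->; exists m.+1%:Z, 0; rewrite mul0r addr0.
  - move=> /orP[] /eqP ->; [exists m.+1%:Z, n.+1%:Z|exists (- m.+1%:Z), n.+1%:Z].
      by rewrite addrC.
    by rewrite addrC rmorphN.
have [a [b lE]] := hl.
have ul : u != l by rewrite lE uP.
have ul' : u != - l.
  by have := uP (- a) (- b); rewrite lE !rmorphN mulNr -opprD.
have [->|l0] := eqVneq l 0; first by rewrite expr0n invr0 mulr0 subr0 oner_neq0.
rewrite (_ : 1 - _ = - ((u - l) * (u + l)) / l ^+ 2); last by field.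
by rewrite !mulf_neq0 ?invr_eq0 ?oppr_eq0 ?mulf_neq0 ?expf_neq0// ?subr_eq0// addr_eq0.
Qed.

Lemma lat_sigma_small (u : R[i]) : u != 0 -> cn u ^+ 2 < 1 -> cn u ^+ 2 < t ^+ 2 ->
  lat_sigma u != 0.
Proof.
move=> u0 u1 ut; apply: lat_sigma_neq0 => m n; apply/eqP => uE.
have cu : cn u ^+ 2 = m%:~R ^+ 2 + (n%:~R * t) ^+ 2.
  rewrite cn_sqr uE /tau.
  rewrite -!(rmorph_int (real_complex R)) /= ; ring.
have sq (k : int) : k != 0 -> 1 <= (k%:~R : R) ^+ 2.
  move=> k0; rewrite -real_normK ?num_real// exprn_ege1// -intr_norm.
  by rewrite ler1z; lia.
have [m0|/sq m1] := eqVneq m 0; last by have := sqr_ge0 (n%:~R * t); lra.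
have [n0|/sq n1] := eqVneq n 0; last first.
  have := sqr_ge0 (m%:~R : R); move: cu; rewrite exprMn; have := sqr_ge0 t; nra.
by move: u0; rewrite uE m0 n0 mul0r addr0 eqxx.
Qed.

(* The sums S of 1 / l^2 over rectangles need not be bounded for this argument:
   if k w^2 = - W, the k-th power of the truncated sigma at w contains
   exp (- S W), which cancels the factor exp (S W) of the three-term expression. *)
Lemma choose_scale (W : R[i]) : exists (w : R[i]) (k : nat),
  k%:R * w ^+ 2 = - W /\ lat_sigma w ^+ k != 0.
Proof.
have [->|W0] := eqVneq W 0.
  by exists 0, 0%N; rewrite mul0r oppr0 expr0 oner_neq0.
pose d := Num.min 1 (t ^+ 2).
have d0 : 0 < d by rewrite lt_min ltr01 exprn_gt0.
have W1 : 0 <= cn W / d by rewrite divr_ge0 ?cn_ge0// ltW.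
(* |w|^2 = |W| / k < d puts w closer to 0 than any other lattice point. *)
pose k := (Num.truncn (cn W / d)).+1.
have kW : cn W / d < k%:R by have := truncn_itv W1; rewrite /k => /andP[].
have k0 : (k%:R : R[i]) != 0 by rewrite pnatr_eq0.
exists (sqrtc (- W / k%:R)), k; rewrite sqr_sqrtc mulrC divfK//; split => //.
have wd : cn (sqrtc (- W / k%:R)) ^+ 2 < d.
  rewrite -cnX sqr_sqrtc cnM cnN cnV cn_nat ltr_pdivrMr ?ltr0n//.
  by rewrite mulrC -ltr_pdivrMr.
rewrite expf_neq0// lat_sigma_small//.
- by rewrite sqrtc_eq0 mulf_neq0 ?oppr_eq0 ?invr_eq0.
- by apply: lt_le_trans wd _; rewrite ge_min lexx.
- by apply: lt_le_trans wd _; rewrite ge_min lexx orbT.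
Qed.

(** A diagonal choice: for each N, finitely many points can share one M, so no uniformity in u is
    required of the row limits. *)
Lemma common_columns (ps : seq R[i]) N : exists M, (N <= M)%N /\
  forall u, u \in ps -> cn (rect_poly t u M N - poly_lim u N) <= N.+1%:R^-1.
Proof.
have e0 : (0 : R) < N.+1%:R^-1 by rewrite invr_gt0 ltr0n.
suff [M0 MP] : exists M0, forall M, (M0 <= M)%N -> forall u, u \in ps ->
    cn (rect_poly t u M N - poly_lim u N) <= N.+1%:R^-1.
  by exists (maxn N M0); rewrite leq_maxl; split => // u; apply: MP; rewrite leq_maxr.
elim: ps => [|a ps [M1 IH]]; first by exists 0%N.
have [M2 M2P] := (ccvg_epsP _ _).1 (@rect_poly_cvg a N) _ e0.
exists (maxn M1 M2) => M; rewrite geq_max => /andP[h1 h2] u; rewrite inE.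
by move=> /predU1P[->|/IH]; [exact: ltW (M2P _ h2)|apply].
Qed.

Lemma lat_sigma_three_term x y u v : three_term lat_sigma x y u v = 0.
Proof.
(* The common sum of the squares of the four arguments in each of the three products. *)
pose W := 2 * (x ^+ 2 + y ^+ 2 + u ^+ 2 + v ^+ 2).
have [w [k [kw w0]]] := choose_scale W.
pose ps := [:: w; x + y; x - y; u + v; u - v; x + u; x - u; y + v; y - v;
  x + v; x - v; y + u; y - u].
have [M MP] := choice (common_columns ps).
have MN N : (N <= M N)%N by case: (MP N).
pose f z N := rect_poly t z (M N) N.
have near z : z \in ps -> ccvg (fun N => f z N - poly_lim z N) 0.
  move=> zp; apply: (ccvg_le _ cvg_harmonic) => N; rewrite subr0.
  by case: (MP N) => _; apply.
have fb z : z \in ps -> cbdd (f z).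
  by move=> zp; exact: cbdd_null (poly_lim_bdd z) (near z zp).
have near2 a b : a \in ps -> b \in ps ->
    ccvg (fun N => f a N * f b N - poly_lim a N * poly_lim b N) 0.
  by move=> ap bp; apply: null_subM; [exact: fb|exact: poly_lim_bdd|exact: near|exact: near].
have near4 a b c d : a \in ps -> b \in ps -> c \in ps -> d \in ps ->
    ccvg (fun N => f a N * f b N * (f c N * f d N) -
      poly_lim a N * poly_lim b N * (poly_lim c N * poly_lim d N)) 0.
  move=> ap bp cp dp; apply: null_subM; [|apply: cbddM; exact: poly_lim_bdd| |].
  - by apply: cbddM; exact: fb.
  - exact: near2.
  - exact: near2.
have fT : ccvg (fun N => three_term (f^~ N) x y u v) 0.
  have h1 := near4 (x + y) (x - y) (u + v) (u - v).
  have h2 := near4 (x + u) (x - u) (y + v) (y - v).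
  have h3 := near4 (x + v) (x - v) (y + u) (y - u).
  rewrite !inE !eqxx !orbT in h1 h2 h3.
  have := ccvgD (ccvgD (ccvgB (h1 isT isT isT isT) (h2 isT isT isT isT))
    (h3 isT isT isT isT)) (poly_lim_three_term x y u v).
  rewrite subr0 !addr0; apply: eq_ccvg => N; rewrite /three_term.
  set a1 := f _ _ * _ * _; set a2 := f _ _ * _ * _; set a3 := f _ _ * _ * _.
  set b1 := poly_lim _ _ * _ * _; set b2 := poly_lim _ _ * _ * _.
  by set b3 := poly_lim _ _ * _ * _; ring.
have fw : cbdd (fun N => f w N ^+ k).
  have wp : w \in ps by rewrite inE eqxx.
  elim: (k) => [|j IH]; first by exists 1 => N; rewrite expr0 cn1.
  have [C CP] := cbddM (fb w wp) IH; exists C => N.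
  by rewrite exprS; exact: CP.
pose s z N := rect_sigma t z (M N) N.
have sl z : ccvg (s z) (lat_sigma z) by exact: rect_sigma_cvg.
have sT : ccvg (fun N => s w N ^+ k * three_term (s^~ N) x y u v)
    (lat_sigma w ^+ k * three_term lat_sigma x y u v).
  apply: ccvgM; first exact: ccvgX.
  by apply: ccvgD; [apply: ccvgB|]; apply: ccvgM; apply: ccvgM; exact: sl.
have : lat_sigma w ^+ k * three_term lat_sigma x y u v = 0.
  apply: ccvg_uniq sT _; have := null_cbddM fT fw; apply: eq_ccvg => N.
  pose S := rect_invsq t (M N) N.
  pose E := cexp (S * W).
  have sw : s w N ^+ k = E^-1 * f w N ^+ k.
    rewrite /s rect_sigmaE exprMn -cexpMn -cexpN; congr (cexp _ * _).
    by rewrite -/S -mulrnAr -[w ^+ 2 *+ k]mulr_natl kw mulrN.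
  have s4 a b c d : a ^+ 2 + b ^+ 2 + (c ^+ 2 + d ^+ 2) = W ->
      s a N * s b N * (s c N * s d N) = E * (f a N * f b N * (f c N * f d N)).
    move=> abcd; rewrite /s !rect_sigmaE -/S.
    have -> : E = cexp (S * a ^+ 2) * cexp (S * b ^+ 2) *
        (cexp (S * c ^+ 2) * cexp (S * d ^+ 2)).
      by rewrite -!cexpD -!mulrDr abcd.
    rewrite /f; ring.
  rewrite sw /three_term !s4; [|rewrite /W; ring..].
  by field; rewrite /E cexp_neq0.
by move/eqP; rewrite mulf_eq0 (negbTE w0) => /eqP.
Qed.

End SigmaLimit.

(** * Partial fractions of sigma quotients *)

Section PartialFractions.
Variables (K : fieldType) (e : K -> K) (L : K -> Prop).
Hypothesis eN : forall x, e (- x) = - e x.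
Hypothesis e0 : e 0 = 0.
Hypothesis e3 : forall x y u v,
  e (x + y) * e (x - y) * (e (u + v) * e (u - v)) -
  e (x + u) * e (x - u) * (e (y + v) * e (y - v)) +
  e (x + v) * e (x - v) * (e (y + u) * e (y - u)) = 0.
Hypothesis eL : forall x, e x = 0 -> L x.
Hypothesis LB : forall x y, L x -> L y -> L (x - y).
Hypothesis char2 : (2 : K) != 0.

Definition pf_term (xs ys : seq K) (x : K) : K :=
  (\prod_(y <- ys) e (x - y)) / \prod_(x' <- xs | x' != x) e (x - x').

(* The functions e (x - a) e (x - (c - a)) of x span a space of dimension 2. *)
Lemma exchange_zeros c a i j x :
  e (x - a) * e (x - (c - a)) * (e (i - j) * e (i + j - c)) =
  e (j - a) * e (j - (c - a)) * - (e (x - i) * e (x - (c - i))) +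
  e (i - a) * e (i - (c - a)) * (e (x - j) * e (x - (c - j))).
Proof.
(* Translation by c / 2 makes the zeros a and c - a opposite, so that [e3] applies. *)
pose h := c / 2.
have c2 : c = h + h by rewrite /h; field.
have := e3 (x - h) (a - h) (i - h) (j - h).
rewrite (_ : x - h + (a - h) = x - (c - a)); last by rewrite c2; ring.
rewrite (_ : x - h - (a - h) = x - a); last by ring.
rewrite (_ : i - h + (j - h) = i + j - c); last by rewrite c2; ring.
rewrite (_ : i - h - (j - h) = i - j); last by ring.
rewrite (_ : x - h + (i - h) = x - (c - i)); last by rewrite c2; ring.
rewrite (_ : x - h - (i - h) = x - i); last by ring.
rewrite (_ : x - h + (j - h) = x - (c - j)); last by rewrite c2; ring.
rewrite (_ : x - h - (j - h) = x - j); last by ring.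
rewrite (_ : a - h + (i - h) = i - (c - a)); last by rewrite c2; ring.
rewrite (_ : a - h - (i - h) = - (i - a)); last by ring.
rewrite (_ : a - h + (j - h) = j - (c - a)); last by rewrite c2; ring.
rewrite (_ : a - h - (j - h) = - (j - a)); last by ring.
rewrite !eN => h0; apply/eqP; rewrite -subr_eq0 -{}h0; apply/eqP; ring.
Qed.

(** A zero placed at a node kills the term of that node and cancels one factor of the denominator in
    every other term. *)
Lemma pf_sum_rem xs ys i z : uniq xs ->
  (forall x x', x \in xs -> x' \in xs -> x != x' -> e (x - x') != 0) ->
  i \in xs ->
  \sum_(x <- xs) pf_term xs (i :: z :: ys) x =
  \sum_(x <- rem i xs) pf_term (rem i xs) (z :: ys) x.
Proof.
move=> uxs nz ix; rewrite (big_rem i)//=.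
have -> : pf_term xs (i :: z :: ys) i = 0.
  by rewrite /pf_term big_cons subrr e0 !mul0r.
rewrite add0r !big_seq; apply: eq_bigr => x.
rewrite (mem_rem_uniq _ uxs) inE => /andP[xi xx].
rewrite /pf_term (big_rem i (r := xs))//= eq_sym xi big_cons invfM.
have exi : e (x - i) != 0 by apply: nz.
by rewrite mulrACA divff// mul1r.
Qed.

(** Induction on the number of nodes. By [exchange_zeros] the pair of zeros (ya, yb) is a
    combination of the pairs (i, c - i) and (j, c - j) with the same sum; for nodes i and j, each
    resulting sum loses one node and one zero and stays balanced. *)
Theorem partial_fractions n xs ys : size xs = n.+2 -> size ys = n.+2 ->
  uniq xs ->
  (forall x x', x \in xs -> x' \in xs -> x != x' -> ~ L (x - x')) ->
  \sum_(x <- xs) x = \sum_(y <- ys) y ->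
  \sum_(x <- xs) pf_term xs ys x = 0.
Proof.
elim: n xs ys => [|n IH] xs ys sx sy uxs nL bal.
  case: xs sx uxs nL bal => [|x1 [|x2 []]]//= _; rewrite inE andbT => x12 nL.
  case: ys sy => [|y1 [|y2 []]]//= _; rewrite !big_cons !big_nil !addr0 => bal.
  have e12 : e (x1 - x2) != 0.
    by apply/eqP => /eL; apply: nL; rewrite ?inE ?eqxx ?orbT.
  rewrite /pf_term !big_cons !big_nil !eqxx /= (eq_sym x2) x12 !mulr1.
  have -> : x2 - y1 = - (x1 - y2) by rewrite -[x1](addrK x2) bal; ring.
  have -> : x2 - y2 = - (x1 - y1) by rewrite -[x1](addrK x2) bal; ring.
  by rewrite -(opprB x1 x2) !eN; field; rewrite e12 oppr_eq0 e12.
case: ys sy bal => [|ya [|yb ys]]//= [sy]; rewrite !big_cons => bal.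
have nz x x' : x \in xs -> x' \in xs -> x != x' -> e (x - x') != 0.
  by move=> xx xx' xx'0; apply/eqP => /eL; exact: nL.
pose c := ya + yb.
(* Three nodes suffice: if e vanished at both x0 + x1 - c and x0 + x2 - c, the difference x1 - x2
   would lie in [L]. *)
have [i [j [ix jx ij ijc]]] : exists i j,
    [/\ i \in xs, j \in xs, i != j & e (i + j - c) != 0].
  case: xs sx uxs nL {bal nz} => [|x0 [|x1 [|x2 xs]]]//= _.
  rewrite !inE !negb_or => /and4P[/and3P[x01 x02 _] /andP[x12 _] _ _] nL.
  have [h1|] := eqVneq (e (x0 + x1 - c)) 0; last first.
    by exists x0, x1; rewrite !inE !eqxx ?orbT.
  have [h2|] := eqVneq (e (x0 + x2 - c)) 0; last first.
    by exists x0, x2; rewrite !inE !eqxx ?orbT.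
  exfalso; apply: (nL x1 x2); rewrite ?inE ?eqxx ?orbT//.
  have := LB (eL h1) (eL h2).
  by rewrite (_ : x0 + x1 - c - (x0 + x2 - c) = x1 - x2); last by ring.
have eij := nz _ _ ix jx ij.
have D0 : e (i - j) * e (i + j - c) != 0 by rewrite mulf_neq0.
have zero k : k \in xs -> \sum_(x <- xs) pf_term xs (k :: c - k :: ys) x = 0.
  move=> kx; rewrite pf_sum_rem//; apply: IH.
  - by rewrite size_rem// sx.
  - by rewrite /= sy.
  - exact: rem_uniq.
  - by move=> x x' /mem_rem xx /mem_rem xx'; exact: nL.
  rewrite big_cons; apply: (addrI k); rewrite -(big_rem (F := id) k kx (P := xpredT)).
  by rewrite bal /c; ring.
apply: (mulIf D0); rewrite mul0r mulr_suml.
pose A := - (e (j - ya) * e (j - yb)); pose B := e (i - ya) * e (i - yb).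
rewrite (eq_bigr (fun x => A * pf_term xs (i :: c - i :: ys) x +
   B * pf_term xs (j :: c - j :: ys) x)) => [|x _].
  by rewrite big_split/= -!mulr_sumr (zero _ ix) (zero _ jx) !mulr0 addr0.
rewrite /pf_term !big_cons.
set P := \prod_(y <- ys) _; set Q := (\prod_(x' <- xs | _) _)^-1.
have := exchange_zeros c ya i j x; rewrite (_ : c - ya = yb); last first.
  by rewrite /c; ring.
move=> h; transitivity (e (x - ya) * e (x - yb) * (e (i - j) * e (i + j - c)) * (P * Q)).
  by ring.
by rewrite h /A /B; ring.
Qed.

End PartialFractions.

(** Apply the adjugate to A q = (0, ..., 0, h) and read the last coordinate, where q is 1: only the
    last diagonal cofactor meets h. *)
Lemma det_last_col (K : comNzRingType) n (A : 'M[K]_n.+1) (q : 'cV[K]_n.+1) (h : K) :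
  (forall i, (A *m q) i ord0 = if i == ord_max then h else 0) ->
  q ord_max ord0 = 1 ->
  \det A = h * \det (\matrix_(i < n, k < n) A (widen_ord (leqnSn n) i) (widen_ord (leqnSn n) k)).
Proof.
move=> Aq q1.
have : (\adj A *m A *m q) ord_max ord0 = \det A.
  by rewrite mul_adj_mx mul_scalar_mx mxE q1 mulr1.
rewrite -mulmxA mxE (bigD1 ord_max)//= Aq eqxx big1 ?addr0 => [<-|i /negbTE im]; last first.
  by rewrite Aq im mulr0.
rewrite mulrC; congr (_ * _); rewrite mxE /cofactor -signr_odd addnn odd_double mul1r.
congr (\det _); apply/matrixP => i k; rewrite !mxE.
by congr (A _ _); apply/val_inj; rewrite /= /bump leqNgt ltn_ord.
Qed.

(** * The Weierstrass product over squares *)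

Definition signfold (K : comNzRingType) (G : int -> K) (m : nat) : K :=
  if m is m'.+1 then G m'.+1%:Z * G (- m'.+1%:Z) else G 0.

Lemma prod_signfold (K : comNzRingType) (G : int -> K) N :
  \prod_(i <- iota 0 N.*2.+1) G (i%:Z - N%:Z) = \prod_(0 <= m < N.+1) signfold G m.
Proof.
rewrite -[X in iota 0 X]subn0 -/(index_iota 0 _) big_mkord.
rewrite (prod_center (fun i => G (i%:Z - N%:Z))) big_ltn// subrr; congr (_ * _).
rewrite big_add1 big_mkord; apply: eq_bigr => -[m mN] _ /=.
by congr (G _ * G _); lia.
Qed.

Section SigmaLink.
Variables (R : realType) (om1 : R) (om3 : R[i]).
Hypothesis om1_gt0 : 0 < om1.
Hypothesis om3_re : complex.Re om3 = 0.
Hypothesis om3_im : 0 < complex.Im om3.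

Let t : R := complex.Im om3 / om1.
Let t0 : 0 < t. Proof. exact: divr_gt0. Qed.
Let p : R[i] := 2 * om1%:C.
Let p0 : p != 0.
Proof. by rewrite mulf_neq0 ?pnatr_eq0// fmorph_eq0 gt_eqF. Qed.
Notation sigma := (weierstrass_sigma om1%:C om3).

Lemma lattice_pointE m n :
  lattice_point om1%:C om3 m n = p * (m%:~R + n%:~R * tau t).
Proof.
have -> : om3 = om1%:C * tau t.
  rewrite /tau /t; case: om3 om3_re => a b /= ->.
  apply/eqP; rewrite eq_complex/=; apply/andP; split; apply/eqP; first by ring.
  by field; rewrite gt_eqF.
rewrite /lattice_point /p; ring.
Qed.

Let F (z l : R[i]) : R[i] :=
  if l != 0 then (1 - z / l) * cexp (z / l + (z / l) ^+ 2 / 2) else 1.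

Lemma F_pair (z h : R[i]) : h != 0 -> F z (p * h) * F z (- (p * h)) = wfac (z / p) h.
Proof.
move=> h0; have ph : p * h != 0 by rewrite mulf_neq0.
rewrite /F oppr_eq0 ph /wfac.
have -> : z / - (p * h) = - (z / (p * h)) by rewrite invrN mulrN.
have -> : (z / p) ^+ 2 / h ^+ 2 = (z / (p * h)) ^+ 2 by field; rewrite p0 h0.
set r := z / (p * h); rewrite sqrrN mulrACA -cexpD; congr (_ * cexp _); first by ring.
by field.
Qed.

(** The sign choices for both coordinates group into opposite pairs, one for each element of
    [halfpts]. *)
Lemma signfold_gridfac (z : R[i]) m n :
  signfold (fun a => signfold (fun b => F z (lattice_point om1%:C om3 a b)) n) m =
  gridfac t (z / p) m n.
Proof.
have k0 k : (k.+1%:R : R[i]) != 0 by rewrite pnatr_eq0.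
case: m n => [|m] [|n]; rewrite /signfold /gridfac /= ?big_cons big_nil ?mulr1 !lattice_pointE.
- by rewrite mul0r addr0 mulr0 /F eqxx.
- rewrite !add0r !(rmorphN, mulNr, mulrN) F_pair//.
  by rewrite -[_ * _]addr0 tauD_neq0.
- by rewrite !mulr0z !mul0r !addr0 mulrNz mulrN -!pmulrn F_pair.
have h1 : n.+1%:R * tau t + m.+1%:R != 0 by rewrite tauD_neq0// Im_nat.
have h2 : n.+1%:R * tau t - m.+1%:R != 0.
  by rewrite tauD_neq0// -[m.+1%:R](rmorph_nat (real_complex R)) /= oppr0.
rewrite -(F_pair z h1) -(F_pair z h2).
rewrite -!pmulrn.
have e1 : p * ((- m.+1%:Z)%:~R + (- n.+1%:Z)%:~R * tau t) =
   - (p * (n.+1%:R * tau t + m.+1%:R)).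
  by rewrite !rmorphN /= -!pmulrn; ring.
have e2 : p * ((- m.+1%:Z)%:~R + n.+1%:R * tau t) = p * (n.+1%:R * tau t - m.+1%:R).
  by rewrite !rmorphN /= -!pmulrn; ring.
have e3 : p * (m.+1%:R + (- n.+1%:Z)%:~R * tau t) = - (p * (n.+1%:R * tau t - m.+1%:R)).
  by rewrite !rmorphN /= -!pmulrn; ring.
rewrite e1 e2 e3 [m.+1%:R + _]addrC; ring.
Qed.

Lemma weierstrass_sigmaE (z : R[i]) : sigma z = p * lat_sigma t (z / p).
Proof.
rewrite /weierstrass_sigma /lat_sigma [RHS]mulrA [p * (z / p)]mulrC divfK//; congr (_ * clim _).
apply/funext => N; rewrite big_mkcond /lattice_square big_allpairs_dep /rect.
pose G a b := F z (lattice_point om1%:C om3 a b).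
rewrite (prod_signfold (fun a => \prod_(j <- iota 0 N.*2.+1) G a (j%:Z - N%:Z))).
apply: eq_bigr => m _; transitivity (\prod_(0 <= n < N.+1)
    signfold (fun a => signfold (G a) n) m); last first.
  by apply: eq_bigr => n _; rewrite signfold_gridfac.
have e a := prod_signfold (G a) N.
by case: m => [|m]; rewrite [LHS]/signfold !e // -big_split.
Qed.

Lemma weierstrass_sigmaN (z : R[i]) : sigma (- z) = - sigma z.
Proof.
rewrite !weierstrass_sigmaE /lat_sigma mulNr mulNr mulrN; congr (- (_ * (_ * clim _))).
apply/funext => N; apply: eq_bigr => m _; apply: eq_bigr => n _.
by apply: eq_bigr => l _; rewrite /wfac sqrrN.
Qed.

Lemma weierstrass_sigma_eq0 (z : R[i]) : sigma z = 0 -> lattice om1%:C om3 z.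
Proof.
rewrite weierstrass_sigmaE => /eqP; rewrite mulf_eq0 (negbTE p0) /= => /eqP h.
apply: contrapT => zL; move/eqP: h; apply/negP; apply: (lat_sigma_neq0 t0) => m n.
apply/eqP => zE; apply: zL; exists m, n.
by rewrite lattice_pointE -zE mulrC divfK.
Qed.

Lemma weierstrass_three_term x y u v : three_term sigma x y u v = 0.
Proof.
have := lat_sigma_three_term t0 (x / p) (y / p) (u / p) (v / p).
rewrite /three_term !weierstrass_sigmaE -!mulrDl -!mulrBl => h.
by rewrite -(mulr0 (p ^+ 4)) -h; ring.
Qed.

Lemma latticeB x y : lattice om1%:C om3 x -> lattice om1%:C om3 y ->
  lattice om1%:C om3 (x - y).
Proof.
move=> [m [n ->]] [m' [n' ->]]; exists (m - m'), (n - n').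
by rewrite !lattice_pointE !rmorphB; ring.
Qed.

End SigmaLink.

(** * Orthogonality and Toeplitz determinants *)

Lemma big_iota_ord (T : Type) (idx : T) (op : T -> T -> T) n (F : nat -> T) :
  \big[op/idx]_(j <- iota 0 n) F j = \big[op/idx]_(j < n) F j.
Proof. by rewrite -[X in iota 0 X]subn0 -/(index_iota 0 n) big_mkord. Qed.

Section EllipticOrthogonality.
Variables (K : fieldType) (e : K -> K) (L : K -> Prop).
Hypothesis eN : forall x, e (- x) = - e x.
Hypothesis e0 : e 0 = 0.
Hypothesis e3 : forall x y u v,
  e (x + y) * e (x - y) * (e (u + v) * e (u - v)) -
  e (x + u) * e (x - u) * (e (y + v) * e (y - v)) +
  e (x + v) * e (x - v) * (e (y + u) * e (y - u)) = 0.
Hypothesis eL : forall x, e x = 0 -> L x.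
Hypothesis LB : forall x y, L x -> L y -> L (x - y).
Hypothesis char0 : forall n : nat, (n.+1%:R : K) != 0.

Variables (a b : K).
Hypothesis Lint : forall k : int, k != 0 -> ~ L k%:~R.
Hypothesis La : forall k : int, ~ L (a + k%:~R).
Hypothesis Lb1 : forall n : nat, ~ L (b + n%:R * a).
Hypothesis Lb2 : forall n : nat, ~ L (b + n%:R * (a + 1)).

Definition poch (x : K) (n : nat) : K := \prod_(i < n) e (x + i%:R).

Lemma pochS x n : poch x n.+1 = poch x n * e (x + n%:R).
Proof. by rewrite /poch big_ord_recr. Qed.

Lemma poch_rev x n : poch x n = (-1) ^+ n * poch (1 - x - n%:R) n.
Proof.
rewrite /poch (reindex_inj rev_ord_inj) -[X in (-1) ^+ X]card_ord -prodr_const.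
rewrite -big_split; apply: eq_bigr => -[i iN] _ /=.
by rewrite mulN1r -eN natrB//; congr e; rewrite -natr1; ring.
Qed.

Let enz x : ~ L x -> e x != 0.
Proof. by move=> xL; apply/eqP => /eL. Qed.

Let eint (k : int) : k != 0 -> e k%:~R != 0.
Proof. by move=> /Lint/enz. Qed.

Let ea (k : int) : e (a + k%:~R) != 0.
Proof. by apply: enz; exact: La. Qed.

Lemma poch1_neq0 n : poch 1 n != 0.
Proof.
by apply/prodf_neq0 => i _; rewrite nat1r (eint (k := i.+1%:Z)).
Qed.

Lemma pocha_neq0 (k : int) n : poch (a + k%:~R) n != 0.
Proof.
apply/prodf_neq0 => i _.
by rewrite (_ : _ + _ + _ = a + (k + i%:Z)%:~R) ?ea// rmorphD addrA.
Qed.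

Lemma nat_inj : injective (fun s : nat => s%:R : K).
Proof.
have h m n : (m < n)%N -> m%:R != n%:R :> K.
  move=> mn; rewrite -(subnK mn) -addSnnS natrD eq_sym -subr_eq0 addrK.
  exact: char0.
move=> m n /eqP mn; apply/eqP; case: ltngtP mn => // /h; first by move=> /negbTE ->.
by rewrite eq_sym => /negbTE ->.
Qed.

Let nodes n : seq K := [seq s%:R | s <- iota 0 n.+1].
Let cst n : K := \prod_(j < n) e (- j.+1%:R).

(** The nodes below s give [1]_s; those above give e(-1) ... e(-(n - s)), which [-n]_s completes to
    all e(-j) with 1 <= j <= n. *)
Lemma poch_nodes n s : (s <= n)%N ->
  poch (- n%:R) s * \prod_(x <- nodes n | x != s%:R) e (s%:R - x) = poch 1 s * cst n.
Proof.
move=> sn; rewrite /nodes big_map.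
rewrite (eq_bigl (fun j => j != s)) => [|j]; last by rewrite (inj_eq nat_inj).
rewrite -(subnKC sn) -addnS iotaD big_cat/= add0n big_cons eqxx.
rewrite big_seq_cond (eq_bigl (fun j => j \in iota 0 s)) => [|j]; last first.
  by rewrite mem_iota; case: ltngtP; rewrite ?andbF ?andbT.
rewrite -big_seq [X in _ * (_ * X)]big_seq_cond.
rewrite [X in _ * (_ * X)](eq_bigl (fun j => j \in iota s.+1 (n - s))); last first.
  by move=> j; rewrite mem_iota; case: ltngtP; rewrite ?andbF ?andbT.
rewrite -big_seq; set d := (n - s)%N.
have -> : \prod_(j <- iota 0 s) e (s%:R - j%:R) = poch 1 s.
  rewrite -[X in iota 0 X]subn0 -/(index_iota 0 s) big_mkord /poch.
  rewrite (reindex_inj rev_ord_inj); apply: eq_bigr => -[i iN] _ /=.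
  by congr e; rewrite natrB// -natr1; ring.
have -> : \prod_(j <- iota s.+1 d) e (s%:R - j%:R) = \prod_(j < d) e (- j.+1%:R).
  rewrite -[X in iota X _]addn0 iotaDl big_map.
  rewrite -[X in iota 0 X]subn0 -/(index_iota 0 d) big_mkord.
  by apply: eq_bigr => j _; congr e; rewrite natrD -!natr1; ring.
rewrite mulrCA; congr (_ * _); rewrite mulrC /cst addnC big_split_ord/=; congr (_ * _).
rewrite /poch (reindex_inj rev_ord_inj); apply: eq_bigr => -[i iN] _ /=.
by congr e; rewrite natrB// -addnS !natrD; ring.
Qed.

(** Turns [a+1]_s / [a+1-n]_s into n factors that vanish in s at the points j - a, over a constant;
    these points become the zeros in the partial fraction. *)
Lemma poch_shift n s :
  poch (a + 1) s * \prod_(j < n) e (a - j%:R) =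
  poch (a + 1 - n%:R) s * \prod_(j < n) e (s%:R + a - j%:R).
Proof.
elim: s => [|s IH].
  by rewrite /poch !big_ord0 !mul1r; apply: eq_bigr => j _; rewrite add0r.
rewrite !pochS mulrAC IH -!mulrA; congr (_ * _).
have h : \prod_(j < n.+1) e (s.+1%:R + a - j%:R) =
    e (s.+1%:R + a) * \prod_(j < n) e (s%:R + a - j%:R).
  rewrite big_ord_recl/= subr0; congr (_ * _); apply: eq_bigr => j _.
  by congr e; rewrite /bump/= -!natr1; ring.
rewrite (_ : a + 1 - n%:R + s%:R = s.+1%:R + a - n%:R); last by rewrite -natr1; ring.
have h' : \prod_(j < n.+1) e (s.+1%:R + a - j%:R) =
    \prod_(j < n) e (s.+1%:R + a - j%:R) * e (s.+1%:R + a - n%:R).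
  by rewrite big_ord_recr.
rewrite [RHS]mulrC -h' h mulrC; congr (e _ * _).
by rewrite -natr1; ring.
Qed.

Let X n : K := - (a + 1) * n%:R - b.

(** The series coefficient with [X+1]_s / [X]_s already collapsed to [X+s] / [X], so that of these
    factors only [X] has to be nonzero. *)
Definition orth_coef (n s : nat) : K :=
  poch (- n%:R) s * poch (a + 1) s * e (X n + s%:R) /
  (poch 1 s * poch (a + 1 - n%:R) s * e (X n)).

Let eX n : e (X n) != 0.
Proof.
rewrite (_ : X n = - (b + n%:R * (a + 1))) ?eN ?oppr_eq0; last by rewrite /X; ring.
by apply: enz; exact: Lb2.
Qed.

Let apoch n s : poch (a + 1 - n%:R) s != 0.
Proof.
rewrite (_ : a + 1 - n%:R = a + (1 - n%:Z)%:~R) ?pocha_neq0//.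
by rewrite rmorphB addrA.
Qed.

Let cst_neq0 n : cst n != 0.
Proof.
apply/prodf_neq0 => j _; rewrite eN oppr_eq0.
by rewrite (eint (k := j.+1%:Z)).
Qed.

Let anode n : \prod_(j < n) e (a - j%:R) != 0.
Proof.
apply/prodf_neq0 => j _; rewrite (_ : a - j%:R = a + (- j%:Z)%:~R) ?ea//.
by rewrite rmorphN.
Qed.

Definition orth_scale (n : nat) : K :=
  poch (- a) n / poch (a + 1) n * (e (a * n%:R + b + n%:R) / e (a * n%:R + b)).

(** Reversal turns [-n]_n into [1]_n and [a+1-n]_n into [-a]_n with the same sign, and X + n = - (a
    n + b), so everything cancels. *)
Lemma orth_scale_coef n : orth_scale n * orth_coef n n = 1.
Proof.
have an : poch (a + 1) n != 0 by rewrite -[1](rmorph1 (intmul 1)) pocha_neq0.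
have h1 := poch_rev (- n%:R) n; rewrite (_ : 1 - - n%:R - n%:R = 1) in h1; last by ring.
have h2 := poch_rev (a + 1 - n%:R) n.
rewrite (_ : 1 - (a + 1 - n%:R) - n%:R = - a) in h2; last by ring.
have an' : poch (- a) n != 0.
  by have := apoch n n; rewrite h2 mulf_eq0 negb_or => /andP[].
have e1 : e (X n + n%:R) = - e (a * n%:R + b).
  by rewrite -eN; congr e; rewrite /X; ring.
have e2 : e (X n) = - e (a * n%:R + b + n%:R).
  by rewrite -eN; congr e; rewrite /X; ring.
have b1 : e (a * n%:R + b) != 0.
  by rewrite mulrC addrC; apply: enz; exact: Lb1.
have b2 : e (a * n%:R + b + n%:R) != 0 by rewrite -oppr_eq0 -e2 eX.
rewrite /orth_scale /orth_coef h1 h2 e1 e2.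
have s0 : (-1) ^+ n != 0 :> K by rewrite expf_neq0// oppr_eq0 oner_eq0.
have p1 := poch1_neq0 n.
by field; rewrite ?oppr_eq0 ?an ?an' ?b1 ?b2 ?s0 ?p1.
Qed.

Lemma orth_scale_neq0 n : orth_scale n != 0.
Proof.
by apply/eqP => h; have /eqP := orth_scale_coef n; rewrite h mul0r eq_sym oner_eq0.
Qed.

Let kap n : K := cst n / (\prod_(j < n) e (a - j%:R) * e (X n)).

Lemma orth_coefE n s : (s <= n)%N ->
  orth_coef n s * \prod_(x <- nodes n | x != s%:R) e (s%:R - x) =
  kap n * (\prod_(j < n) e (s%:R + a - j%:R) * e (X n + s%:R)).
Proof.
move=> sn; have h1 := poch_nodes sn; have h2 := poch_shift n s.
rewrite /orth_coef /kap; have p1 := poch1_neq0 s; have p2 := apoch n s.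
have x0 := eX n; have a0 := anode n.
set N := \prod_(x <- _ | _) _ in h1 *; set A := \prod_(j < n) e (a - _) in h2 a0 *.
set B := \prod_(j < n) _ in h2 *.
transitivity ((poch (- n%:R) s * N) * (poch (a + 1) s * A) * e (X n + s%:R) /
  (poch 1 s * poch (a + 1 - n%:R) s * e (X n) * A)); first by field; rewrite p1 p2 x0 a0.
by rewrite h1 h2; field; rewrite p1 p2 x0 a0.
Qed.

(** The zeros - X, i - a - b and j - a balance the nodes 0, ..., n and i - a, so the sum is minus
    the term at i - a. Its numerator contains the product of e (i - j) over j < n, which vanishes
    exactly when i < n. *)
Lemma orth_sum n i : (i <= n)%N ->
  exists2 h : K, (h != 0) = (i == n) &
  \sum_(s < n.+1) orth_coef n s *
     (e (s%:R - i%:R + b + a) / e (s%:R - i%:R + a)) = h.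
Proof.
move=> iN; eexists; last by [].
pose xs := (i%:R - a) :: nodes n.
pose ys := - X n :: (i%:R - a - b) :: [seq j%:R - a | j <- iota 0 n].
have ni j : i%:R - a - j%:R = - (a + (j%:Z - i%:Z)%:~R) :> K.
  by rewrite rmorphB; ring.
have LN x : L x -> L (- x).
  by move=> xL; rewrite -(sub0r x) -{1}(subrr x); exact: LB (LB xL xL) xL.
have an j : i%:R - a != j%:R.
  apply/eqP => h; case: (@La (j%:Z - i%:Z)).
  by rewrite (_ : a + _ = 0); [exact: eL|rewrite rmorphB /= -!pmulrn -h; ring].
have uxs : uniq xs.
  rewrite cons_uniq map_inj_uniq ?iota_uniq ?andbT; last exact: nat_inj.
  by apply/mapP => -[j _ /eqP]; rewrite (negbTE (an j)).
have szs : size ys = n.+2 by rewrite /= size_map size_iota.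
have szx : size xs = n.+2 by rewrite /= size_map size_iota.
have bal : \sum_(x <- xs) x = \sum_(y <- ys) y.
  rewrite /xs /ys big_cons [in RHS]big_cons [in RHS]big_cons /nodes !big_map.
  rewrite !big_iota_ord big_ord_recr/=.
  rewrite sumrB sumr_const card_ord -[a *+ n]mulr_natr /X; ring.
have sep x x' : x \in xs -> x' \in xs -> x != x' -> ~ L (x - x').
  rewrite [x \in xs]in_cons [x' \in xs]in_cons => /predU1P[->|/mapP[j _ ->]] /predU1P[->|/mapP[k _ ->]].
  - by rewrite eqxx.
  - by move=> _; rewrite ni => /LN; rewrite opprK; exact: La.
  - by move=> _; rewrite -opprB ni opprK; exact: La.
  move=> jk; rewrite (_ : _ - _ = (j%:Z - k%:Z)%:~R); last by rewrite rmorphB.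
  by apply: Lint; apply: contraNneq jk => h; rewrite (_ : j = k)//; lia.
have ysE x : \prod_(y <- ys) e (x - y) = e (x + X n) * (e (x - i%:R + a + b) *
    \prod_(j < n) e (x + a - j%:R)).
  rewrite /ys big_cons big_cons big_map big_iota_ord opprK; congr (_ * (e _ * _)).
    by ring.
  by apply: eq_bigr => j _; congr e; ring.
have xsE x : \prod_(x' <- xs | x' != x) e (x - x') =
    (if i%:R - a != x then e (x - i%:R + a) else 1) *
    \prod_(x' <- nodes n | x' != x) e (x - x').
  rewrite /xs big_cons; case: ifP => _; last by rewrite mul1r.
  by congr (e _ * _); ring.
have := partial_fractions eN e0 e3 eL LB (char0 1) szx szs uxs sep bal.
rewrite big_cons => /eqP; rewrite addrC addr_eq0 => /eqP pf.
have -> : \sum_(s < n.+1) orth_coef n s *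
     (e (s%:R - i%:R + b + a) / e (s%:R - i%:R + a)) =
   kap n * \sum_(x <- nodes n) pf_term e xs ys x.
  rewrite mulr_sumr [in RHS]/nodes big_map big_iota_ord.
  apply: eq_bigr => -[s sn] _ /=.
  have sn' : (s <= n)%N by [].
  have := orth_coefE sn'; set N := \prod_(x <- _ | _) _ => hN.
  have N0 : N != 0.
    rewrite /N prodf_seq_neq0; apply/allP => x xn; apply/implyP => xs0.
    apply: enz; apply: sep; last by rewrite eq_sym.
      by rewrite in_cons map_f ?orbT// mem_iota.
    by rewrite in_cons xn orbT.
  rewrite /pf_term ysE xsE an -/N.
  have d0 : e (s%:R - i%:R + a) != 0.
    rewrite (_ : _ + a = a + (s%:Z - i%:Z)%:~R) ?ea//.
    by rewrite rmorphB; ring.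
  set B := \prod_(j < n) _ in hN *.
  have -> : orth_coef n s = kap n * (B * e (X n + s%:R)) / N by rewrite -hN mulfK.
  have -> : s%:R - i%:R + a + b = s%:R - i%:R + b + a by ring.
  by rewrite [s%:R + X n]addrC; field; rewrite N0 d0.
rewrite pf /pf_term ysE xsE eqxx /= mul1r.
have k0 : kap n != 0.
  by rewrite /kap mulf_neq0 ?invr_eq0 ?mulf_neq0.
have N0 : \prod_(x <- nodes n | x != i%:R - a) e (i%:R - a - x) != 0.
  rewrite prodf_seq_neq0; apply/allP => x /mapP[j _ ->].
  by apply/implyP => _; rewrite ni eN oppr_eq0 ea.
rewrite mulrN oppr_eq0 mulf_eq0 (negbTE k0) /= mulf_eq0 invr_eq0 (negbTE N0) orbF.
rewrite !mulf_eq0.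
have -> : i%:R - a - i%:R + a + b = b + 0%:R * a by rewrite mul0r; ring.
rewrite (negbTE (enz (@Lb1 0))) /=.
case: (ltngtP i n) iN => // [iN|->] _.
  apply/negbTE; rewrite negbK; apply/orP; right; rewrite (bigD1 (Ordinal iN))//=.
  by rewrite (_ : i%:R - a + a - i%:R = 0) ?e0 ?mul0r//; ring.
(* The zero - X brings in b + (n + 1) a: the condition on b + m a is used at m = 0 and m = n + 1. *)
rewrite (_ : n%:R - a + X n = - (b + n.+1%:R * a)); last by rewrite /X -natr1; ring.
rewrite eN oppr_eq0 (negbTE (enz (@Lb1 _))) /=.
apply/prodf_neq0 => -[j jn] _ /=.
rewrite (_ : n%:R - a + a - j%:R = (n%:Z - j%:Z)%:~R); last by rewrite rmorphB; ring.
by apply: eint; lia.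
Qed.

End EllipticOrthogonality.

(** * Toeplitz determinants and polynomials of an orthogonal system *)

Section ToeplitzFromOrthogonality.
Variables (R : realType) (c : int -> R[i]) (q : nat -> nat -> R[i]).
Hypothesis q1 : forall n, q n n = 1.
Hypothesis qc : forall n i, (i <= n)%N ->
  (\sum_(s < n.+1) c (s%:Z - i%:Z) * q n s != 0) = (i == n).

(** [det_last_col] gives the recursion Delta_(n+1) = h_n Delta_n, with h_n the nonzero sum at i =
    n. *)
Lemma toeplitz_det_neq0 n : toeplitz_det c n != 0.
Proof.
elim: n => [|n IH]; first by rewrite /toeplitz_det det_mx00 oner_neq0.
pose h := \sum_(s < n.+1) c (s%:Z - n%:Z) * q n s.
have h0 : h != 0 by rewrite /h qc ?eqxx.
rewrite /toeplitz_det (@det_last_col _ _ _ (\col_s q n s) h).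
- rewrite mulf_neq0//; move: IH; rewrite /toeplitz_det.
  by congr (\det _ != 0); apply/matrixP => i k; rewrite !mxE.
- move=> i; rewrite mxE (eq_bigr (fun s : 'I_n.+1 => c (s%:Z - i%:Z) * q n s)).
    case: eqP => [->//|/eqP im]; apply/eqP.
    have := qc (leq_ord i); rewrite (negbTE (_ : (i : nat) != n)) => [/negbFE//|].
    by apply: contraNneq im => h1; apply/eqP/val_inj.
  by move=> s _; rewrite !mxE.
- by rewrite mxE q1.
Qed.

(** [det_last_col] over the polynomial ring: the row of monomials, applied to the coefficients,
    gives the candidate polynomial in the role of h. *)
Lemma toeplitz_polyE n : toeplitz_poly c n = \poly_(s < n.+1) q n s.
Proof.
pose P : {poly R[i]} := \poly_(s < n.+1) q n s.
rewrite /toeplitz_poly (@det_last_col _ _ _ (\col_s (q n s)%:P) P).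
- set M := (\matrix_(i, k) _ : 'M_n).
  have -> : \det M = (toeplitz_det c n)%:P.
    rewrite /toeplitz_det -det_map_mx; congr (\det _); apply/matrixP => i k.
    by rewrite !mxE /= ltn_ord.
  by rewrite mulrC mul_polyC scalerA mulVf ?scale1r ?toeplitz_det_neq0.
- move=> i; rewrite mxE; case: (eqVneq i ord_max) => [->|im].
    rewrite /P poly_def; apply: eq_bigr => s _.
    by rewrite !mxE /= ltnn mulrC mul_polyC.
  have iN : (i < n)%N.
    by rewrite ltn_neqAle leq_ord andbT; apply: contraNneq im => h; apply/eqP/val_inj.
  rewrite (eq_bigr (fun s : 'I_n.+1 => (c (s%:Z - i%:Z) * q n s)%:P)) => [|s _]; last first.
    by rewrite !mxE iN polyCM.
  rewrite -rmorph_sum; have := qc (ltnW iN); rewrite ltn_eqF// => /negbFE /eqP ->.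
  by rewrite rmorph0.
- by rewrite mxE q1.
Qed.

Lemma toeplitz_poly_monic n : toeplitz_poly c n \is monic.
Proof. by rewrite toeplitz_polyE monicE lead_coef_poly ?q1 ?oner_neq0. Qed.

Lemma horner_toeplitz_poly n z :
  (toeplitz_poly c n).[z] = \sum_(s < n.+1) q n s * z ^+ s.
Proof. by rewrite toeplitz_polyE horner_poly. Qed.

End ToeplitzFromOrthogonality.

(** * Cancellation in the hypergeometric coefficients *)

Lemma ell_quot_cancel (R : realType) (om1 om3 : R[i]) (w : R)
    (cs num den num' den' : seq R[i]) :
  perm_eq num (cs ++ num') -> perm_eq den (cs ++ den') ->
  ell_quot om1 om3 w num den = ell_quot om1 om3 w num' den'.
Proof.
move=> pn pd; rewrite /ell_quot.
pose E x := ell_num om1 om3 w x ^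
  ((count_mem x num')%:Z - (count_mem x den')%:Z).
rewrite (eq_bigr E) => [|x _]; last first.
  rewrite /E (permP pn) (permP pd) !count_cat; congr (_ ^ _).
  by rewrite !PoszD; ring.
rewrite (bigID (mem (num' ++ den')))/= [X in _ * X]big1 ?mulr1; last first.
  move=> x; rewrite mem_cat negb_or => /andP[/count_memPn xn /count_memPn xd].
  by rewrite /E xn xd subrr expr0z.
rewrite -big_filter; apply: perm_big; apply: uniq_perm.
- by rewrite filter_uniq// undup_uniq.
- exact: undup_uniq.
move=> x; rewrite mem_filter !mem_undup andb_idr// !mem_cat.
by rewrite (perm_mem pn) (perm_mem pd) !mem_cat => /orP[->|->]; rewrite ?orbT.
Qed.

(* The upper parameter y + 1 and the lower parameter y only contribute
   [y + s] / [y], the common factors [y + 1] ... [y + s - 1] being cancelled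
   even where they vanish. *)
Lemma ell_quot_shift (R : realType) (om1 om3 : R[i]) (w : R)
    (u v d y : R[i]) s :
  (forall j, (j < s)%N -> ell_num om1 om3 w (1 + j%:R) != 0) ->
  (forall j, (j < s)%N -> ell_num om1 om3 w (d + j%:R) != 0) ->
  ell_num om1 om3 w y != 0 ->
  ell_quot om1 om3 w (flatten [seq poch_args x s | x <- [:: u; v; y + 1]])
    (flatten [seq poch_args x s | x <- [:: 1; d; y]]) =
  ell_poch om1 om3 w u s * ell_poch om1 om3 w v s * ell_num om1 om3 w (y + s%:R) /
  (ell_poch om1 om3 w 1 s * ell_poch om1 om3 w d s * ell_num om1 om3 w y).
Proof.
move=> n1 nd ny; case: s n1 nd => [|s] n1 nd.
  rewrite /ell_poch !big_ord0 /= addr0 !mul1r divff//.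
  by rewrite /ell_quot /= big_nil.
pose cs := poch_args (y + 1) s.
have p1 : poch_args (y + 1) s.+1 = rcons cs (y + s.+1%:R).
  rewrite /poch_args -addn1 iotaD map_cat/= cats1 add0n; congr rcons.
  by rewrite natrD; ring.
have p2 : poch_args y s.+1 = y :: cs.
  rewrite /poch_args/= addr0; congr cons; rewrite -[1%N]addn0 iotaDl -map_comp.
  by apply: eq_map => j /=; rewrite natrD addrA.
rewrite (@ell_quot_cancel _ _ _ _ cs _ _
  (poch_args u s.+1 ++ poch_args v s.+1 ++ [:: y + s.+1%:R])
  (poch_args 1 s.+1 ++ poch_args d s.+1 ++ [:: y])); first last.
- rewrite -[map _ _]/[:: poch_args 1 s.+1; poch_args d s.+1; poch_args y s.+1].
  rewrite -[flatten _]/(poch_args 1 s.+1 ++ poch_args d s.+1 ++ poch_args y s.+1 ++ [::]).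
  rewrite cats0 p2 -[y :: cs]cat1s; apply/permP => pr.
  by rewrite !count_cat; lia.
- rewrite -[map _ _]/[:: poch_args u s.+1; poch_args v s.+1; poch_args (y + 1) s.+1].
  rewrite -[flatten _]/(poch_args u s.+1 ++ poch_args v s.+1 ++ poch_args (y + 1) s.+1 ++ [::]).
  rewrite cats0 p1 -cats1; apply/permP => pr.
  by rewrite !count_cat [RHS]addnCA; congr addn; rewrite addnCA.
have pE x : \prod_(z <- poch_args x s.+1) ell_num om1 om3 w z =
    ell_poch om1 om3 w x s.+1.
  by rewrite /poch_args big_map big_iota_ord.
rewrite ell_quotE.
  by rewrite !big_cat !big_seq1 /= !pE !mulrA.
move=> z; rewrite !mem_cat => /or3P[/mapP[j]|/mapP[j]|]; rewrite ?mem_iota ?add0n.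
- by move=> /= js ->; exact: n1.
- by move=> /= js ->; exact: nd.
by rewrite inE => /eqP ->.
Qed.

Lemma cexp_subz (R : realType) (x : R[i]) (s i : nat) :
  cexp (x * (s%:Z - i%:Z)%:~R) = cexp x ^+ s / cexp x ^+ i.
Proof.
by rewrite rmorphB/= mulrBr cexpD cexpN -!pmulrn !mulr_natr !cexpMn.
Qed.

Theorem proposition1 (R : realType) (om1 : R) (om3 : R[i]) (w : R)
    (al be ga : R[i])
    (om1_gt0 : 0 < om1)
    (om3_re : complex.Re om3 = 0) (om3_im : 0 < complex.Im om3)
    (w_incomm : forall N1 N2 : int, (N1, N2) != (0, 0) ->
       w * N1%:~R != om1 * N2%:~R)
    (al_nondeg : ~ exists (k : int) (l : R[i]),
       lattice om1%:C om3 l /\ al = w%:C * k%:~R + l)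
    (be_nondeg : forall n : nat,
       ~ lattice om1%:C om3 (be + n%:R * al) /\
       ~ lattice om1%:C om3 (be + n%:R * (al + w%:C)))
    (n : nat) :
  let c := ell_moment om1%:C om3 w al be ga in
  let P := toeplitz_poly c n in
  let ell := ell_num om1%:C om3 w in
  let ellp := ell_poch om1%:C om3 w in
  let ah := al / w%:C in
  let bh := be / w%:C in
  let B := cexp (ga * w%:C * n%:R)
           * (ellp (- ah) n / ellp (ah + 1) n)
           * (ell (ah * n%:R + bh + n%:R) / ell (ah * n%:R + bh)) in
  P \is monic /\
  forall z : R[i],
    P.[z] = B * ellE_terminating om1%:C om3 w n
                  [:: ah + 1; - (ah + 1) * n%:R - bh + 1]
                  [:: ah + 1 - n%:R; - (ah + 1) * n%:R - bh]
                  (z * cexp (- ga * w%:C)).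
Proof.
move=> c P ell ellp ah bh B.
pose S := weierstrass_sigma om1%:C om3.
(* After division by w the step of the nodes is 1, and the lattice is pulled back along x -> w x. *)
pose L x := lattice om1%:C om3 (w%:C * x).
have w0 : w != 0.
  by apply/eqP => w0; have := w_incomm 1 0 isT; rewrite w0 mul0r mulr0 eqxx.
have wC0 : (w%:C : R[i]) != 0 by rewrite fmorph_eq0.
have Lint (k : int) : k != 0 -> ~ L k%:~R.
  move=> k0 [m [n' /(congr1 (@complex.Re R))]].
  (* [om3] is imaginary, so a lattice point has real part 2 om1 m; membership would give w k = om1
     (2 m). *)
  have := w_incomm k (2 * m); rewrite xpair_eqE negb_and k0 => /(_ isT) /negP wk.
  rewrite /lattice_point -!(rmorph_int (real_complex R)).
  have -> : om3 = 'i * (complex.Im om3)%:C by rewrite {1}[om3]complexE om3_re add0r.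
  by rewrite /= => h; apply: wk; apply/eqP; rewrite rmorphM /=; lra.
have SL x : S x = 0 -> lattice om1%:C om3 x.
  exact: (weierstrass_sigma_eq0 om1_gt0 om3_re om3_im).
have Sw0 : S w%:C != 0.
  apply/eqP => /SL h; apply: (Lint 1) => //.
  by rewrite /L mulr1.
have eN x : ell (- x) = - ell x.
  by rewrite /ell /ell_num mulrN (weierstrass_sigmaN om1_gt0 om3_re om3_im) mulNr.
have e0 : ell 0 = 0 by rewrite /ell /ell_num /weierstrass_sigma !(mulr0, mul0r).
have e3 x y u v :
    ell (x + y) * ell (x - y) * (ell (u + v) * ell (u - v)) -
    ell (x + u) * ell (x - u) * (ell (y + v) * ell (y - v)) +
    ell (x + v) * ell (x - v) * (ell (y + u) * ell (y - u)) = 0.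
  have := weierstrass_three_term om1_gt0 om3_re om3_im
    (w%:C * x) (w%:C * y) (w%:C * u) (w%:C * v).
  rewrite /three_term /ell /ell_num -!mulrDr -!mulrBr => h.
  by rewrite -(mul0r ((S w%:C)^-1 ^+ 4)) -h -/S; ring.
have eL x : ell x = 0 -> L x.
  rewrite /ell /ell_num => /eqP; rewrite mulf_eq0 invr_eq0 (negbTE Sw0) orbF.
  by move=> /eqP /SL.
have LB x y : L x -> L y -> L (x - y).
  by rewrite /L mulrBr; exact: (latticeB om1_gt0 om3_re).
have char0 (j : nat) : (j.+1%:R : R[i]) != 0 by rewrite pnatr_eq0.
have wah : w%:C * ah = al by rewrite /ah mulrC divfK.
have wbh : w%:C * bh = be by rewrite /bh mulrC divfK.
have La (k : int) : ~ L (ah + k%:~R).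
  rewrite /L mulrDr wah => h; apply: al_nondeg; exists (- k), (al + w%:C * k%:~R).
  by split => //; rewrite mulrNz; ring.
have Lb1 (m : nat) : ~ L (bh + m%:R * ah).
  by rewrite /L mulrDr [w%:C * (m%:R * _)]mulrCA wah wbh; case: (be_nondeg m).
have Lb2 (m : nat) : ~ L (bh + m%:R * (ah + 1)).
  rewrite /L mulrDr [w%:C * (m%:R * _)]mulrCA [w%:C * (ah + 1)]mulrDr mulr1 wah wbh.
  by case: (be_nondeg m).
have Sbe : S be != 0.
  by apply/eqP => /SL; have := Lb1 0%N; rewrite /L mul0r addr0 wbh.
pose g := cexp (ga * w%:C).
have g0 : g != 0 by exact: cexp_neq0.
(* g^m comes from the prefactor B and g^-s from the argument z exp (- gamma w); the latter cancels
   g^s in the moment, leaving only factors independent of s. *)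
pose q m s := g ^+ m * orth_scale ell ah bh m * g^-1 ^+ s * orth_coef ell ah bh m s.
have q1 m : q m m = 1.
  rewrite /q -(orth_scale_coef eN eL Lint La Lb1 Lb2 m) exprVn.
  by field; rewrite expf_neq0.
have scale0 m : orth_scale ell ah bh m != 0.
  exact: (orth_scale_neq0 eN eL Lint La Lb1 Lb2).
have cE s i : c (s%:Z - i%:Z) = cexp (ga * al) / S be * (g ^+ s / g ^+ i) *
    (ell (s%:R - i%:R + bh + ah) / ell (s%:R - i%:R + ah)).
  rewrite /c /ell_moment cexpD cexp_subz -/g /ell /ell_num -/S.
  have -> : w%:C * (s%:Z - i%:Z)%:~R + be + al = w%:C * (s%:R - i%:R + bh + ah).
    by rewrite !mulrDr wah wbh rmorphB/= mulrBr -!pmulrn; ring.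
  have -> : w%:C * (s%:Z - i%:Z)%:~R + al = w%:C * (s%:R - i%:R + ah).
    by rewrite !mulrDr wah rmorphB/= mulrBr -!pmulrn; ring.
  have frac (A D : R[i]) : A / S w%:C / (D / S w%:C) = A / D.
    by rewrite [(D / _)^-1]invfM invrK mulrACA [_^-1 * S _]mulVf// mulr1.
  by rewrite frac [(_ * S be)^-1]invfM; ring.
have qc m i : (i <= m)%N ->
    (\sum_(s < m.+1) c (s%:Z - i%:Z) * q m s != 0) = (i == m).
  move=> im; have [h <- hE] := orth_sum eN e0 e3 eL LB char0 Lint La Lb1 Lb2 im.
  have -> : \sum_(s < m.+1) c (s%:Z - i%:Z) * q m s =
     cexp (ga * al) / S be / g ^+ i * g ^+ m * orth_scale ell ah bh m * h.
    rewrite -hE mulr_sumr; apply: eq_bigr => s _; rewrite cE /q exprVn.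
    have gs : g ^+ s != 0 by rewrite expf_neq0.
    move: (g ^+ s) gs (ell _ / ell _) => G G0 E.
    by rewrite -[RHS]mul1r -(divff G0); ring.
  have C0 : cexp (ga * al) / S be / g ^+ i * g ^+ m * orth_scale ell ah bh m != 0.
    apply: (mulf_neq0 _ (scale0 m)); apply: (mulf_neq0 _ (expf_neq0 m g0)).
    apply: mulf_neq0; last by rewrite invr_eq0 expf_neq0.
    by apply: mulf_neq0; [exact: cexp_neq0|rewrite invr_eq0].
  by rewrite mulf_eq0 negb_or C0.
split; first exact: toeplitz_poly_monic q1 qc n.
move=> z; rewrite (horner_toeplitz_poly q1 qc) /ellE_terminating mulr_sumr.
apply: eq_bigr => -[s sn] _ /=.
rewrite /ellE_term; set y := - (ah + 1) * n%:R - bh.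
have -> : ellE_M om1%:C om3 w (- n%:R :: [:: ah + 1; y + 1]) [:: ah + 1 - n%:R; y] = 0.
  rewrite /ellE_M !big_cons !big_nil (_ : 1 + _ - _ = 0) ?mulr0//; ring.
have y0 : ell y != 0.
  rewrite (_ : y = - (bh + n%:R * (ah + 1))); last by rewrite /y; ring.
  by rewrite eN oppr_eq0; apply/eqP => /eL; exact: Lb2.
rewrite mul0r cexp0 mulr1 (@ell_quot_shift _ _ _ _ (- n%:R) (ah + 1) (ah + 1 - n%:R) y s)//.
- rewrite /q /B exprMn (_ : cexp (- ga * w%:C) = g^-1); last first.
    by rewrite mulNr cexpN.
  rewrite (_ : cexp (ga * w%:C * n%:R) = g ^+ n); last by rewrite mulr_natr cexpMn.
  have pE x k : ell_poch om1%:C om3 w x k = poch ell x k by [].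
  rewrite /orth_scale /orth_coef -/y /ellp !pE -/ell; ring.
- by move=> j _; rewrite nat1r; apply/eqP => /eL; exact: (Lint j.+1%:Z).
move=> j _; apply/eqP => /eL.
rewrite (_ : ah + 1 - n%:R + j%:R = ah + (1 - n%:Z + j%:Z)%:~R); first exact: La.
by rewrite rmorphD rmorphB/= -!pmulrn; ring.
Qed.
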